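(* Let $n\ge 2$, let $X_1,\dots,X_n$ be homeomorphic, path-connected CW-complexes, and for $1\le i<j\le n$ let $\phi_{i,j}:X_i\to X_j$ be a homeomorphism. Let $A_1,A_2$ be homeomorphic subcomplexes of $X_1$, and assume that there is an automorphism (self-homeomorphism) $\psi$ of $X_1$ with $\psi(A_1)=A_2$ and $\psi(A_2)=A_1$. Let $P_n$ be the space obtained from these data by the iterated gluing construction described in the context. Let $F_{A_2}$ be the homotopy fibre of the inclusion $A_2\hookrightarrow X_1$. Then there is a homotopy equivalence \[\Omega P_n\simeq \Omega X_1\times \Omega F,\qquad\text{where } F\simeq \bigvee_{i=1}^{n-1}\Sigma F_{A_2}.\]
   Context: $\Omega$ denotes the based loop space and $\Sigma$ the suspension. Construction of $P_n$. The space $P_2$ is the pushout of $X_1\hookleftarrow A_2\xrightarrow{f_2}X_2$, where $A_2\hookrightarrow X_1$ is the inclusion and $f_2$ is the composite \[A_2\xrightarrow{\psi|_{A_2}}A_1\xrightarrow{\phi_{1,2}|_{A_1}}\phi_{1,2}(A_1)\hookrightarrow X_2.\] Inductively, for $n\ge 3$, $P_n$ is the pushout of $P_{n-1}\hookleftarrow \phi_{1,n-1}(A_2)\xrightarrow{f_n}X_n$, where $\phi_{1,n-1}(A_2)\subseteq X_{n-1}$ is included in $P_{n-1}$ via the copy of $X_{n-1}$ contained in $P_{n-1}$, and $f_n$ is the composite \[\phi_{1,n-1}(A_2)\xrightarrow{\phi_{1,n-1}^{-1}|_{\phi_{1,n-1}(A_2)}}A_2\xrightarrow{\psi|_{A_2}}A_1\xrightarrow{\phi_{1,n}|_{A_1}}\phi_{1,n}(A_1)\hookrightarrow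 X_n.\] Thus the copy of $A_2$ in $X_{n-1}$ is glued to the copy of $A_1$ in $X_n$. *)

(* Defs.v *)
From HB Require Import structures.
From Stdlib Require Import Relation_Operators Operators_Properties.
From mathcomp Require Import all_boot all_order all_algebra generic_quotient.
From mathcomp Require Import all_classical all_reals all_analysis homotopy.

Set Implicit Arguments.
Unset Strict Implicit.
Unset Printing Implicit Defensive.

Import Order.TTheory GRing.Theory Num.Theory.
Import numFieldNormedType.Exports.

Local Open Scope classical_set_scope.
Local Open Scope ring_scope.
Local Open Scope quotient_scope.

(* [pwedge] needs a pointed index type. *)
HB.instance Definition _ (m : nat) := isPointed.Build 'I_m.+1 ord0.

(* The unit interval, as a bipointed space, so that the library's path spaces
   [{path I01 R from x to y in X}] (with the compact-open topology) apply. *)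
Definition I01 (R : realType) : Type := set_type `[0 : R, 1].

Section unit_interval.
Context (R : realType).

HB.instance Definition _ := Topological.copy (I01 R) (set_type `[0 : R, 1]).

Fact zero01_subproof : (0 : R) \in `[0 : R, 1]%classic.
Proof. by rewrite inE /= in_itv /= lexx ler01. Qed.

Fact one01_subproof : (1 : R) \in `[0 : R, 1]%classic.
Proof. by rewrite inE /= in_itv /= ler01 lexx. Qed.

Definition zero01 : I01 R := exist _ 0 zero01_subproof.
Definition one01 : I01 R := exist _ 1 one01_subproof.

Fact zero01_neq_one01 : zero01 != one01.
Proof.
by apply/eqP => -[] /eqP; rewrite eq_sym oner_eq0.
Qed.

HB.instance Definition _ := isBiPointed.Build (I01 R) zero01_neq_one01.

End unit_interval.

Section homotopy.
Context (R : realType).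

Definition homeomorphism (X Y : topologicalType) (f : X -> Y) : Prop :=
  continuous f /\
  exists g : Y -> X, [/\ continuous g, cancel f g & cancel g f].

Definition homeomorphic (X Y : topologicalType) : Prop :=
  exists f : X -> Y, homeomorphism f.

Definition path_connected (X : topologicalType) : Prop :=
  forall x y : X, inhabited {path (I01 R) from x to y in X}.

Definition homotopic (X Y : topologicalType) (f g : X -> Y) : Prop :=
  exists H : X * I01 R -> Y,
    [/\ continuous H, forall x, H (x, zero) = f x & forall x, H (x, one) = g x].

Definition homotopy_equivalent (X Y : topologicalType) : Prop :=
  exists (f : X -> Y) (g : Y -> X),
    [/\ continuous f, continuous g, homotopic (g \o f) id
      & homotopic (f \o g) id].

Definition pointed_homotopic (X Y : ptopologicalType) (f g : X -> Y) : Prop :=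
  exists H : X * I01 R -> Y,
    [/\ continuous H, forall x, H (x, zero) = f x, forall x, H (x, one) = g x
      & forall t, H (point, t) = point].

Definition pointed_homotopy_equivalent (X Y : ptopologicalType) : Prop :=
  exists (f : X -> Y) (g : Y -> X),
    [/\ continuous f /\ f point = point, continuous g /\ g point = point,
        pointed_homotopic (g \o f) id & pointed_homotopic (f \o g) id].

Definition loop_space (X : topologicalType) (x : X) : topologicalType :=
  {path (I01 R) from x to x in X}.

Section homotopy_fibre.
Context (A X : topologicalType) (f : A -> X) (a0 : A).

(* The homotopy fibre of [f] over [f a0], based at the constant path. *)
Definition hofiber_set : set (A * {compact-open, I01 R -> X}) :=
  [set p | [/\ continuous (p.2 : I01 R -> X), p.2 zero = f p.1
             & p.2 one = f a0]].

Definition hofiber : Type := set_type hofiber_set.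

HB.instance Definition _ := Topological.copy hofiber (set_type hofiber_set).

Fact hofiber_point_subproof : (a0, cst (f a0)) \in hofiber_set.
Proof. by rewrite inE; split=> //; exact: cst_continuous. Qed.

Definition hofiber_point : hofiber := SigSub hofiber_point_subproof.

HB.instance Definition _ := isPointed.Build hofiber hofiber_point.

End homotopy_fibre.

(* The reduced suspension of [Y]: the quotient of the cylinder [Y * I01 R] that
   collapses both ends and the segment over the base point to a single point. *)
Section suspension.
Context (Y : ptopologicalType).

Definition susp_collapsed : set (Y * I01 R) :=
  [set z | [\/ z.2 = zero, z.2 = one | z.1 = point]].

Definition susp_rel_def (u v : Y * I01 R) : bool :=
  (u == v) || ((u \in susp_collapsed) && (v \in susp_collapsed)).

Fact susp_rel_refl : reflexive susp_rel_def.
Proof. by move=> u; rewrite /susp_rel_def eqxx. Qed.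

Fact susp_rel_sym : symmetric susp_rel_def.
Proof. by move=> u v; rewrite /susp_rel_def eq_sym andbC. Qed.

Fact susp_rel_trans : transitive susp_rel_def.
Proof.
rewrite /susp_rel_def => v u w /orP[/eqP -> //|/andP[uS vS]].
by case/orP=> [/eqP <-|/andP[_ wS]]; rewrite uS ?vS ?wS orbT.
Qed.

Definition susp_rel := EquivRel _ susp_rel_refl susp_rel_sym susp_rel_trans.

Definition suspension := {eq_quot susp_rel}.

HB.instance Definition _ :=
  Topological.copy suspension (quotient_topology suspension).
HB.instance Definition _ := Quotient.on suspension.
HB.instance Definition _ := isPointed.Build suspension
  (\pi_suspension (point, zero)).

End suspension.

Section cw_complex.

Definition sqnorm n (x : 'rV[R]_n) : R := \sum_i x 0 i ^+ 2.

Definition disc n : set 'rV[R]_n := [set x | sqnorm x <= 1].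
Arguments disc n : clear implicits.

Definition disc_interior n : set (disc n) := [set x | sqnorm (set_val x) < 1].

Definition disc_boundary n : set (disc n) := [set x | sqnorm (set_val x) = 1].

(* A CW structure in the sense of Whitehead.  That each characteristic map is a
   homeomorphism from the open disc onto its cell follows from [cw_inj] and the
   remaining fields, discs being compact and [X] Hausdorff. *)
Record cw_structure (X : topologicalType) := CWStructure {
  cw_index : Type;
  cw_dim : cw_index -> nat;
  cw_char : forall e : cw_index, disc (cw_dim e) -> X;
  cw_cell : cw_index -> set X :=
    fun e => @cw_char e @` @disc_interior (cw_dim e);
  cw_hausdorff : hausdorff_space X;
  cw_char_continuous : forall e, continuous (@cw_char e);
  cw_inj : forall e, set_inj (@disc_interior (cw_dim e)) (@cw_char e);
  cw_disjoint : trivIset setT cw_cell;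
  cw_cover : \bigcup_e cw_cell e = setT;
  cw_closure_finite : forall e, exists S : set cw_index,
    [/\ finite_set S, forall e', S e' -> (cw_dim e' < cw_dim e)%N
      & @cw_char e @` @disc_boundary (cw_dim e)
          `<=` \bigcup_(e' in S) cw_cell e'];
  cw_weak : forall B : set X,
    (forall e, closed (@cw_char e @^-1` B)) -> closed B
}.

Definition is_cw_complex (X : topologicalType) : Prop :=
  inhabited (cw_structure X).

Definition subcomplex (X : topologicalType) (K : cw_structure X) (A : set X) :
  Prop :=
  exists S : set (cw_index K),
    A = \bigcup_(e in S) cw_cell e /\
    forall e, S e -> closure (cw_cell e) `<=` A.

End cw_complex.

End homotopy.

(* The pushout of [B <-g- C -f-> Y]: the disjoint union of [B] (tag [true]) and
   [Y] (tag [false]) modulo the equivalence relation generated by [g c ~ f c]. *)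
Section pushout.
Context (B C Y : topologicalType) (g : C -> B) (f : C -> Y).

Definition po_family (b : bool) : topologicalType := if b then B else Y.

Definition po_inB (x : B) : {b : bool & po_family b} :=
  existT (fun b => po_family b) true x.

Definition po_inY (y : Y) : {b : bool & po_family b} :=
  existT (fun b => po_family b) false y.

Definition po_glue (u v : {b : bool & po_family b}) : Prop :=
  exists c : C, u = po_inB (g c) /\ v = po_inY (f c).

Definition po_rel_def (u v : {b : bool & po_family b}) : bool :=
  `[< clos_refl_sym_trans _ po_glue u v >].

Fact po_rel_refl : reflexive po_rel_def.
Proof. by move=> u; apply/asboolP; exact: rst_refl. Qed.

Fact po_rel_sym : symmetric po_rel_def.
Proof. by move=> u v; apply/asboolP/asboolP; exact: rst_sym. Qed.

Fact po_rel_trans : transitive po_rel_def.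
Proof.
by move=> v u w /asboolP uv /asboolP vw; apply/asboolP; exact: rst_trans uv vw.
Qed.

Definition po_rel := EquivRel _ po_rel_refl po_rel_sym po_rel_trans.

Definition pushout := {eq_quot po_rel}.

HB.instance Definition _ :=
  Topological.copy pushout (quotient_topology pushout).
HB.instance Definition _ := Quotient.on pushout.

Definition pushout_inl (x : B) : pushout := \pi_pushout (po_inB x).
Definition pushout_inr (y : Y) : pushout := \pi_pushout (po_inY y).

End pushout.

(* The iterated gluing.  Families are indexed by [nat] with the indices
   1, ..., n of interest; other values are never used. *)
Section gluing.
Context (X : nat -> topologicalType) (phi : forall i j : nat, X i -> X j).
Context (A2 : set (X 1)) (psi : X 1 -> X 1).

(* [P_k] together with the copies of [X_1] and [X_k] in it. *)
Record gluing_stage (k : nat) := GluingStage {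
  stage_space : topologicalType;
  stage_first : X 1 -> stage_space;
  stage_last : X k -> stage_space
}.

(* The restricted inverse of [phi 1 k] on the image of [A2]; the choice of a
   preimage is unique because [phi 1 k] is assumed injective. *)
Definition phi_inv (k : nat) (c : phi k @` A2) : X 1 :=
  projT1 (cid2 (set_valP c)).

Definition glue_f2 (a : A2) : X 2 := phi 2 (psi (set_val a)).

Definition glue_f (k : nat) (c : phi k @` A2) : X k.+1 :=
  phi k.+1 (psi (phi_inv c)).

Definition P2_stage : gluing_stage 2 :=
  GluingStage (pushout_inl (set_val : A2 -> X 1) glue_f2)
              (pushout_inr (set_val : A2 -> X 1) glue_f2).

Definition next_stage (k : nat) (P : gluing_stage k) : gluing_stage k.+1 :=
  let g : phi k @` A2 -> stage_space P := fun c => stage_last P (set_val c) in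
  GluingStage (fun x => pushout_inl g (@glue_f k) (stage_first P x))
              (pushout_inr g (@glue_f k)).

Fixpoint P_stage (m : nat) : gluing_stage m.+2 :=
  if m is m'.+1 then next_stage (P_stage m') else P2_stage.

(* [P_n], for [2 <= n], and its copy of [X_1]. *)
Definition P_space (n : nat) : topologicalType := stage_space (P_stage (n - 2)).
Definition P_first (n : nat) : X 1 -> P_space n := stage_first (P_stage (n - 2)).

End gluing.

(* Main.v *)
(** Up to homotopy [P_n] is a telescope: copies [X * {0}, ..., X * {n - 1}] of
    [X = X_1], joined by tubes over the subsets [psi^-i (A_2)] of [X]; this is
    where the homotopy extension property of subcomplexes is needed.  The
    telescope retracts onto its first copy of [X], so its loop space is the
    product of the loop space of [X] and that of the homotopy fibre of the
    retraction.  That fibre is again a telescope, now over the contractible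
    space of paths in [X] ending at [a0], and its tubes are all equivalent to
    [F_{A_2}], because [psi] followed by a change of base point identifies them.
    Contracting the copies of the path space leaves a chain of [n - 1] unreduced
    suspensions of [F_{A_2}], and collapsing the arc through the base points,
    which are nondegenerate, turns it into the wedge of reduced suspensions. *)

Require Import Defs.
From HB Require Import structures.
From mathcomp Require Import all_boot all_order all_algebra generic_quotient.
From mathcomp Require Import all_classical all_reals all_analysis homotopy.
From mathcomp Require Import lra.

Set Implicit Arguments.
Unset Strict Implicit.
Unset Printing Implicit Defensive.

Import Order.TTheory GRing.Theory Num.Theory.
Import numFieldNormedType.Exports.

Local Open Scope classical_set_scope.
Local Open Scope ring_scope.

(** The gluing maps of [P_n] twist by [psi]. For [k >= 2] the copy [X_k] is identified with [X_1]
    through [phi 1 k] after [psi^(k-1)], not through [phi 1 k] alone. This untwists the gluings: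
    each one then identifies equal points of [X_1], over a preimage of [A2] under a power of [psi],
    and only so does the telescope project to [X_1]. The telescope is a subspace of a product with
    the line, not a quotient. Maps into it are pairs of coordinates, so the fibre of its projection
    is a telescope up to homeomorphism; maps out of it are pasted from closed pieces. The spaces are
    arbitrary topological spaces, where a quotient map times an interval need not be a quotient map.
    Homotopies on CW complexes, pushouts, chains and wedges are therefore built as maps into path
    spaces with the compact-open topology, the interval being compact Hausdorff. Most homotopy
    equivalences are free. Base points matter only for loops, and there it suffices to know where
    each map sends the base point. *)

Implicit Types (R : realType) (X Y Z V W : topologicalType).

(** * Continuity *)

(* A named copy of [continuous], so that the tactic [ctsify] can recognise goals. *)
Definition cts X Y (f : X -> Y) : Prop := continuous f.

Section cts_rules.

Lemma cts_id X : cts (fun x : X => x).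
Proof. by move=> x; exact: cvg_id. Qed.

Lemma cts_cst X Y (y : Y) : cts (fun _ : X => y).
Proof. by move=> x; exact: cvg_cst. Qed.

Lemma cts_comp X Y Z (f : Y -> Z) (g : X -> Y) :
  cts f -> cts g -> cts (fun x => f (g x)).
Proof. by move=> cf cg x; apply: continuous_comp; [exact: cg|exact: cf]. Qed.

Lemma cts_pair X Y Z (f : X -> Y) (g : X -> Z) :
  cts f -> cts g -> cts (fun x => (f x, g x)).
Proof. by move=> cf cg x; apply: cvg_pair; [exact: cf|exact: cg]. Qed.

Lemma cts_fst X Y Z (f : X -> Y * Z) : cts f -> cts (fun x => (f x).1).
Proof. by apply: cts_comp => -[a b]; exact: cvg_fst. Qed.

Lemma cts_snd X Y Z (f : X -> Y * Z) : cts f -> cts (fun x => (f x).2).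
Proof. by apply: cts_comp => -[a b]; exact: cvg_snd. Qed.

Lemma cts_val X Y (A : set Y) (f : X -> A) : cts f -> cts (fun x => set_val (f x)).
Proof. by apply: cts_comp; exact: initial_continuous. Qed.

Lemma cts_set_type X Y (A : set Y) (f : X -> A) :
  cts (fun x => set_val (f x)) -> cts f.
Proof. by move=> cf; apply: continuous_comp_initial. Qed.

Lemma cts_ext X Y (f g : X -> Y) : (forall x, g x = f x) -> cts f -> cts g.
Proof. by move=> /funext ->. Qed.

End cts_rules.

Section real_rules.
Context R X.
Implicit Types f g : X -> R.

Lemma cts_add f g : cts f -> cts g -> cts (fun x => f x + g x).
Proof. by move=> cf cg x; apply: continuousD; [exact: cf|exact: cg]. Qed.

Lemma cts_opp f : cts f -> cts (fun x => - f x).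
Proof. by move=> cf x; apply: continuousN; exact: cf. Qed.

Lemma cts_mul f g : cts f -> cts g -> cts (fun x => f x * g x).
Proof. by move=> cf cg x; apply: continuousM; [exact: cf|exact: cg]. Qed.

Lemma cts_max f g : cts f -> cts g -> cts (fun x => Num.max (f x) (g x)).
Proof. by move=> cf cg x; apply: continuous_max; [exact: cf|exact: cg]. Qed.

Lemma cts_min f g : cts f -> cts g -> cts (fun x => Num.min (f x) (g x)).
Proof. by move=> cf cg x; apply: continuous_min; [exact: cf|exact: cg]. Qed.

Lemma cts_inv f : (forall x, f x != 0) -> cts f -> cts (fun x => (f x)^-1).
Proof. by move=> f0 cf x; apply: continuousV; [exact: f0|exact: cf]. Qed.

Lemma cts_norm f : cts f -> cts (fun x => `|f x|).
Proof. by apply: cts_comp; exact: norm_continuous. Qed.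

End real_rules.

Section clamp.
Context R.

(** The retraction of the line onto [0, 1]. Paths and homotopies carry a real parameter, so that
    ring arithmetic applies to it, and are cut off by [clamp] where a point of the interval is
    required. *)
Definition clamp (t : R) : R := Num.max 0 (Num.min 1 t).

Lemma cts_clamp X (f : X -> R) :
  cts f -> cts (fun x => clamp (f x)).
Proof.
by move=> cf; apply: cts_max; [exact: cts_cst|apply: cts_min=> //; exact: cts_cst].
Qed.

Lemma clamp01 t : 0 <= clamp t <= 1.
Proof. by rewrite /clamp le_max lexx ge_max ler01 ge_min lexx. Qed.

Lemma clamp_id t : 0 <= t <= 1 -> clamp t = t.
Proof. by move=> /andP[t0 t1]; rewrite /clamp (min_idPr t1) (max_idPr t0). Qed.

Lemma clamp_le0 t : t <= 0 -> clamp t = 0.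
Proof.
move=> t0; rewrite /clamp; apply/max_idPl; rewrite ge_min t0 orbT //.
Qed.

Lemma clamp_ge1 t : 1 <= t -> clamp t = 1.
Proof.
by move=> t1; rewrite /clamp (min_idPl t1); apply/max_idPr; exact: ler01.
Qed.

Lemma clamp0 : clamp 0 = 0. Proof. exact: clamp_le0. Qed.
Lemma clamp1 : clamp 1 = 1. Proof. exact: clamp_ge1. Qed.

Lemma clampK t : clamp (clamp t) = clamp t.
Proof. by rewrite clamp_id ?clamp01. Qed.

Definition to01 (t : R) : I01 R := insubd (zero01 R) (clamp t).

Lemma val_to01 t : set_val (to01 t) = clamp t.
Proof.
rewrite /to01 set_valE /= insubdK // unfold_in /= asboolE /=.
by rewrite in_itv /= clamp01.
Qed.

Lemma I01P (s : I01 R) : 0 <= set_val s <= 1.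
Proof. by have := set_valP s; rewrite /= in_itv. Qed.

Lemma to01K (s : I01 R) : to01 (set_val s) = s.
Proof. by apply: val_inj; rewrite -set_valE val_to01 clamp_id // I01P. Qed.

Lemma to01_0 : to01 0 = zero.
Proof. by apply: val_inj; rewrite -set_valE val_to01 clamp0. Qed.

Lemma to01_1 : to01 1 = one.
Proof. by apply: val_inj; rewrite -set_valE val_to01 clamp1. Qed.

Lemma val_zero : set_val (zero : I01 R) = 0. Proof. by []. Qed.
Lemma val_one : set_val (one : I01 R) = 1. Proof. by []. Qed.

Lemma to01_clamp t : to01 (clamp t) = to01 t.
Proof. by apply: val_inj; rewrite -!set_valE !val_to01 clampK. Qed.

Lemma cts_to01 X (f : X -> R) :
  cts f -> cts (fun x => to01 (f x)).
Proof.
move=> cf; apply: cts_set_type.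
by apply: (@cts_ext _ _ (fun x => clamp (f x))) => [x|]; [rewrite val_to01|exact: cts_clamp].
Qed.

End clamp.

(** Syntax-directed continuity: the rule is chosen by the head of the body, after an eta-expansion
    that exposes the binder. Any other head must have a continuity hypothesis in the context. *)
Ltac cts_eta :=
  lazymatch goal with
  | |- cts (fun _ => _) => idtac
  | |- @cts ?X ?Y ?f => change (@cts X Y (fun x => f x))
  end.
Ltac cts_step :=
  cts_eta;
  first
  [ assumption
  | match goal with
    | |- cts (fun x => x) => exact: cts_id
    | |- cts (fun _ => ?y) => exact: cts_cst
    | |- cts (fun x => (_, _)) => apply: cts_pair
    | |- cts (fun x => fst _) => apply: cts_fst
    | |- cts (fun x => snd _) => apply: cts_snd
    | |- cts (fun x => set_val _) => apply: cts_val
    | |- cts (fun x => _ + _) => apply: cts_add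
    | |- cts (fun x => - _) => apply: cts_opp
    | |- cts (fun x => _ * _) => apply: cts_mul
    | |- cts (fun x => Num.max _ _) => apply: cts_max
    | |- cts (fun x => Num.min _ _) => apply: cts_min
    | |- cts (fun x => clamp _) => apply: cts_clamp
    | |- cts (fun x => to01 _) => apply: cts_to01
    | |- cts (fun x => `|_|) => apply: cts_norm
    | |- cts (fun x => ?f (@?g x)) =>
        match goal with
        | H : cts f |- _ => refine (@cts_comp _ _ _ f g H _)
        | H : continuous f |- _ => refine (@cts_comp _ _ _ f g H _)
        end
    end ].
Ltac ctsify := repeat cts_step.

Section pasting.

Lemma closed_preimage X Y (f : X -> Y) (B : set Y) :
  cts f -> closed B -> closed (f @^-1` B).
Proof. by move=> cf cB; apply: preimage_closed => // x _; exact: cf. Qed.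

Lemma open_preimage X Y (f : X -> Y) (B : set Y) :
  cts f -> open B -> open (f @^-1` B).
Proof. by move=> cf cB; apply: open_comp => // x _; exact: cf. Qed.

Lemma cts_closed X Y (f : X -> Y) :
  (forall B, closed B -> closed (f @^-1` B)) -> cts f.
Proof.
move=> h; apply/continuousP => A oA; rewrite -closedC preimage_setC.
by apply: h; exact: open_closedC.
Qed.

(** A closed subset of the closed subspace [C i] is closed in [X], and the preimage of a closed set
    is a finite union of such subsets. *)
Lemma cts_cover X Y (I : choiceType) (s : set I)
    (C : I -> set X) (f : X -> Y) :
  finite_set s -> (forall i, s i -> closed (C i)) ->
  (forall x, exists2 i, s i & C i x) ->
  (forall i, s i -> cts (fun x : C i => f (set_val x))) -> cts f.
Proof.
move=> fs cC cov cf; apply: cts_closed => B cB.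
have -> : f @^-1` B = \bigcup_(i in s) (set_val @` ((fun x : C i => f (set_val x)) @^-1` B)).
  apply/seteqP; split=> [x Bx|x [i si [y /= By <-]]//].
  have [i si Cx] := cov x; exists i => //.
  by exists (SigSub (mem_set Cx)).
apply: closed_bigcup => // i si.
have [U oU UE] : open ((fun x : C i => f (set_val x)) @^-1` ~` B).
  by apply: open_preimage; [exact: cf|rewrite openC].
have -> : set_val @` ((fun x : C i => f (set_val x)) @^-1` B) = C i `&` ~` U.
  apply/seteqP; split=> [_ [y /= By <-]|x [Cx Ux]].
    split; first exact: set_valP.
    move=> Uy; have : (set_val @^-1` U) y by [].
    by rewrite UE.
  exists (SigSub (mem_set Cx)) => //=; apply: contrapT => nB; apply: Ux.
  by have : ((fun x : C i => f (set_val x)) @^-1` (~` B)) (SigSub (mem_set Cx)) by []; rewrite -UE.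
by apply: closedI; [exact: cC|rewrite closedC].
Qed.

Lemma closed_eqc R X (f : X -> R) (c : R) : cts f -> closed [set x | f x = c].
Proof. by move=> cf; exact: (closed_preimage cf (@closed_eq _ c)). Qed.

Lemma closed_lec R X (f : X -> R) (c : R) : cts f -> closed [set x | f x <= c].
Proof. by move=> cf; exact: (closed_preimage cf (@closed_le _ c)). Qed.

Lemma cts_cover2 X Y (A B : set X) (f : X -> Y) :
  closed A -> closed B -> (forall x, A x \/ B x) ->
  cts (fun x : A => f (set_val x)) -> cts (fun x : B => f (set_val x)) -> cts f.
Proof.
move=> cA cB AB fA fB.
apply: (@cts_cover _ _ bool setT (fun b => if b then A else B)).
- exact: finite_finset.
- by case.
- by move=> x; have [h|h] := AB x; [exists true|exists false].
- by case.
Qed.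

(** All piecewise formulas below test the sign of a continuous real function, so that only agreement
    on its zero set remains to be checked. *)
Lemma cts_if R X Y (F : X -> R) (f g : X -> Y) :
  cts F -> cts f -> cts g -> (forall x, F x = 0 -> f x = g x) ->
  cts (fun x => if F x <= 0 then f x else g x).
Proof.
move=> cF cf cg fg.
pose A := [set x | F x <= 0]; pose B := [set x | 0 <= F x].
apply: (@cts_cover2 _ _ A B).
- exact: closed_lec.
- exact: (@closed_preimage _ _ F [set y | 0 <= y] cF (@closed_ge _ 0)).
- by move=> x; apply/orP; exact: le_total.
- apply: (@cts_ext _ _ (fun x : A => f (set_val x))); last by ctsify.
  by move=> x; have /= -> := set_valP x.
- apply: (@cts_ext _ _ (fun x : B => g (set_val x))); last by ctsify.
  move=> x; have /= F0 := set_valP x; case: lerP => // F1.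
  by apply: fg; apply/le_anti; rewrite F1.
Qed.

End pasting.

(** * Homotopies and path spaces *)

Section homotopies.
Context R.

(** Over the whole line instead of [I01]. What happens outside [0, 1] is irrelevant: [htp_homotopic]
    restricts to the interval. *)
Definition htp X Y (f g : X -> Y) : Prop :=
  exists H : X * R -> Y,
    [/\ cts H, forall x, H (x, 0) = f x & forall x, H (x, 1) = g x].

Definition heq X Y (f : X -> Y) : Prop :=
  cts f /\ exists g : Y -> X,
    [/\ cts g, htp (fun x => g (f x)) id & htp (fun y => f (g y)) id].

Lemma htp_refl X Y (f : X -> Y) : cts f -> htp f f.
Proof. by move=> cf; exists (fun z => f z.1); split=> //; ctsify. Qed.

Lemma htp_eq X Y (f g : X -> Y) :
  cts f -> (forall x, f x = g x) -> htp f g.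
Proof. by move=> cf /funext <-; exact: htp_refl. Qed.

Lemma htp_sym X Y (f g : X -> Y) : htp f g -> htp g f.
Proof.
move=> [H [cH H0 H1]]; exists (fun z => H (z.1, 1 - z.2)); split=> [|x|x] /=.
- by ctsify.
- by rewrite subr0 H1.
- by rewrite subrr H0.
Qed.

Lemma htp_trans X Y (g f h : X -> Y) :
  htp f g -> htp g h -> htp f h.
Proof.
move=> [H [cH H0 H1]] [K [cK K0 K1]].
exists (fun z => if z.2 - 2^-1 <= 0 then H (z.1, 2 * z.2) else K (z.1, 2 * z.2 - 1)).
split=> [|x|x] /=.
- apply: cts_if; [by ctsify..|] => -[x t] /= t2.
  have -> : t = 2^-1 by lra.
  by rewrite divff // subrr H1 K0.
- by rewrite ifT ?mulr0 ?H0//; lra.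
- by rewrite ifF; [rewrite mulr1 (_ : 2 - 1 = 1) ?K1//; lra | apply/negbTE; rewrite -ltNge; lra].
Qed.

Lemma htp_compl X Y Z (f g : X -> Y) (h : Y -> Z) :
  cts h -> htp f g -> htp (fun x => h (f x)) (fun x => h (g x)).
Proof.
move=> ch [H [cH H0 H1]]; exists (fun z => h (H z)).
by split=> [|x|x]; [ctsify|rewrite H0|rewrite H1].
Qed.

Lemma htp_compr X Y Z (f g : Y -> Z) (h : X -> Y) :
  cts h -> htp f g -> htp (fun x => f (h x)) (fun x => g (h x)).
Proof.
move=> ch [H [cH H0 H1]]; exists (fun z => H (h z.1, z.2)).
by split=> [|x|x]; [ctsify|rewrite H0|rewrite H1].
Qed.

Lemma heq_id X : heq (fun x : X => x).
Proof.
by split; [ctsify|exists (fun x => x); split; [ctsify|exact/htp_refl/cts_id..]].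
Qed.

Lemma heq_homeo X Y (f : X -> Y) (g : Y -> X) :
  cts f -> cts g -> cancel f g -> cancel g f -> heq f.
Proof.
move=> cf cg fg gf; split=> //; exists g; split=> //; apply: htp_eq => //.
  exact: (cts_comp cg cf).
exact: (cts_comp cf cg).
Qed.

Lemma heq_of_inverses X Y (f : X -> Y) (l r : Y -> X) :
  cts f -> cts l -> cts r -> htp (fun x => l (f x)) id ->
  htp (fun y => f (r y)) id -> heq f.
Proof.
move=> cf cl cr lf fr; split=> //; exists l; split=> //.
have lr : htp l r.
  apply: (@htp_trans _ _ (fun y => l (f (r y)))).
    exact/htp_sym/(htp_compl cl fr).
  exact: (htp_compr cr lf).
apply: htp_trans fr; exact: (htp_compl cf lr).
Qed.

Lemma heq_comp X Y Z (f : X -> Y) (g : Y -> Z) :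
  heq f -> heq g -> heq (fun x => g (f x)).
Proof.
move=> [cf [f' [cf' f'f ff']]] [cg [g' [cg' g'g gg']]].
split; first by ctsify.
exists (fun z => f' (g' z)); split; first by ctsify.
- apply: htp_trans f'f; exact: (htp_compl cf' (htp_compr cf g'g)).
- apply: htp_trans gg'; exact: (htp_compl cg (htp_compr cg' ff')).
Qed.

(* [l] has the right inverse [f] and the left inverse [m], so it is an
   equivalence, and then so is [f]. *)
Lemma heq_two_of_six X Y Z (f : X -> Y) (l : Y -> X)
    (m : X -> Y) :
  cts f -> cts l -> cts m -> htp (fun x => l (f x)) id ->
  htp (fun y => m (l y)) id -> heq f.
Proof.
move=> cf cl cm lf ml.
have [_ [l' [cl' l'l ll']]] : heq l by exact: (@heq_of_inverses _ _ l m f).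
apply: (@heq_of_inverses _ _ f l l) => //; apply: htp_trans (l'l).
have fl' : htp f l'.
  apply: (@htp_trans _ _ (fun x => l' (l (f x)))).
    exact/htp_sym/(htp_compr cf l'l).
  exact: (htp_compl cl' lf).
exact: (htp_compr cl fl').
Qed.

End homotopies.

Lemma hausdorff_injective X Y (f : X -> Y) :
  cts f -> injective f -> hausdorff_space Y -> hausdorff_space X.
Proof.
move=> cf fI hY p q pq; apply/fI/hY => A B /cf fA /cf fB.
by have [x [/= Ax Bx]] := pq _ _ fA fB; exists (f x).
Qed.

Lemma set_type_hausdorff X (A : set X) :
  hausdorff_space X -> hausdorff_space A.
Proof.
by apply: (@hausdorff_injective A X set_val); [ctsify|exact: val_inj].
Qed.

Lemma prod_hausdorff X Y :
  hausdorff_space X -> hausdorff_space Y -> hausdorff_space (X * Y)%type.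
Proof.
move=> hX hY [p p'] [q q'] pq; congr (_, _).
- apply: hX => A B nA nB.
  have [[x y] [/= Ax Bx]] := pq _ _ (@cts_fst _ _ _ id (@cts_id _) (p, p') _ nA)
    (@cts_fst _ _ _ id (@cts_id _) (q, q') _ nB).
  by exists x.
- apply: hY => A B nA nB.
  have [[x y] [/= Ax Bx]] := pq _ _ (@cts_snd _ _ _ id (@cts_id _) (p, p') _ nA)
    (@cts_snd _ _ _ id (@cts_id _) (q, q') _ nB).
  by exists y.
Qed.

Lemma set_type_compact X (A : set X) :
  compact A -> compact [set: A].
Proof.
move=> cA F FF _.
have FA : (set_val @ F) A by apply: (@filterE _ F) => y; exact: set_valP.
have [x [Ax clx]] := cA (set_val @ F) _ FA.
exists (SigSub (mem_set Ax)); split=> // B C FB [_ [[U oU <-] Ux UC]].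
have [] := clx (set_val @` B) U.
- have FB' : F (set_val @^-1` (set_val @` B)).
    by apply: filterS FB => y By; exists y.
  exact: FB'.
- by apply: open_nbhs_nbhs.
by move=> _ [[y By <-] Uy]; exists y; split=> //; exact: UC.
Qed.

(** * Path spaces and the exponential law for the interval *)

Section path_spaces.
Context R.

Lemma compact_I01 : compact [set: I01 R].
Proof. exact/set_type_compact/segment_compact. Qed.

Lemma hausdorff_I01 : hausdorff_space (I01 R).
Proof. exact/set_type_hausdorff/Rhausdorff. Qed.

Lemma locally_compact_I01 : locally_compact [set: I01 R].
Proof.
move=> x _; exists setT; first exact: filterT.
by split; [exact: compact_I01|exact: closedT].
Qed.

Lemma cts_curry Z V W (c : Z -> {compact-open, V -> W}) :
  cts (fun z : Z * V => c z.1 z.2) -> cts c.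
Proof. by move=> h; exact: (continuous_curry_fun h). Qed.

Lemma cts_uncurry Z W (c : Z -> {compact-open, I01 R -> W}) :
  cts c -> (forall z, continuous (c z : I01 R -> W)) ->
  cts (fun z : Z * I01 R => c z.1 z.2).
Proof.
move=> h h'; apply: (@cts_ext _ _ (uncurry (fun z => c z : I01 R -> W))) => [[a b]//|].
exact: (continuous_uncurry locally_compact_I01 hausdorff_I01 h h').
Qed.

(* Joint quotient maps stay jointly quotient after taking the product with the
   line, because maps on [X * I01 R] are maps from [X] into a path space. *)
Lemma cts_quotient_prod (J : Type) (D : J -> topologicalType)
    X V (q : forall j, D j -> X) (H : X * R -> V) :
  (forall W (f : X -> W),
     (forall j, cts (fun d => f (q j d))) -> cts f) ->
  (forall x, exists j d, q j d = x) ->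
  (forall j, cts (fun z : D j * R => H (q j z.1, z.2))) ->
  cts (fun z : X * R => H (z.1, clamp z.2)).
Proof.
move=> univ surj cH.
pose c x : {compact-open, I01 R -> V} := fun s => H (x, set_val s).
suff cc : cts (fun z : X * I01 R => c z.1 z.2).
  apply: (@cts_ext _ _ (fun z : X * R => c z.1 (to01 z.2))) => [z|].
    by rewrite /c val_to01.
  pose k (z : X * R) := (z.1, to01 z.2).
  have ck : cts k by rewrite /k; ctsify.
  exact: (cts_comp cc ck).
apply: cts_uncurry => [|x].
  apply: univ => j; apply: cts_curry; rewrite /c /=.
  pose k (z : D j * I01 R) := (z.1, set_val z.2).
  have ck : cts k by rewrite /k; ctsify.
  exact: (cts_comp (cH j) ck).
have [j [d <-]] := surj x.
pose k (s : I01 R) := (d, set_val s).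
have ck : cts k by rewrite /k; ctsify.
exact: (cts_comp (cH j) ck).
Qed.

(** The compact-open type contains all functions; the continuous ones are cut out as a subspace. *)
Definition pathsp X : topologicalType :=
  set_type [set w : {compact-open, I01 R -> X} | continuous (w : I01 R -> X)].

Definition pev X (w : pathsp X) (t : R) : X :=
  set_val w (to01 t).

Lemma cts_pev Z X (c : Z -> pathsp X) (f : Z -> R) :
  cts c -> cts f -> cts (fun z => pev (c z) (f z)).
Proof.
move=> cc cf.
have h : cts (fun z : Z * I01 R => set_val (c z.1) z.2).
  apply: (@cts_uncurry _ _ (fun z => set_val (c z))) => [|z]; first by ctsify.
  by have := set_valP (c z).
pose k z := (z, to01 (f z)).
have ck : cts k by rewrite /k; ctsify.
exact: (cts_comp h ck).
Qed.

Lemma pathsp_subproof X (g : R -> X) :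
  cts g -> ((fun s => g (set_val s)) : I01 R -> X) \in
    [set w : {compact-open, I01 R -> X} | continuous (w : I01 R -> X)].
Proof.
move=> cg; rewrite inE /=.
have : cts (fun s : I01 R => g (set_val s)) by ctsify.
by [].
Qed.

Definition mkp X (g : R -> X) (cg : cts g) : pathsp X :=
  SigSub (pathsp_subproof cg).

Lemma pev_mkp X (g : R -> X) (cg : cts g) t :
  pev (mkp cg) t = g (clamp t).
Proof. by rewrite -val_to01. Qed.

Lemma pev_clamp X (w : pathsp X) t :
  pev w (clamp t) = pev w t.
Proof. by rewrite /pev to01_clamp. Qed.

Lemma pev_le0 X (w : pathsp X) t : t <= 0 -> pev w t = pev w 0.
Proof. by move=> t0; rewrite -pev_clamp clamp_le0. Qed.

Lemma pev_ge1 X (w : pathsp X) t : 1 <= t -> pev w t = pev w 1.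
Proof. by move=> t0; rewrite -pev_clamp clamp_ge1. Qed.

Lemma pathsp_ext X (u w : pathsp X) :
  (forall t, 0 <= t <= 1 -> pev u t = pev w t) -> u = w.
Proof.
move=> uw; apply: val_inj; apply/funext => s.
by have := uw _ (I01P s); rewrite /pev to01K.
Qed.

Lemma cts_pathsp Z X (c : Z -> pathsp X) :
  cts (fun z : Z * R => pev (c z.1) z.2) -> cts c.
Proof.
move=> h; apply: cts_set_type; apply: cts_curry.
pose k (z : Z * I01 R) := (z.1, set_val z.2).
have ck : cts k by rewrite /k; ctsify.
apply: cts_ext (cts_comp h ck) => -[z s].
by rewrite /k /pev /= to01K.
Qed.

End path_spaces.

Lemma cts_pathsp_mkp R Z X (g : Z -> R -> X)
    (cg : forall z, cts (g z)) :
  cts (fun z : Z * R => g z.1 z.2) -> cts (fun z => mkp (cg z)).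
Proof.
move=> h; apply: cts_pathsp.
pose k (z : Z * R) := (z.1, clamp z.2).
have ck : cts k by rewrite /k; ctsify.
by apply: cts_ext (cts_comp h ck) => z; rewrite /k pev_mkp.
Qed.

Ltac cts_step_path :=
  cts_eta; first [ cts_step
        | match goal with
          | |- cts (fun x => pev _ _) => apply: cts_pev
          end ].
Ltac ctsify ::= repeat cts_step_path.

Section corestr.

Definition corestr Z X (A : set X) (f : Z -> X)
  (Af : forall z, A (f z)) : Z -> A := fun z => SigSub (mem_set (Af z)).

Lemma cts_corestr Z X (A : set X) (f : Z -> X)
    (Af : forall z, A (f z)) : cts f -> cts (corestr Af).
Proof. by move=> cf; exact: cts_set_type. Qed.

(** Lets a homotopy into a subspace be written in the ambient space: it need stay in [A] only for
    times in [0, 1], the rest being clamped away. *)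
Lemma htp_sub R Z X (A : set X) (f g : Z -> A)
    (H : Z * R -> X) :
  cts H -> (forall z t, 0 <= t <= 1 -> A (H (z, t))) ->
  (forall z, H (z, 0) = set_val (f z)) -> (forall z, H (z, 1) = set_val (g z)) ->
  htp R f g.
Proof.
move=> cH AH H0 H1.
have AK (z : Z * R) : A (H (z.1, clamp z.2)) by apply: AH; exact: clamp01.
exists (corestr AK); split=> [|z|z].
- by apply: cts_corestr; ctsify.
- by apply: val_inj; rewrite /= clamp0 H0.
- by apply: val_inj; rewrite /= clamp1 H1.
Qed.

End corestr.

(** * Concatenation, segments and reparametrisation of paths *)

Section path_algebra.
Context R.

Definition cat_fun X (u v : pathsp R X) (t : R) : X :=
  if 2 * t - 1 <= 0 then pev u (2 * t) else pev v (2 * t - 1).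

Lemma cts_cat_fun X Z (u v : Z -> pathsp R X) (f : Z -> R) :
  cts u -> cts v -> cts f -> (forall z, pev (u z) 1 = pev (v z) 0) ->
  cts (fun z => cat_fun (u z) (v z) (f z)).
Proof.
move=> cu cv cf uv; apply: cts_if; [by ctsify..|move=> z e].
have -> : 2 * f z = 1 by lra.
by rewrite subrr uv.
Qed.

(* Junk value [u] when the endpoints do not match. *)
Definition catp X (u v : pathsp R X) : pathsp R X :=
  match pselect (pev u 1 = pev v 0) with
  | left e => mkp (@cts_cat_fun X R (fun=> u) (fun=> v) id (@cts_cst _ _ _)
                     (@cts_cst _ _ _) (@cts_id _) (fun=> e))
  | right _ => u
  end.

Lemma pev_catp X (u v : pathsp R X) t :
  pev u 1 = pev v 0 -> pev (catp u v) t = cat_fun u v t.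
Proof.
move=> e; rewrite /catp; case: pselect => // e'; rewrite pev_mkp /cat_fun.
have [t0|t0] := leP t 0.
  by rewrite clamp_le0 // !ifT; [rewrite (pev_le0 _ (_ : 2 * t <= 0)) ?mulr0//|..]; lra.
have [t1|t1] := leP 1 t.
  rewrite clamp_ge1 // !ifF; try (apply/negbTE; rewrite -ltNge; lra).
  by rewrite !pev_ge1 //; lra.
by rewrite clamp_id // !ltW.
Qed.

Lemma catp0 X (u v : pathsp R X) : pev (catp u v) 0 = pev u 0.
Proof.
rewrite /catp; case: pselect => // e; rewrite pev_mkp clamp0 /cat_fun.
by rewrite ifT ?mulr0//; lra.
Qed.

Lemma catp1 X (u v : pathsp R X) : pev u 1 = pev v 0 -> pev (catp u v) 1 = pev v 1.
Proof.
move=> e; rewrite pev_catp // /cat_fun ifF; last by apply/negbTE; rewrite -ltNge; lra.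
by rewrite (_ : 2 * 1 - 1 = 1) //; lra.
Qed.

Lemma cts_catp X Z (u v : Z -> pathsp R X) :
  (forall z, pev (u z) 1 = pev (v z) 0) -> cts u -> cts v ->
  cts (fun z => catp (u z) (v z)).
Proof.
move=> uv cu cv; apply: cts_pathsp.
apply: (@cts_ext _ _ (fun z : Z * R => cat_fun (u z.1) (v z.1) z.2)) => [z|].
  by rewrite pev_catp.
by apply: cts_cat_fun => //; ctsify.
Qed.

Lemma cts_pev_affine X (u : pathsp R X) (a b : R) : cts (fun t => pev u (a + (b - a) * t)).
Proof. by ctsify. Qed.

(** The order of [a] and [b] is free: [subp u 1 0] is the reverse path and [subp u a a] is constant.
    Retracting a path along itself thus amounts to moving [a] or [b]. *)
Definition subp X (u : pathsp R X) (a b : R) : pathsp R X :=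
  mkp (@cts_pev_affine X u a b).

Lemma pev_subp X (u : pathsp R X) a b t :
  pev (subp u a b) t = pev u (a + (b - a) * clamp t).
Proof. by rewrite pev_mkp. Qed.

Lemma subp0 X (u : pathsp R X) a b : pev (subp u a b) 0 = pev u a.
Proof. by rewrite pev_subp clamp0 mulr0 addr0. Qed.

Lemma subp1 X (u : pathsp R X) a b : pev (subp u a b) 1 = pev u b.
Proof. by rewrite pev_subp clamp1; congr pev; lra. Qed.

Lemma subp_full X (u : pathsp R X) : subp u 0 1 = u.
Proof.
by apply: pathsp_ext => t _; rewrite pev_subp subr0 mul1r add0r pev_clamp.
Qed.

Lemma cts_subp X Z (u : Z -> pathsp R X) (a b : Z -> R) :
  cts u -> cts a -> cts b -> cts (fun z => subp (u z) (a z) (b z)).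
Proof.
move=> cu ca cb; apply: cts_pathsp_mkp.
by ctsify.
Qed.

Lemma cts_pev_map X Y (f : X -> Y) (cf : cts f) (u : pathsp R X) :
  cts (fun t => f (pev u t)).
Proof. by ctsify. Qed.

Definition mapp X Y (f : X -> Y) (cf : cts f) (u : pathsp R X) : pathsp R Y :=
  mkp (@cts_pev_map X Y f cf u).

Lemma pev_mapp X Y (f : X -> Y) (cf : cts f) (u : pathsp R X) t :
  pev (mapp cf u) t = f (pev u t).
Proof. by rewrite pev_mkp pev_clamp. Qed.

Lemma cts_mapp X Y Z (f : X -> Y) (cf : cts f) (u : Z -> pathsp R X) :
  cts u -> cts (fun z => mapp cf (u z)).
Proof. by move=> cu; apply: cts_pathsp_mkp; ctsify. Qed.

(* The path [t |-> u (s (c t - d) + (1 - s) t)] *)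
Definition reparam X (u : pathsp R X) (c d s : R) : pathsp R X :=
  subp u (s * - d) (s * (c - d) + (1 - s)).

Lemma reparam_0 X (u : pathsp R X) c d : reparam u c d 0 = u.
Proof.
by rewrite /reparam !mul0r subr0 add0r subp_full.
Qed.

Lemma pev_reparam_1 X (u : pathsp R X) c d t : 0 <= t <= 1 ->
  pev (reparam u c d 1) t = pev u (c * t - d).
Proof. by move=> t01; rewrite pev_subp clamp_id //; congr pev; lra. Qed.

(** The affine parameter is at most 0 at time 0 and at least 1 at time 1 throughout the
    interpolation, and [pev] is constant beyond these values. The failure of strict unit laws for
    [catp] is always repaired by such a reparametrisation. *)
Lemma reparam_ends X (u : pathsp R X) c d s : 0 <= s <= 1 -> 0 <= d -> 1 <= c - d ->
  pev (reparam u c d s) 0 = pev u 0 /\ pev (reparam u c d s) 1 = pev u 1.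
Proof.
move=> s01 d0 cd; rewrite subp0 subp1; split; [apply: pev_le0|apply: pev_ge1]; nra.
Qed.

Lemma cts_reparam X Z (u : Z -> pathsp R X) (c d s : Z -> R) :
  cts u -> cts c -> cts d -> cts s ->
  cts (fun z => reparam (u z) (c z) (d z) (s z)).
Proof. by move=> *; apply: cts_subp; ctsify. Qed.

End path_algebra.

Ltac cts_step_path ::=
  cts_eta; first [ cts_step
        | match goal with
          | |- cts (fun x => pev _ _) => apply: cts_pev
          | |- cts (fun x => subp _ _ _) => apply: cts_subp
          | |- cts (fun x => reparam _ _ _ _) => apply: cts_reparam
          | |- cts (fun x => mapp _ _) => apply: cts_mapp
          | |- cts (fun x => catp _ _) => apply: cts_catp; [intro|..]
          end ].

(** * Homotopy invariance of spaces of paths with fixed ends *)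

Section path_equivalences.
Context R.

Definition heqv X Y : Prop := exists f : X -> Y, heq R f.

Lemma heqv_trans Y X Z : heqv X Y -> heqv Y Z -> heqv X Z.
Proof. by move=> [f hf] [g hg]; exists (fun x => g (f x)); exact: heq_comp. Qed.

Lemma heqv_sym X Y : heqv X Y -> heqv Y X.
Proof. by move=> [f [cf [g [cg gf fg]]]]; exists g; split=> //; exists f. Qed.

Lemma heqv_prod X Y X' Y' : heqv X Y -> heqv X' Y' -> heqv (X * X')%type (Y * Y')%type.
Proof.
move=> [f [cf [g [cg [H [cH H0 H1]] [K [cK K0 K1]]]]]].
move=> [f' [cf' [g' [cg' [H' [cH' H'0 H'1]] [K' [cK' K'0 K'1]]]]]].
exists (fun z => (f z.1, f' z.2)); split; first by ctsify.
exists (fun z => (g z.1, g' z.2)); split; first by ctsify.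
- exists (fun z => (H (z.1.1, z.2), H' (z.1.2, z.2))).
  by split=> [|x|[x x']] /=; [ctsify|rewrite H0 H'0|rewrite H1 H'1].
- exists (fun z => (K (z.1.1, z.2), K' (z.1.2, z.2))).
  by split=> [|x|[x x']] /=; [ctsify|rewrite K0 K'0|rewrite K1 K'1].
Qed.

Definition paths X (x y : X) : topologicalType :=
  set_type [set w : pathsp R X | pev w 0 = x /\ pev w 1 = y].

Lemma paths_zero X (x y : X) (w : paths x y) : pev (set_val w) 0 = x.
Proof. by have [] := set_valP w. Qed.

Lemma paths_one X (x y : X) (w : paths x y) : pev (set_val w) 1 = y.
Proof. by have [] := set_valP w. Qed.

Definition mkpaths X (x y : X) (w : pathsp R X)
    (e : pev w 0 = x /\ pev w 1 = y) : paths x y :=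
  SigSub (mem_set (e : [set w : pathsp R X | pev w 0 = x /\ pev w 1 = y] w)).

Lemma cts_mkpaths Z X (x y : X) (f : Z -> pathsp R X)
    (e : forall z, pev (f z) 0 = x /\ pev (f z) 1 = y) :
  cts f -> cts (fun z => mkpaths (e z)).
Proof. by move=> cf; exact: cts_set_type. Qed.

(** Membership in [A] depends only on the ends of a path, and the interpolation does not move
    them. *)
Lemma htp_reparam Z X (A : set (pathsp R X)) (f : Z -> pathsp R X) (c d : R)
    (g h : Z -> A) :
  0 <= d -> 1 <= c - d -> cts f ->
  (forall u w, pev u 0 = pev w 0 -> pev u 1 = pev w 1 -> A u -> A w) ->
  (forall z, set_val (g z) = reparam (f z) c d 1) ->
  (forall z, set_val (h z) = f z) -> htp R g h.
Proof.
move=> d0 cd cf Aend gE hE.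
apply: (@htp_sub _ _ _ _ _ _ (fun z => reparam (f z.1) c d (1 - z.2))).
- by ctsify.
- move=> z t /= t01.
  have [|e0 e1] := @reparam_ends R _ (f z) c d (1 - t) _ d0 cd.
    by rewrite subr_ge0 lerBlDr lerDl andbC.
  apply: (Aend (f z)) => //.
  by rewrite -hE; exact: set_valP.
- by move=> z; rewrite /= subr0 gE.
- by move=> z; rewrite /= subrr reparam_0 hE.
Qed.

Lemma paths_endsP X (x y : X) (u w : pathsp R X) :
  pev u 0 = pev w 0 -> pev u 1 = pev w 1 ->
  [set w : pathsp R X | pev w 0 = x /\ pev w 1 = y] u ->
  [set w : pathsp R X | pev w 0 = x /\ pev w 1 = y] w.
Proof. by move=> /= -> ->. Qed.

(** In this concatenation [w] occupies the times [1/4, 1/2], which [4 t - 1] maps onto [0, 1]. *)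
Lemma catp_cst X (u w v : pathsp R X) :
  (forall t, pev u t = pev w 0) -> (forall t, pev v t = pev w 1) ->
  catp (catp u w) v = reparam w 4 1 1.
Proof.
move=> hu hv; apply: pathsp_ext => t t01; rewrite pev_reparam_1 //.
have uw : pev u 1 = pev w 0 by [].
rewrite pev_catp ?catp1 // /cat_fun; case: ifPn => [t1|].
  rewrite pev_catp // /cat_fun; case: ifPn => [t2|].
    by rewrite hu (pev_le0 _ (_ : 4 * t - 1 <= 0)) //; lra.
  by move=> _; congr pev; lra.
by rewrite -ltNge => t1; rewrite hv [RHS]pev_ge1 //; lra.
Qed.

Section conjugation.
Context X (x x1 y y1 : X) (s : paths x x1) (r : paths y1 y).

Lemma conj_ends (w : paths x1 y1) :
  pev (catp (catp (set_val s) (set_val w)) (set_val r)) 0 = x /\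
  pev (catp (catp (set_val s) (set_val w)) (set_val r)) 1 = y.
Proof.
rewrite !catp0 paths_zero catp1 ?paths_one // catp1 ?paths_one //.
- by rewrite paths_zero.
- by rewrite paths_zero.
Qed.

Definition conj_path : paths x1 y1 -> paths x y := corestr conj_ends.

Lemma cts_conj : cts conj_path.
Proof.
apply: cts_corestr; ctsify.
- by rewrite catp1 ?paths_one // paths_zero.
- by rewrite paths_one paths_zero.
Qed.

End conjugation.

Definition rev_ends X (x y : X) (s : paths x y) :
  pev (subp (set_val s) 1 0) 0 = y /\ pev (subp (set_val s) 1 0) 1 = x.
Proof. by rewrite subp0 subp1 paths_zero paths_one. Qed.

Definition revp X (x y : X) (s : paths x y) : paths y x :=
  mkpaths (rev_ends s).

(** The iterate of [c t - d]. The clamp between the two maps is harmless: where [c t - d] leaves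
    [0, 1], its image under the same map lies beyond the same end. *)
Lemma reparam_twice X (w : pathsp R X) c d : 0 <= d -> 1 <= c - d ->
  reparam (reparam w c d 1) c d 1 = reparam w (c * c) (c * d + d) 1.
Proof.
move=> d0 cd; apply: pathsp_ext => t t01.
rewrite [LHS]pev_reparam_1 // [RHS]pev_reparam_1 // -pev_clamp pev_reparam_1 ?clamp01 //.
have [t0|t0] := leP (c * t - d) 0.
  by rewrite clamp_le0 // pev_le0 ?[RHS]pev_le0//; nra.
have [t1|t1] := leP 1 (c * t - d).
  by rewrite clamp_ge1 // pev_ge1 ?[RHS]pev_ge1//; nra.
by rewrite clamp_id ?ltW //; congr pev; lra.
Qed.

(** Each conjugating path meets its reverse, and the pair is retracted along itself: [H] at time [u]
    uses only the part of [s] after [1 - u] and the part of [r] before [u]. *)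
Lemma conjK X (x x1 y y1 : X) (s : paths x x1) (r : paths y1 y) :
  htp R (fun w => conj_path (revp s) (revp r) (conj_path s r w)) id.
Proof.
pose H (z : paths x1 y1 * R) :=
  catp (catp (subp (set_val s) 1 (1 - z.2))
    (catp (catp (subp (set_val s) (1 - z.2) 1) (set_val z.1)) (subp (set_val r) 0 z.2)))
    (subp (set_val r) z.2 0).
have e1 z u : pev (subp (set_val s) u 1) 1 = pev (set_val (z : paths x1 y1)) 0.
  by rewrite subp1 paths_one paths_zero.
have e2 z u v : pev (catp (subp (set_val s) u 1) (set_val (z : paths x1 y1))) 1 =
    pev (subp (set_val r) 0 v) 0.
  by rewrite catp1 // subp0 paths_one paths_zero.
have e3 z u v : pev (subp (set_val s) 1 u) 1 =
    pev (catp (catp (subp (set_val s) u 1) (set_val (z : paths x1 y1)))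
              (subp (set_val r) 0 v)) 0.
  by rewrite !catp0 subp0 subp1.
have e4 z u v : pev (catp (subp (set_val s) 1 u) (catp (catp (subp (set_val s) u 1)
     (set_val (z : paths x1 y1))) (subp (set_val r) 0 v))) 1 = pev (subp (set_val r) v 0) 0.
  by rewrite catp1 // catp1 // subp1 subp0.
have cH : cts H by rewrite /H; ctsify.
have HP z t : pev (H (z, t)) 0 = x1 /\ pev (H (z, t)) 1 = y1.
  by rewrite /H /= !catp0 catp1 // subp0 subp1 paths_one paths_zero.
(* At time 0 the four conjugating segments are constant, so [catp_cst] applies twice; 16 and 5 come
   from iterating [4 t - 1]. *)
have H0 : htp R (fun z => corestr (fun z => HP z 0) z) id.
  apply: (@htp_reparam _ _ _ (fun z => set_val z) (4 * 4) (4 * 1 + 1)); [lra|lra|ctsify| |move=> z|by []].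
    exact: paths_endsP.
  change (H (z, 0) = reparam (set_val z) (4 * 4) (4 * 1 + 1) 1).
  rewrite /H /= subr0 -reparam_twice; [|lra..].
  have c1 : catp (catp (subp (set_val s) 1 1) (set_val z)) (subp (set_val r) 0 0) =
      reparam (set_val z) 4 1 1.
    apply: catp_cst => t; rewrite pev_subp subrr mul0r addr0.
      by rewrite paths_one paths_zero.
    by rewrite paths_one paths_zero.
  have h01 : 0 <= (1 : R) <= 1 by rewrite ler01 lexx.
  have h41 : (1 : R) <= 4 - 1 by lra.
  have [r0 r1] := @reparam_ends R _ (set_val z) 4 1 1 h01 ler01 h41.
  rewrite c1; apply: catp_cst => t; rewrite pev_subp subrr mul0r addr0.
    by rewrite r0 paths_one paths_zero.
  by rewrite r1 paths_one paths_zero.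
apply: htp_trans H0.
apply: (@htp_sub _ _ _ _ _ _ (fun z => H (z.1, 1 - z.2))).
- by ctsify.
- by move=> z t _; exact: HP.
- by move=> z; rewrite /H /= subr0 subrr !subp_full.
- by move=> z; rewrite [LHS]/= subrr.
Qed.

Lemma revpK X (x y : X) (s : paths x y) : revp (revp s) = s.
Proof.
apply: val_inj; apply: pathsp_ext => t t01.
change (pev (subp (subp (set_val s) 1 0) 1 0) t = pev (set_val s) t).
rewrite !pev_subp (clamp_id t01) clamp_id; first by congr pev; lra.
by case/andP: t01 => t0 t1; apply/andP; split; lra.
Qed.

Definition path_map_ends X Y (f : X -> Y) (cf : cts f) (x y : X) (w : paths x y) :
  pev (mapp cf (set_val w)) 0 = f x /\ pev (mapp cf (set_val w)) 1 = f y.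
Proof. by rewrite !pev_mapp paths_zero paths_one. Qed.

Definition path_map X Y (f : X -> Y) (cf : cts f) (x y : X) :
  paths x y -> paths (f x) (f y) := corestr (@path_map_ends X Y f cf x y).

Lemma cts_path_map X Y (f : X -> Y) (cf : cts f) (x y : X) : cts (@path_map X Y f cf x y).
Proof. by apply: cts_corestr; ctsify. Qed.

(* A homotopy moves a path [w] through the paths [H_u w]; closing them up along
   the tracks of the two endpoints keeps the endpoints fixed. *)
Lemma path_map_left_inverse X Y (f : X -> Y) (cf : cts f) (g : Y -> X) (cg : cts g)
    (x y : X) : htp R (fun x => g (f x)) id ->
  exists (s : paths x (g (f x))) (r : paths (g (f y)) y),
    htp R (fun w : paths x y => conj_path s r (path_map cg (path_map cf w))) id.
Proof.
move=> [H [cH H0 H1]].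
have ct z : cts (fun t => H (z, t)) by ctsify.
pose tr z := mkp (ct z).
have ctr : cts tr by apply: cts_pathsp_mkp; ctsify.
have tr0 z : pev (tr z) 0 = g (f z) by rewrite pev_mkp clamp0 H0.
have tr1 z : pev (tr z) 1 = z by rewrite pev_mkp clamp1 H1.
have sP : pev (subp (tr x) 1 0) 0 = x /\ pev (subp (tr x) 1 0) 1 = g (f x).
  by rewrite subp0 subp1.
have rP : pev (tr y) 0 = g (f y) /\ pev (tr y) 1 = y by [].
exists (mkpaths sP), (mkpaths rP).
have cw (w : paths x y) u : cts (fun t => H (pev (set_val w) t, clamp u)) by ctsify.
pose W (z : paths x y * R) := mkp (@cw z.1 z.2).
have cW : cts W by apply: cts_pathsp_mkp; ctsify.
pose G (z : paths x y * R) :=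
  catp (catp (subp (tr x) 1 z.2) (W z)) (subp (tr y) z.2 1).
have W0 z : pev (W z) 0 = H (x, clamp z.2) by rewrite pev_mkp clamp0 paths_zero.
have W1 z : pev (W z) 1 = H (y, clamp z.2) by rewrite pev_mkp clamp1 paths_one.
have e1 z : pev (subp (tr x) 1 z.2) 1 = pev (W z) 0 by rewrite subp1 pev_mkp W0.
have e2 z : pev (catp (subp (tr x) 1 z.2) (W z)) 1 = pev (subp (tr y) z.2 1) 0.
  by rewrite catp1 // subp0 W1 pev_mkp.
have cG : cts G by rewrite /G; ctsify.
have GP z t : pev (G (z, t)) 0 = x /\ pev (G (z, t)) 1 = y.
  by rewrite /G (catp1 (e2 (z, t))) !catp0 subp0 subp1.
have G1 : htp R (fun z => corestr (fun z => GP z 1) z) id.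
  apply: (@htp_reparam _ _ _ (fun z => set_val z) 4 1); [lra|lra|ctsify| |move=> z|by []].
    exact: paths_endsP.
  change (G (z, 1) = reparam (set_val z) 4 1 1); rewrite /G /=.
  have -> : W (z, 1) = set_val z.
    by apply: pathsp_ext => t t01; rewrite pev_mkp /= pev_clamp clamp1 H1.
  apply: catp_cst => t; rewrite pev_subp subrr mul0r addr0.
    by rewrite tr1 paths_zero.
  by rewrite tr1 paths_one.
apply: htp_trans G1; apply: (@htp_sub _ _ _ _ _ _ G) => //.
  by move=> z t _; exact: GP.
move=> z; rewrite /G /= subp_full; congr (catp (catp _ _) _).
apply: pathsp_ext => t t01.
by rewrite pev_mkp /= pev_clamp clamp0 H0 !pev_mapp.
Qed.

(** A free homotopy inverse moves the end points, so [path_map cg] inverts only after conjugation by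
    their tracks. The tracks for [g f] and for [f g] are unrelated; the two-of-six argument spares
    their comparison. *)
Lemma heq_path_map X Y (f : X -> Y) (cf : cts f) (x y : X) :
  heq R f -> heq R (@path_map X Y f cf x y).
Proof.
move=> [_ [g [cg gf fg]]].
have [s [r gfK]] := path_map_left_inverse cf cg x y gf.
have [s' [r' fgK]] := path_map_left_inverse cg cf (f x) (f y) fg.
apply: (@heq_two_of_six _ _ _ _ _ (fun w => conj_path s r (path_map cg w))
  (fun w => conj_path s' r' (path_map cf (conj_path (revp s) (revp r) w)))) => //.
- exact: cts_path_map.
- by apply: (cts_comp (@cts_conj _ _ _ _ _ s r)); exact: cts_path_map.
- apply: (cts_comp (@cts_conj _ _ _ _ _ s' r')).
  apply: (cts_comp (@cts_path_map _ _ _ cf _ _)); exact: cts_conj.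
- apply: htp_trans fgK.
  apply: (@htp_compl _ _ _ _ _ _ (fun w => conj_path s' r' (path_map cf w))).
    by apply: (cts_comp (@cts_conj _ _ _ _ _ s' r')); exact: cts_path_map.
  exact: (htp_compr (@cts_path_map _ _ _ cg _ _) (conjK s r)).
Qed.

End path_equivalences.

Section one_sided_units.
Context R X.

(** Here [w] occupies the second half, hence [2 t - 1]; in [catp_cst_right] the first half, hence
    [2 t]. *)
Lemma catp_cst_left (u w : pathsp R X) :
  (forall t, pev u t = pev w 0) -> catp u w = reparam w 2 1 1.
Proof.
move=> hu; apply: pathsp_ext => t t01; rewrite pev_reparam_1 //.
rewrite pev_catp // /cat_fun; case: ifPn => // t1.
by rewrite hu [RHS]pev_le0.
Qed.

Lemma catp_cst_right (w v : pathsp R X) :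
  (forall t, pev v t = pev w 1) -> catp w v = reparam w 2 0 1.
Proof.
move=> hv; apply: pathsp_ext => t t01; rewrite pev_reparam_1 // subr0.
rewrite pev_catp // /cat_fun; case: ifPn => // t1.
by rewrite hv [RHS]pev_ge1 //; lra.
Qed.

End one_sided_units.

Section cancellation.
Context R Z X (A : set (pathsp R X)).
Context (al p : Z -> pathsp R X).

(** The detour back along [p] and forth again is shortened from its far end. At time 1 it consists
    of two constant paths, and each of them costs one reparametrisation by [2 t]. *)
Lemma htp_cancel (g h : Z -> A) :
  cts al -> cts p -> (forall z, pev (al z) 1 = pev (p z) 1) ->
  (forall u w, pev u 0 = pev w 0 -> pev u 1 = pev w 1 -> A u -> A w) ->
  (forall z, set_val (g z) = catp (catp (al z) (subp (p z) 1 0)) (p z)) ->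
  (forall z, set_val (h z) = al z) -> htp R g h.
Proof.
move=> ca cp ap Aend gE hE.
pose H (z : Z * R) := catp (catp (al z.1) (subp (p z.1) 1 z.2)) (subp (p z.1) z.2 1).
have e1 z u : pev (al z) 1 = pev (subp (p z) 1 u) 0 by rewrite subp0.
have e2 z u : pev (catp (al z) (subp (p z) 1 u)) 1 = pev (subp (p z) u 1) 0.
  by rewrite catp1 // subp1 subp0.
have cH : cts H by rewrite /H; ctsify.
have AH z u : A (H (z, u)).
  apply: (Aend (set_val (h z))); last exact: set_valP.
    by rewrite hE /H !catp0.
  by rewrite hE /H catp1 // subp1.
apply: (@htp_trans _ _ _ (fun z => corestr (fun z => AH z 1) z)).
  apply: (@htp_sub _ _ _ _ _ _ H) => //.
  by move=> z; rewrite gE /H /= subp_full.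
have h20 : (1 : R) <= 2 - 0 by lra.
apply: (@htp_reparam _ _ _ _ al (2 * 2) (2 * 0 + 0)) => //; [by lra..|].
move=> z; change (H (z, 1) = reparam (al z) (2 * 2) (2 * 0 + 0) 1).
have -> : H (z, 1) = catp (catp (al z) (subp (p z) 1 1)) (subp (p z) 1 1) by [].
have cst t : pev (subp (p z) 1 1) t = pev (al z) 1.
  by rewrite pev_subp subrr mul0r addr0 ap.
rewrite catp_cst_right => [|t]; last by rewrite cst catp1 // cst.
by rewrite catp_cst_right // reparam_twice.
Qed.

End cancellation.

(* A retraction [r : P -> X] with section [s] splits the loop space of [P]:
   writing [G] for the homotopy fibre of [s], the sequence
   [loops X -> loops P -> G] is trivialised because the path [r w] contracts the
   starting point [r (w 0)] of every [w] in [G]; and [G] is the loop space of the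
   homotopy fibre of [r]. *)
Section splitting.
Context R (P X : topologicalType) (r : P -> X) (s : X -> P).
Context (cr : cts r) (cs : cts s) (rs : forall x, r (s x) = x) (x0 : X).

Let p0 := s x0.

Local Notation sec_fib_set :=
  [set w : pathsp R P | pev w 0 = s (r (pev w 0)) /\ pev w 1 = p0].

Local Notation sec_pairs_set := [set z : pathsp R P * pathsp R X |
    (pev z.1 0 = s (r (pev z.1 0)) /\ pev z.1 1 = p0) /\
    (pev z.2 0 = x0 /\ pev z.2 1 = r (pev z.1 0))].

(** The homotopy fibre of [s]: as [s] is injective with left inverse [r], the point of [X] is
    recovered as [r (w 0)] and need not be stored. *)
Definition sec_fib : topologicalType :=
  set_type sec_fib_set.

(** A path [w] of [sec_fib] together with a path [b] in [X] from [x0] to [r (w 0)]. Such a pair can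
    be read in two ways: [s b] followed by [w] is a loop in [P], and [b] followed by [r w] is a loop
    in [X]. *)
Definition sec_pairs : topologicalType :=
  set_type sec_pairs_set.

Lemma sec_fibP (w : sec_fib) :
  pev (set_val w) 0 = s (r (pev (set_val w) 0)) /\ pev (set_val w) 1 = p0.
Proof. exact: (set_valP w). Qed.

Lemma sec_pairsP (z : sec_pairs) :
    (pev (set_val z).1 0 = s (r (pev (set_val z).1 0)) /\ pev (set_val z).1 1 = p0) /\
    (pev (set_val z).2 0 = x0 /\ pev (set_val z).2 1 = r (pev (set_val z).1 0)).
Proof. exact: (set_valP z). Qed.

(** The inverse pairs a loop with the constant path. The homotopy on pairs splits [b] at time [u]:
    the part after [u] is pushed into [P] by [s] and put before [w], the part before [u] is kept. *)
Lemma loops_sec_pairs : heqv R sec_pairs (paths R p0 p0).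
Proof.
have e1 (z : sec_pairs) u :
    pev (mapp cs (subp (set_val z).2 u 1)) 1 = pev (set_val z).1 0.
  by have [[a b] [c d]] := sec_pairsP z; rewrite pev_mapp subp1 d.
have fP (z : sec_pairs) :
    pev (catp (mapp cs (subp (set_val z).2 0 1)) (set_val z).1) 0 = p0 /\
    pev (catp (mapp cs (subp (set_val z).2 0 1)) (set_val z).1) 1 = p0.
  have [[a b] [c d]] := sec_pairsP z.
  by rewrite catp0 catp1 // b pev_mapp subp0 c.
pose f z : paths R p0 p0 := mkpaths (fP z).
have cx0 : cts (fun _ : R => x0) by ctsify.
have gP (w : paths R p0 p0) :
    (pev (set_val w) 0 = s (r (pev (set_val w) 0)) /\ pev (set_val w) 1 = p0) /\
    (pev (mkp cx0) 0 = x0 /\ pev (mkp cx0) 1 = r (pev (set_val w) 0)).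
  by rewrite paths_zero paths_one !pev_mkp /p0 !rs.
pose g : paths R p0 p0 -> sec_pairs := corestr (fun w => gP w : sec_pairs_set (set_val w, mkp cx0)).
have cf : cts f by apply: cts_mkpaths; ctsify.
have cg : cts g by apply: cts_corestr; ctsify.
exists f; split=> //; exists g; split=> //.
- pose H (z : sec_pairs * R) :=
    (catp (mapp cs (subp (set_val z.1).2 z.2 1)) (set_val z.1).1,
     subp (set_val z.1).2 0 z.2).
  have cH : cts H by rewrite /H; ctsify.
  have HP z u : (pev (H (z, u)).1 0 = s (r (pev (H (z, u)).1 0)) /\ pev (H (z, u)).1 1 = p0) /\
    (pev (H (z, u)).2 0 = x0 /\ pev (H (z, u)).2 1 = r (pev (H (z, u)).1 0)).
    have [[a b] [c d]] := sec_pairsP z.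
    by rewrite /H /= catp0 catp1 // subp0 subp1 pev_mapp subp0 b c rs.
  apply: (@htp_trans _ _ _ (fun z => corestr (fun z => HP z 1 : sec_pairs_set (H (z, 1))) z)).
    apply: (@htp_sub _ _ _ _ _ _ H) => // [z t _|z]; first exact: HP.
    rewrite /H /=; congr (_, _).
    apply: pathsp_ext => t _; have [[a b] [c d]] := sec_pairsP z.
    by rewrite pev_subp subrr mul0r addr0 pev_mkp c.
  apply: (@htp_sub _ _ _ _ _ _ (fun z : sec_pairs * R =>
     (reparam (set_val z.1).1 2 1 (1 - z.2), (set_val z.1).2))).
  + by ctsify.
  + move=> z t t01 /=; have [[a b] [c d]] := sec_pairsP z.
    have s01 : 0 <= 1 - t <= 1 by case/andP: t01 => ? ?; apply/andP; split; lra.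
    have h21 : (1 : R) <= 2 - 1 by lra.
    have [-> ->] := @reparam_ends R _ (set_val z).1 2 1 _ s01 ler01 h21.
    by [].
  + move=> z /=; rewrite subr0; have [[a b] [c d]] := sec_pairsP z.
    change ((reparam (set_val z).1 2 1 1, (set_val z).2) = H (z, 1)).
    rewrite /H /= subp_full catp_cst_left // => t.
    by rewrite pev_mapp pev_subp subrr mul0r addr0 d -a.
  + by move=> z /=; rewrite subrr reparam_0 -surjective_pairing.
- have h21 : (1 : R) <= 2 - 1 by lra.
  apply: (@htp_reparam _ _ _ _ (fun w => set_val w) 2 1 _ _ ler01 h21) => //; first by ctsify.
    exact: paths_endsP.
  move=> w; change (catp (mapp cs (subp (mkp cx0) 0 1)) (set_val w) = reparam (set_val w) 2 1 1).
  by rewrite catp_cst_left // => t; rewrite pev_mapp pev_subp pev_mkp paths_zero.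
Qed.

(** The path [r w] runs from the end of [b] to [x0], so appending it or its reverse exchanges paths
    ending at [r (w 0)] with loops at [x0], up to cancellation. *)
Lemma sec_pairs_split : heqv R sec_pairs (paths R x0 x0 * sec_fib)%type.
Proof.
have e1 (z : sec_pairs) : pev (set_val z).2 1 = pev (mapp cr (set_val z).1) 0.
  by have [[a b] [c d]] := sec_pairsP z; rewrite pev_mapp.
have e1' (w : sec_fib) : pev (mapp cr (set_val w)) 1 = x0.
  by rewrite pev_mapp (sec_fibP w).2 rs.
have fP1 (z : sec_pairs) : pev (catp (set_val z).2 (mapp cr (set_val z).1)) 0 = x0 /\
    pev (catp (set_val z).2 (mapp cr (set_val z).1)) 1 = x0.
  have [[a b] [c d]] := sec_pairsP z.
  by rewrite catp0 catp1 // pev_mapp b rs c.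
pose f1 z : paths R x0 x0 := mkpaths (fP1 z).
pose f2 : sec_pairs -> sec_fib := corestr (fun z => (sec_pairsP z).1 :
  sec_fib_set (set_val z).1).
have e3 (z : paths R x0 x0 * sec_fib) :
    pev (set_val z.1) 1 = pev (subp (mapp cr (set_val z.2)) 1 0) 0.
  by rewrite paths_one subp0 e1'.
have gP (z : paths R x0 x0 * sec_fib) :
  sec_pairs_set
   (set_val z.2, catp (set_val z.1) (subp (mapp cr (set_val z.2)) 1 0)).
  split; first exact: sec_fibP.
  split; first by rewrite [LHS]catp0 paths_zero.
  by rewrite [LHS](catp1 (e3 z)) subp1 pev_mapp.
have cf1 : cts f1 by apply: cts_mkpaths; ctsify.
have cf2 : cts f2 by apply: cts_corestr; ctsify.
have cg : cts (corestr gP) by apply: cts_corestr; ctsify.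
exists (fun z => (f1 z, f2 z)); split; first by ctsify.
exists (corestr gP); split=> //.
- pose B (z : sec_pairs) : set (pathsp R X) :=
    [set b | pev b 0 = x0 /\ pev b 1 = r (pev (set_val z).1 0)].
  (* The end point required of the second path varies with [z], whereas [htp_cancel] has a fixed set
     [A]; its homotopy is therefore repeated on pairs. *)
  pose p (z : sec_pairs) := subp (mapp cr (set_val z).1) 1 0.
  pose H (z : sec_pairs * R) :=
    catp (catp (set_val z.1).2 (subp (p z.1) 1 z.2)) (subp (p z.1) z.2 1).
  have h1 (z : sec_pairs) u : pev (set_val z).2 1 = pev (subp (p z) 1 u) 0.
    by rewrite subp0 subp1 pev_mapp; have [[a b] [c d]] := sec_pairsP z.
  have h2 (z : sec_pairs) u : pev (catp (set_val z).2 (subp (p z) 1 u)) 1 =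
      pev (subp (p z) u 1) 0.
    by rewrite catp1 // subp1 subp0.
  have cp : cts p by rewrite /p; ctsify.
  have cH : cts H by rewrite /H; ctsify.
  pose K (z : sec_pairs * R) := ((set_val z.1).1, H z).
  have KP z u : sec_pairs_set (K (z, u)).
    have [[a b] [c d]] := sec_pairsP z.
    by rewrite /K /H /= !catp0 catp1 // !subp1 pev_mapp.
  apply: (@htp_trans _ _ _ (fun z => corestr (fun z => KP z 1) z)).
    apply: (@htp_sub _ _ _ _ _ _ K) => //; first by rewrite /K; ctsify.
    move=> z; rewrite /K /=; congr (_, _); rewrite /H /= subp_full.
    congr (catp (catp _ _) _); apply: pathsp_ext => t /andP[t0 t1].
    rewrite !pev_subp !clamp_id; [|apply/andP; split; lra..].
    by congr pev; lra.
  apply: (@htp_sub _ _ _ _ _ _ (fun z : sec_pairs * R =>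
     ((set_val z.1).1, reparam (set_val z.1).2 (2 * 2) (2 * 0 + 0) (1 - z.2)))).
  + by ctsify.
  + move=> z t t01; have [[a b] [c d]] := sec_pairsP z.
    have s01 : 0 <= 1 - t <= 1 by case/andP: t01 => ? ?; apply/andP; split; lra.
    have [||] := @reparam_ends R _ (set_val z).2 (2 * 2) (2 * 0 + 0) _ s01; [by lra..|].
    by rewrite /= => -[-> ->].
  + move=> z /=; rewrite subr0; have [[a b] [c d]] := sec_pairsP z.
    change (((set_val z).1, reparam (set_val z).2 (2 * 2) (2 * 0 + 0) 1) = K (z, 1)).
    rewrite /K /H /=; congr (_, _).
    have cst t : pev (subp (p z) 1 1) t = pev (set_val z).2 1.
      by rewrite pev_subp subrr mul0r addr0 (h1 z 0) subp0.
    rewrite (catp_cst_right (v := subp (p z) 1 1)) => [|t]; last by rewrite cst catp1 // cst.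
    by rewrite catp_cst_right // reparam_twice //; lra.
  + by move=> z /=; rewrite subrr reparam_0 -surjective_pairing.
- have [H [cH H0 H1]] : htp R (fun z => f1 (corestr gP z)) (fun z => z.1).
    apply: (@htp_cancel _ _ _ _ (fun z => set_val z.1) (fun z => mapp cr (set_val z.2))) => //.
    + by ctsify.
    + by ctsify.
    + by move=> z; rewrite paths_one e1'.
    + exact: paths_endsP.
  exists (fun z => (H z, z.1.2)); split=> [|z|z] /=; first by ctsify.
    by rewrite H0; congr (_, _); exact: val_inj.
  by rewrite H1 -surjective_pairing.
Qed.

End splitting.

(** * Loops of a retract *)

Section fibre_of_retraction.
Context R (P X : topologicalType) (r : P -> X) (s : X -> P).
Context (cr : cts r) (cs : cts s) (rs : forall x, r (s x) = x) (x0 : X).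

Local Notation ret_fib_set := [set z : P * pathsp R X | pev z.2 0 = r z.1 /\ pev z.2 1 = x0].

Definition ret_fib : topologicalType :=
  set_type ret_fib_set.

Lemma ret_fibP (z : ret_fib) :
  pev (set_val z).2 0 = r (set_val z).1 /\ pev (set_val z).2 1 = x0.
Proof. exact: (set_valP z). Qed.

Lemma cts_cst_path : cts (fun _ : R => x0).
Proof. exact: cts_cst. Qed.

Lemma ret_fib_point_subproof :
  ret_fib_set
    (s x0, mkp cts_cst_path).
Proof. by rewrite /= !pev_mkp rs. Qed.

Definition ret_fib_point : ret_fib := SigSub (mem_set ret_fib_point_subproof).

Lemma val_ret_fib_point : set_val ret_fib_point = (s x0, mkp cts_cst_path).
Proof. by []. Qed.

Definition starts_in_section (w : pathsp R ret_fib) : Prop :=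
  (set_val (pev w 0)).1 = s (r (set_val (pev w 0)).1).

Local Notation ret_fib_paths_set :=
  [set w : pathsp R ret_fib | starts_in_section w /\ pev w 1 = ret_fib_point].

Definition ret_fib_paths : topologicalType :=
  set_type ret_fib_paths_set.

Lemma ret_fib_pathsP (w : ret_fib_paths) :
  starts_in_section (set_val w) /\ pev (set_val w) 1 = ret_fib_point.
Proof. exact: (set_valP w). Qed.

(** A path [w] in [P] ending at [s x0] lifts to the fibre of [r]: at time [t] the second coordinate
    is the rest of [r w], written [u |-> r (w (max t u))]. Forgetting the second coordinate is the
    inverse. *)
Lemma sec_fib_ret_fib_paths : heqv R (sec_fib R r s x0) ret_fib_paths.
Proof.
have cG (w : pathsp R P) (t : R) : cts (fun u : R => r (pev w (Num.max t u))).
  by ctsify.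
have cG2 (w : pathsp R P) : cts (fun t : R => (pev w t, mkp (cG w (clamp t)))).
  by apply: cts_pair; [ctsify|apply: cts_pathsp_mkp; ctsify].
have GP (w : sec_fib R r s x0) (t : R) :
    pev (mkp (cG (set_val w) (clamp t))) 0 = r (pev (set_val w) t) /\
    pev (mkp (cG (set_val w) (clamp t))) 1 = x0.
  rewrite !pev_mkp clamp0 clamp1; have /andP[t0 t1] := clamp01 t.
  rewrite (max_idPl t0) (max_idPr t1) pev_clamp.
  by have [_ ->] := sec_fibP w; rewrite rs.
pose fp (w : sec_fib R r s x0) (t : R) : ret_fib := corestr (fun t => GP w t :
  ret_fib_set
    (pev (set_val w) t, mkp (cG (set_val w) (clamp t)))) t.
have cfp w : cts (fp w) by apply: cts_corestr; exact: cG2.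
have val_fp w t : set_val (fp w t) = (pev (set_val w) t, mkp (cG (set_val w) (clamp t))).
  by [].
have fP (w : sec_fib R r s x0) :
    starts_in_section (mkp (cfp w)) /\ pev (mkp (cfp w)) 1 = ret_fib_point.
  split; first by rewrite /starts_in_section pev_mkp val_fp clamp0 /=; case: (sec_fibP w).
  rewrite pev_mkp clamp1; apply: val_inj.
  change ((pev (set_val w) 1, mkp (cG (set_val w) (clamp 1))) = (s x0, mkp cts_cst_path)).
  have [_ e] := sec_fibP w; rewrite e; congr (_, _).
  apply: pathsp_ext => t t01; rewrite !pev_mkp (clamp_id t01) clamp1.
  by case/andP: t01 => _ t1; rewrite (max_idPl t1) e rs.
pose f : sec_fib R r s x0 -> ret_fib_paths := corestr (fun w => fP w :
  ret_fib_paths_set (mkp (cfp w))).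
have cf : cts f.
  apply: cts_corestr; apply: cts_pathsp_mkp; apply: cts_set_type.
  apply: cts_pair; first by rewrite /=; ctsify.
  by apply: cts_pathsp_mkp; ctsify.
have cpr (w : pathsp R ret_fib) : cts (fun t : R => (set_val (pev w t)).1) by ctsify.
have gP (w : ret_fib_paths) :
  [set v : pathsp R P | pev v 0 = s (r (pev v 0)) /\ pev v 1 = s x0]
    (mkp (cpr (set_val w))).
  have [a b] := ret_fib_pathsP w.
  by rewrite /= !pev_mkp clamp0 clamp1 b.
pose g : ret_fib_paths -> sec_fib R r s x0 := corestr gP.
have cg : cts g by apply: cts_corestr; apply: cts_pathsp_mkp; ctsify.
exists f; split=> //; exists g; split=> //.
- apply: htp_eq => [|w]; first exact: (cts_comp cg cf).
  apply: val_inj; apply: pathsp_ext => t t01.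
  change (pev (mkp (cpr (mkp (cfp w)))) t = pev (set_val w) t).
  by rewrite !pev_mkp !(clamp_id t01) val_fp.
(* Write the lifted path as [t |-> (y_t, c_t)]. The second coordinate becomes
   [v |-> c_(max t (a v)) (b v)]: it is [c_t] at [(a, b) = (0, 1)] and the rest of [r y] at
   [(1, 0)]. The route passes through [(1, 1)] because its end is [x0] only if [b = 1], where [c]
   ends, or [a = 1], where [c_1] is constant. *)
- pose a (u : R) := clamp (2 * u).
  pose b (u : R) := clamp (2 - 2 * u).
  have cH1 (w : ret_fib_paths) (u t : R) : cts (fun v : R =>
      pev (set_val (pev (set_val w) (Num.max t (a u * v)))).2 (b u * v)).
    by rewrite /a /b; ctsify.
  have ab u : a u = 1 \/ b u = 1.
    rewrite /a /b; have [h|h] := leP 1 (2 * u); first by left; rewrite clamp_ge1.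
    by right; rewrite clamp_ge1 //; lra.
  have HP (w : ret_fib_paths) u t :
    ret_fib_set
      ((set_val (pev (set_val w) t)).1, mkp (cH1 w u (clamp t))).
    have [_ e] := ret_fib_pathsP w.
    split; rewrite /= pev_mkp ?clamp0 ?clamp1 ?mulr0 ?mulr1.
      have /andP[t0 _] := clamp01 t.
      by rewrite (max_idPl t0) pev_clamp; have [-> _] := ret_fibP (pev (set_val w) t).
    have [->|->] := ab u.
      by have /andP[_ t1] := clamp01 t; rewrite (max_idPr t1) e pev_mkp.
    by have [_ ->] := ret_fibP (pev (set_val w) (Num.max (clamp t) (a u))).
  pose Hp (w : ret_fib_paths) u (t : R) : ret_fib := corestr (HP w u) t.
  have cHp2 : cts (fun z : ret_fib_paths * R * R => Hp z.1.1 z.1.2 z.2).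
    apply: cts_set_type; apply: cts_pair; first by rewrite /=; ctsify.
    by apply: cts_pathsp_mkp; rewrite /a /b; ctsify.
  have cHp w u : cts (Hp w u).
    pose k (t : R) := (w, u, t).
    have ck : cts k by rewrite /k; ctsify.
    exact: (cts_comp cHp2 ck).
  have val_Hp w u t : set_val (Hp w u t) =
    ((set_val (pev (set_val w) t)).1, mkp (cH1 w u (clamp t))) by [].
  apply/htp_sym; apply: (@htp_sub _ _ _ _ _ _ (fun z => mkp (cHp z.1 z.2))).
  + by apply: cts_pathsp_mkp; ctsify.
  + move=> w u _; have [c d] := ret_fib_pathsP w; split.
      rewrite /starts_in_section pev_mkp val_Hp /= clamp0; exact: c.
    rewrite pev_mkp clamp1; apply: val_inj.
    change ((((set_val (pev (set_val w) 1)).1, mkp (cH1 w u (clamp 1)))) = (s x0, mkp cts_cst_path)).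
    rewrite d; congr (_, _); apply: pathsp_ext => t t01; rewrite !pev_mkp clamp1.
    rewrite (clamp_id t01); case/andP: t01 => t0 t1.
    have /andP[a0 a1] : 0 <= a u <= 1 by exact: clamp01.
    have m : a u * t <= 1 by exact: mulr_ile1.
    by rewrite (max_idPl m) d pev_mkp.
  + move=> w; apply: pathsp_ext => t t01; rewrite pev_mkp /=; apply: val_inj.
    change (((set_val (pev (set_val w) (clamp t))).1, mkp (cH1 w 0 (clamp (clamp t)))) =
             set_val (pev (set_val w) t)).
    rewrite pev_clamp clampK [RHS]surjective_pairing; congr (_, _).
    apply: pathsp_ext => v v01; rewrite pev_mkp /a /b mulr0 subr0 clamp0 mul0r.
    have /andP[t0 t1] := clamp01 t.
    by rewrite (max_idPl t0) (@clamp_ge1 R 2) ?ler1n // mul1r !pev_clamp.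
  + move=> w; apply: pathsp_ext => t t01; rewrite pev_mkp /=; apply: val_inj.
    change (((set_val (pev (set_val w) (clamp t))).1, mkp (cH1 w 1 (clamp (clamp t)))) =
             set_val (pev (mkp (cfp (g w))) t)).
    have gE u : pev (set_val (g w)) u = (set_val (pev (set_val w) u)).1.
      by change (pev (mkp (cpr (set_val w))) u = (set_val (pev (set_val w) u)).1);
         rewrite pev_mkp pev_clamp.
    rewrite pev_mkp val_fp; congr (_, _); first exact: (esym (gE _)).
    apply: pathsp_ext => v v01; rewrite !pev_mkp clampK.
    apply: (@eq_trans _ _ (r (set_val (pev (set_val w) (Num.max (clamp t) (clamp v)))).1)).
      rewrite /a /b mulr1 subrr clamp0 mul0r (@clamp_ge1 R 2) ?ler1n // mul1r.
      by have [-> _] := ret_fibP (pev (set_val w) (Num.max (clamp t) (clamp v))).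
    by rewrite pev_clamp.
Qed.

(** The part of the fibre over the section is the space of paths in [X] ending at [x0], which is
    contractible. A path starting there is closed to a loop by the track of its starting point. *)
Lemma ret_fib_paths_loops : heqv R ret_fib_paths (paths R ret_fib_point ret_fib_point).
Proof.
(* The contraction slides a point along its own path. The formula makes sense on the whole fibre,
   but starts at the identity only over the section ([k0]). *)
have kP (z : ret_fib * R) :
  ret_fib_set
    (s (pev (set_val z.1).2 z.2), subp (set_val z.1).2 z.2 1).
  have [a b] := ret_fibP z.1.
  by rewrite /= subp0 subp1 rs b.
pose k : ret_fib * R -> ret_fib := corestr kP.
have ck : cts k by apply: cts_corestr; ctsify.
have ck1 z : cts (fun t => k (z, t)) by ctsify.
pose tr z := mkp (ck1 z).
have ctr : cts tr by apply: cts_pathsp_mkp; ctsify.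
have val_k z t : set_val (k (z, t)) = (s (pev (set_val z).2 t), subp (set_val z).2 t 1).
  by [].
have k0 (z : ret_fib) : (set_val z).1 = s (r (set_val z).1) -> k (z, 0) = z.
  move=> e; apply: val_inj; rewrite -!set_valE val_k subp_full.
  by have [-> _] := ret_fibP z; rewrite -e -surjective_pairing.
have k1 z : k (z, 1) = ret_fib_point.
  apply: val_inj; change (set_val (k (z, 1)) = (s x0, mkp cts_cst_path)); rewrite val_k.
  have [_ e] := ret_fibP z; rewrite e; congr (_, _); apply: pathsp_ext => t _.
  by rewrite pev_subp subrr mul0r addr0 e pev_mkp.
have kpt t : k (ret_fib_point, t) = ret_fib_point.
  apply: val_inj; change (set_val (k (ret_fib_point, t)) = (s x0, mkp cts_cst_path)).
  rewrite val_k val_ret_fib_point; congr (_, _).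
  by apply: pathsp_ext => u _; rewrite pev_subp; change (x0 = x0).
have e (w : ret_fib_paths) t :
    pev (subp (tr (pev (set_val w) 0)) t 0) 1 = pev (set_val w) 0.
  have [c d] := ret_fib_pathsP w.
  by rewrite subp1 pev_mkp clamp0 k0.
have fP (w : ret_fib_paths) :
  pev (catp (subp (tr (pev (set_val w) 0)) 1 0) (set_val w)) 0 = ret_fib_point /\
  pev (catp (subp (tr (pev (set_val w) 0)) 1 0) (set_val w)) 1 = ret_fib_point.
  have [c d] := ret_fib_pathsP w.
  by rewrite catp0 (catp1 (e w 1)) subp0 pev_mkp clamp1 k1 d.
have gP (w : paths R ret_fib_point ret_fib_point) :
  ret_fib_paths_set (set_val w).
  by rewrite /= /starts_in_section paths_zero paths_one /= rs.
have cf : cts (fun w => mkpaths (fP w)) by apply: cts_mkpaths; ctsify.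
have cg : cts (corestr gP) by apply: cts_corestr; ctsify.
have h21 : (1 : R) <= 2 - 1 by lra.
exists (fun w => mkpaths (fP w)); split=> //; exists (corestr gP); split=> //.
- pose H (z : ret_fib_paths * R) := catp (subp (tr (pev (set_val z.1) 0)) z.2 0) (set_val z.1).
  have cH : cts H by rewrite /H; ctsify.
  have HP w t : ret_fib_paths_set (H (w, t)).
    split; last by rewrite /H (catp1 (e w t)); have [] := ret_fib_pathsP w.
    by rewrite /starts_in_section /H /= catp0 subp0 pev_mkp val_k /= rs.
  have H0 : htp R (corestr (fun w => HP w 0)) id.
    apply: (@htp_reparam _ _ _ _ (fun w => set_val w) 2 1 _ _ ler01 h21) => //; first by ctsify.
      by move=> u w; rewrite /= /starts_in_section => -> ->.
    move=> w; change (H (w, 0) = reparam (set_val w) 2 1 1); apply: catp_cst_left => t.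
    have [c d] := ret_fib_pathsP w.
    by rewrite pev_subp subrr mul0r addr0 pev_mkp clamp0 k0.
  apply: htp_trans H0; apply: (@htp_sub _ _ _ _ _ _ (fun z => H (z.1, 1 - z.2))).
  + by ctsify.
  + by move=> w t _; exact: HP.
  + by move=> w; rewrite /= subr0.
  + by move=> w; rewrite [LHS]/= subrr.
- apply: (@htp_reparam _ _ _ _ (fun w => set_val w) 2 1 _ _ ler01 h21) => //; first by ctsify.
    exact: paths_endsP.
  move=> w; change (catp (subp (tr (pev (set_val w) 0)) 1 0) (set_val w) =
                    reparam (set_val w) 2 1 1).
  apply: catp_cst_left => t.
  by rewrite pev_subp pev_mkp paths_zero kpt.
Qed.

Lemma loops_retraction_split :
  heqv R (paths R (s x0) (s x0))
    (paths R x0 x0 * paths R ret_fib_point ret_fib_point)%type.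
Proof.
apply: heqv_trans (heqv_sym (loops_sec_pairs R cs rs x0)) _.
apply: heqv_trans (sec_pairs_split R cr rs x0) _.
apply: heqv_prod; first by exists (fun x => x); exact: heq_id.
exact: heqv_trans sec_fib_ret_fib_paths ret_fib_paths_loops.
Qed.

End fibre_of_retraction.

(** * Pushouts and the homotopy extension property *)

Lemma itv01 R : (0 : R) <= 0 <= (1 : R).
Proof. by rewrite lexx ler01. Qed.

Lemma itv11 R : (0 : R) <= 1 <= (1 : R).
Proof. by rewrite lexx ler01. Qed.

Local Notation collar_set R A :=
  [set z : _ * R%type | (A z.1 /\ 0 <= z.2 <= 1) \/ z.2 = 1].

Section pushouts.
Context R.

(** Pushouts up to homeomorphism, so that telescopes, the stages of the gluing and auxiliary
    quotients are treated alike. Joint surjectivity gives uniqueness of induced maps. *)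
Definition pushout_sq (A Z X Q : topologicalType) (f : A -> Z) (i : A -> X)
    (jZ : Z -> Q) (jX : X -> Q) : Prop :=
  [/\ cts jZ, cts jX, forall a, jZ (f a) = jX (i a),
      forall q, (exists z, jZ z = q) \/ (exists x, jX x = q)
    & forall V (u : Z -> V) (v : X -> V), cts u -> cts v ->
        (forall a, u (f a) = v (i a)) ->
        exists h : Q -> V, [/\ cts h, forall z, h (jZ z) = u z
                             & forall x, h (jX x) = v x]].

Lemma pushoutP (B C Y : topologicalType) (g : C -> B) (f : C -> Y) :
  pushout_sq g f (@pushout_inl B C Y g f) (@pushout_inr B C Y g f).
Proof.
split.
- move=> x; apply: (@continuous_comp _ _ _ (@po_inB B Y) \pi_(pushout g f)%qT).
    exact: (existT_continuous true).
  exact: pi_continuous.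
- move=> x; apply: (@continuous_comp _ _ _ (@po_inY B Y) \pi_(pushout g f)%qT).
    exact: (existT_continuous false).
  exact: pi_continuous.
- move=> c; apply/eqmodP; apply/asboolP; apply: Relation_Operators.rst_step.
  by exists c.
- move=> q; rewrite -[q]reprK; case: (repr q) => -[] y; [left|right]; by exists y.
- move=> V u v cu cv uv.
  pose uv_ (b : bool) : po_family B Y b -> V :=
    if b as b' return (po_family B Y b' -> V) then u else v.
  pose w (s : {b : bool & po_family B Y b}) := uv_ (projT1 s) (projT2 s).
  have cuv b : continuous (uv_ b) by case: b.
  have cw : continuous w by exact: (sigT_continuous uv_ cuv).
  have wE s t : po_rel g f s t -> w s = w t.
    move/asboolP; elim=> [x y [c [-> ->]]|x|x y _ e|x y z _ e1 _ e2] //.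
      exact: uv.
    by rewrite e1.
  have wpi s : w (repr (\pi_(pushout g f)%qT s)) = w s.
    by apply: wE; apply/eqmodP; rewrite reprK.
  exists (fun q => w (repr q)); split.
  + apply/(@quotient_continuous _ (pushout g f)).
    by apply: (@cts_ext _ _ w) => // s; rewrite /= wpi.
  + by move=> z; rewrite /pushout_inl wpi.
  + by move=> x; rewrite /pushout_inr wpi.
Qed.

(** The universal property is applied with the path space of [V] as target, so the product of the
    pushout with the interval is never analysed. *)
Lemma pushout_htp (A Z X Q V : topologicalType) (f : A -> Z) (i : A -> X)
    (jZ : Z -> Q) (jX : X -> Q) (u : Z * R -> V) (v : X * R -> V) :
  pushout_sq f i jZ jX -> cts u -> cts v ->
  (forall a t, 0 <= t <= 1 -> u (f a, t) = v (i a, t)) ->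
  exists h : Q * R -> V, [/\ cts h,
    forall z t, 0 <= t <= 1 -> h (jZ z, t) = u (z, t)
    & forall x t, 0 <= t <= 1 -> h (jX x, t) = v (x, t)].
Proof.
move=> [_ _ _ _ univ] cu cv uv.
have cu1 z : cts (fun t => u (z, t)) by ctsify.
have cv1 z : cts (fun t => v (z, t)) by ctsify.
have [||a|h [ch hZ hX]] := univ _ (fun z => mkp (cu1 z)) (fun x => mkp (cv1 x)).
- by apply: cts_pathsp_mkp; ctsify.
- by apply: cts_pathsp_mkp; ctsify.
- by apply: pathsp_ext => t t01; rewrite !pev_mkp clamp_id // uv.
exists (fun z => pev (h z.1) z.2); split=> [|z t t01|x t t01] /=; first by ctsify.
- by rewrite hZ pev_mkp clamp_id.
- by rewrite hX pev_mkp clamp_id.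
Qed.

(* [rho] retracts the cylinder over [X] onto its bottom and the cylinder over
   [A]. *)
Definition cyl_retraction X (A : set X)
    (rho : X * R -> X * R) : Prop :=
  [/\ cts rho, forall x, rho (x, 0) = (x, 0),
      forall x t, A x -> 0 <= t <= 1 -> rho (x, t) = (x, t)
    & forall x t, 0 <= t <= 1 -> 0 <= (rho (x, t)).2 <= 1 /\
        ((rho (x, t)).2 = 0 \/ A (rho (x, t)).1)].

(** The extension is [rho] followed by the union of [h0] and [G]. The conclusion retains this
    formula, and not only the prescribed values as in [hep_simple], because
    [attach_homotopy_left_inverse] compares [E] with [rho]. *)
Lemma hep X (A : set X) (rho : X * R -> X * R)
    V (h0 : X -> V) (G : A * R -> V) :
  closed A -> cyl_retraction A rho -> cts h0 -> cts G ->
  (forall a, G (a, 0) = h0 (set_val a)) ->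
  exists E : X * R -> V, cts E /\ forall x t, 0 <= t <= 1 ->
    ((rho (x, t)).2 = 0 -> E (x, t) = h0 (rho (x, t)).1) /\
    (forall a : A, (rho (x, t)).1 = set_val a -> E (x, t) = G (a, (rho (x, t)).2)).
Proof.
move=> clA [crho rho0 rhoA rhoP] ch cG Gh.
pose k (z : X * R) := match pselect (A z.1) with
  | left a => G (SigSub (mem_set a), z.2) | right _ => h0 z.1 end.
have k0 z : z.2 = 0 -> k z = h0 z.1.
  by rewrite /k => e; case: pselect => // a; rewrite e Gh.
have kA z (a : A) : z.1 = set_val a -> k z = G (a, z.2).
  rewrite /k => e; case: pselect => [b|]; last by rewrite e => /(_ (set_valP a)).
  by congr (G (_, _)); apply: val_inj.
pose rc (z : X * R) := rho (z.1, clamp z.2).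
have crc : cts rc by rewrite /rc; ctsify.
exists (fun z => k (rc z)); split; last first.
  by move=> x t t01; rewrite /rc /= clamp_id //; split=> [/k0|a /kA].
pose C0 := [set z | (rc z).2 = 0]; pose C1 := [set z | A (rc z).1].
apply: (@cts_cover2 _ _ C0 C1).
- by apply: closed_eqc; ctsify.
- by apply: (@closed_preimage _ _ (fun z => (rc z).1) A) => //; ctsify.
- by move=> z; have [] := rhoP z.1 (clamp z.2) (clamp01 _).
- apply: (@cts_ext _ _ (fun z : C0 => h0 (rc (set_val z)).1)); last by ctsify.
  by move=> z; rewrite k0 //; exact: (set_valP z).
- have AP (z : C1) : A (rc (set_val z)).1 by exact: (set_valP z).
  apply: (@cts_ext _ _ (fun z : C1 => G (corestr AP z, (rc (set_val z)).2))).
    by move=> z; apply: kA.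
  have cA : cts (corestr AP) by apply: cts_corestr; ctsify.
  by ctsify.
Qed.

Section cobase_change.
Context X (A : set X) (rho : X * R -> X * R).
Context (clA : closed A) (rhoP : cyl_retraction A rho).

Let i : A -> X := set_val.

Lemma hep_simple V (h0 : X -> V) (G : A * R -> V) :
  cts h0 -> cts G -> (forall a, G (a, 0) = h0 (i a)) ->
  exists E : X * R -> V, [/\ cts E, forall x, E (x, 0) = h0 x
    & forall (a : A) t, 0 <= t <= 1 -> E (i a, t) = G (a, t)].
Proof.
move=> ch cG Gh; have [E [cE EP]] := hep clA rhoP ch cG Gh.
have [_ rho0 rhoA _] := rhoP.
exists E; split=> // [x|a t t01].
  by have [e _] := EP x 0 (itv01 R); rewrite e rho0.
have [_ e] := EP (i a) t t01.
by rewrite (e a) rhoA //; exact: (set_valP a).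
Qed.

(** On [Z'] the left inverse [L] is [g']; on [X] it cannot be the inclusion, since [g' g] is only
    homotopic to the identity. The homotopy [H] is therefore extended over [X] to [E], whose final
    map is used there; [E] run backwards deforms [L th] to the identity. *)
Lemma cobase_left_inverse (Z Z' Q Q' : topologicalType) (f : A -> Z) (g : Z -> Z')
    (g' : Z' -> Z) (H : Z * R -> Z)
    (jZ : Z -> Q) (jX : X -> Q) (jZ' : Z' -> Q') (jX' : X -> Q') (th : Q -> Q') :
  cts f -> cts g' -> cts H ->
  (forall z, H (z, 0) = g' (g z)) -> (forall z, H (z, 1) = z) ->
  pushout_sq f i jZ jX -> pushout_sq (fun a => g (f a)) i jZ' jX' ->
  cts th -> (forall z, th (jZ z) = jZ' (g z)) -> (forall x, th (jX x) = jX' x) ->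
  exists (E : X * R -> Q) (L : Q' -> Q),
    [/\ cts E,
        forall x t, 0 <= t <= 1 ->
          ((rho (x, t)).2 = 0 -> E (x, t) = jX (rho (x, t)).1) /\
          (forall a : A, (rho (x, t)).1 = i a ->
             E (x, t) = jZ (H (f a, 1 - (rho (x, t)).2)))
      & [/\ cts L, forall z, L (jZ' z) = jZ (g' z), forall x, L (jX' x) = E (x, 1)
          & htp R (fun q => L (th q)) id]].
Proof.
move=> cf cg' cH H0 H1 po [_ _ _ _ univ'] cth thZ thX.
have [cjZ cjX jf surj _] := po.
have [|a|E [cE EP]] := hep (V := Q) (h0 := jX) (G := fun z => jZ (H (f z.1, 1 - z.2)))
    clA rhoP cjX.
- by ctsify.
- by rewrite /= subr0 H1 jf.
have [_ rho0 rhoA _] := rhoP.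
have E0 x : E (x, 0) = jX x.
  by have [e _] := EP x 0 (itv01 R); rewrite e rho0.
have EA (a : A) t : 0 <= t <= 1 -> E (i a, t) = jZ (H (f a, 1 - t)).
  move=> t01; have [_ e] := EP (i a) t t01.
  by rewrite (e a) rhoA //; exact: (set_valP a).
have [|||L [cL LZ LX]] := univ' Q (fun z => jZ (g' z)) (fun x => E (x, 1)).
- by ctsify.
- by ctsify.
- by move=> a /=; rewrite EA ?itv01 ?itv11 // subrr H0.
exists E, L; split=> //; split=> //.
have [|||h [ch hZ hX]] := @pushout_htp _ _ _ _ Q _ _ _ _ (fun z => jZ (H z))
    (fun z => E (z.1, 1 - z.2)) po.
- by ctsify.
- by ctsify.
- move=> a t /andP[t0 t1] /=; rewrite EA /=; first by congr (jZ (H (_, _))); lra.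
  by apply/andP; split; lra.
exists h; split=> // q; have [[z <-]|[x <-]] := surj q.
- by rewrite hZ ?itv01 ?itv11 // H0 thZ LZ.
- by rewrite hX ?itv01 ?itv11 // subr0 thX LX.
- by rewrite hZ ?itv01 ?itv11 // H1.
- by rewrite hX ?itv01 ?itv11 // subrr E0.
Qed.

(* Both pushouts along the two ends of a homotopy [H] of attaching maps are
   retracts of the pushout [W] of [H] itself, and the second one is a deformation
   retract of it. *)
Lemma attach_homotopy_left_inverse (Z Q0 Q1 : topologicalType) (H : A * R -> Z)
    (jZ0 : Z -> Q0) (jX0 : X -> Q0) (jZ1 : Z -> Q1) (jX1 : X -> Q1) (E : X * R -> Q1)
    (th : Q0 -> Q1) :
  cts H ->
  pushout_sq (fun a => H (a, 0)) i jZ0 jX0 ->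
  pushout_sq (fun a => H (a, 1)) i jZ1 jX1 ->
  cts th -> (forall z, th (jZ0 z) = jZ1 z) ->
  (forall x, th (jX0 x) = E (x, 1)) ->
  cts E -> (forall x t, 0 <= t <= 1 ->
    ((rho (x, t)).2 = 0 -> E (x, t) = jX1 (rho (x, t)).1) /\
    (forall a : A, (rho (x, t)).1 = i a -> E (x, t) = jZ1 (H (a, 1 - (rho (x, t)).2)))) ->
  exists N : Q1 -> Q0, cts N /\ htp R (fun q => N (th q)) id.
Proof.
move=> cH po0 po1 cth thZ thX cE EP.
have [crho rho0 rhoA rhoI] := rhoP.
have [cjZ0 cjX0 jf0 surj0 univ0] := po0; have [cjZ1 cjX1 jf1 surj1 univ1] := po1.
have ci : cts i by rewrite /i; ctsify.
pose Hc (z : A * R) := H (z.1, clamp z.2).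
pose iR (z : A * R) := (i z.1, z.2).
have cHc : cts Hc by rewrite /Hc; ctsify.
have ciR : cts iR by rewrite /iR; ctsify.
have poW := pushoutP Hc iR.
have [kZ [kX {}poW]] : exists (kZ : Z -> pushout Hc iR) (kX : X * R -> pushout Hc iR),
    pushout_sq Hc iR kZ kX by exists (pushout_inl Hc iR), (pushout_inr Hc iR).
have [ckZ ckX kf surjW univW] := poW.
have kA (a : A) t : kX (i a, t) = kZ (Hc (a, t)) by rewrite kf.
have EA (a : A) t : 0 <= t <= 1 -> E (i a, t) = jZ1 (H (a, 1 - t)).
  move=> t01; have [_ e] := EP (i a) t t01.
  by rewrite rhoA //= in e; [exact: e|exact: (set_valP a)].
have [|a|F [cF F0 FA]] := @hep_simple Q0 jX0 (fun z => jZ0 (H z)) cjX0.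
- by ctsify.
- by rewrite jf0.
have [||P0 [cP0 P0Z P0X]] := univW Q0 jZ0 (fun z => F (z.1, clamp z.2)) cjZ0.
- by ctsify.
- by move=> [a t] /=; rewrite FA ?clamp01.
have [||P1 [cP1 P1Z P1X]] := univW Q1 jZ1 (fun z => E (z.1, 1 - clamp z.2)) cjZ1.
- by ctsify.
- move=> [a t] /=; have /andP[t0 t1] := clamp01 t; rewrite EA.
    by rewrite /Hc /=; congr (jZ1 (H (_, _))); lra.
  by apply/andP; split; lra.
have [||I1 [cI1 I1Z I1X]] := univ1 (pushout Hc iR) kZ (fun x => kX (x, 1)) ckZ.
- by ctsify.
- by move=> a; rewrite kA /Hc /= clamp1.
have [||I0 [cI0 I0Z I0X]] := univ0 (pushout Hc iR) kZ (fun x => kX (x, 0)) ckZ.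
- by ctsify.
- by move=> a; rewrite kA /Hc /= clamp0.
have thE q : th q = P1 (I0 q).
  have [[z <-]|[x <-]] := surj0 q; first by rewrite thZ I0Z P1Z.
  by rewrite thX I0X P1X /= clamp0 subr0.
have P0I0 q : P0 (I0 q) = q.
  have [[z <-]|[x <-]] := surj0 q; first by rewrite I0Z P0Z.
  by rewrite I0X P0X /= clamp0 F0.
(* With [N = P0 I1] one has [N th = P0 I1 P1 I0], which is homotopic to [P0 I0 = id] as soon as
   [I1 P1] is homotopic to the identity of [W]. *)
exists (fun q => P0 (I1 q)); split; first by ctsify.
have [D [cD D0 D1]] : htp R (fun w => I1 (P1 w)) id.
  (* At [z.2 = 0] this is [I1 P1], that is [rho] turned upside down. As [z.2] grows to 1, the first
     coordinate follows [rho] down to height 0, where [rho] is the identity, while the second is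
     interpolated linearly. Over [A] the clamped height never changes. *)
  pose v (z : X * R * R) : pushout Hc iR :=
    let c := 1 - clamp z.1.2 in
    kX ((rho (z.1.1, (1 - z.2) * c)).1,
        1 - (z.2 * (1 - z.1.2) + (1 - z.2) * (rho (z.1.1, c)).2)).
  have cv : cts v by rewrite /v /=; ctsify.
  have [||h [ch hZ hX]] := @pushout_htp _ _ _ _ _ _ _ _ _ (fun z : Z * R => kZ z.1) v poW _ cv.
  - by ctsify.
  - move=> [a t] s /andP[s0 s1]; rewrite /v /=.
    have /andP[t0 t1] := clamp01 t.
    have Aa : A (i a) by exact: (set_valP a).
    rewrite !rhoA //=; try (by apply/andP; split; nra).
    rewrite kA /Hc /=; congr (kZ (H (_, _))).
    have [h|h] := leP t 0; first by rewrite clamp_le0 // clamp_le0 //; nra.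
    have [h'|h'] := leP 1 t; first by rewrite clamp_ge1 // clamp_ge1 //; nra.
    have -> : clamp t = t by rewrite clamp_id // !ltW.
    by rewrite clamp_id; [lra|apply/andP; split; nra].
  exists h; split=> // w; have [[z <-]|[[x t] <-]] := surjW w.
  - by rewrite hZ ?itv01 ?itv11 // P1Z I1Z.
  - rewrite hX ?itv01 ?itv11 // P1X /v /= subr0 mul1r mul0r add0r mul1r.
    have /andP[t0 t1] := clamp01 t.
    have c01 : 0 <= 1 - clamp t <= 1 by apply/andP; split; lra.
    have [_ [e|e]] := rhoI x _ c01; have [e1 e2] := EP x _ c01.
      by rewrite e1 // I1X e subr0.
    have {}e2 := e2 (SigSub (mem_set e)) erefl.
    rewrite e2 I1Z; set s := (rho _).2.
    have s01 : 0 <= 1 - s <= 1.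
      by have [/andP[]] := rhoI x _ c01; rewrite -/s => *; apply/andP; split; lra.
    have <- : kX (i (SigSub (mem_set e)), 1 - s) = kZ (H (SigSub (mem_set e), 1 - s)).
      by rewrite kA /Hc /= (clamp_id s01).
    by [].
  - by rewrite hZ ?itv01 ?itv11.
  - rewrite hX ?itv01 ?itv11 // /v /= subrr !mul0r addr0 mul1r rho0 /=.
    by congr (kX (_, _)); lra.
exists (fun z => P0 (D (I0 z.1, z.2))); split=> [|q|q]; first by ctsify.
- by rewrite D0 thE.
- by rewrite D1.
Qed.

(** The left inverse [L] of [th] factors as [h h'], where [h'] is the cobase change of [g'] and [h]
    compares the attaching maps [g' g f] and [f], which are homotopic. Each factor has a left
    inverse, so [L] has one too, and two-of-six applies. *)
Lemma heq_cobase (Z Z' Q Q' : topologicalType) (f : A -> Z) (g : Z -> Z')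
    (jZ : Z -> Q) (jX : X -> Q) (jZ' : Z' -> Q') (jX' : X -> Q') (th : Q -> Q') :
  cts f -> heq R g ->
  pushout_sq f i jZ jX -> pushout_sq (fun a => g (f a)) i jZ' jX' ->
  cts th -> (forall z, th (jZ z) = jZ' (g z)) -> (forall x, th (jX x) = jX' x) ->
  heq R th.
Proof.
move=> cf [cg [g' [cg' [H [cH H0 H1]] [K [cK K0 K1]]]]] po po' cth thZ thX.
have [E [L [cE EP [cL LZ LX Lth]]]] :=
  cobase_left_inverse cf cg' cH H0 H1 po po' cth thZ thX.
have [_ rho0 rhoA _] := rhoP.
have ci : cts i by rewrite /i; ctsify.
pose f'' a := g' (g (f a)).
have [Q'' [jZ'' [jX'' po'']]] : exists (Q'' : topologicalType) (jZ'' : Z -> Q'')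
    (jX'' : X -> Q''), pushout_sq f'' i jZ'' jX''.
  by exists (pushout f'' i), (pushout_inl f'' i), (pushout_inr f'' i); exact: pushoutP.
have [cjZ'' cjX'' _ _ univ''] := po''; have [cjZ cjX _ _ univ] := po.
have [_ _ _ surj' univ'] := po'.
have EA (a : A) : E (i a, 1) = jZ (g' (g (f a))).
  have [_ e] := EP (i a) 1 (itv11 R).
  by rewrite (e a) rhoA ?itv11 //= ?subrr ?H0//; exact: (set_valP a).
have [||h [ch hZ hX]] := univ'' Q jZ (fun x => E (x, 1)) cjZ.
- by ctsify.
- by move=> a; rewrite EA.
have [N [cN Nh]] : exists N : Q -> Q'', cts N /\ htp R (fun q => N (h q)) id.
  pose H' (z : A * R) := H (f z.1, z.2).
  have e0 : (fun a => H' (a, 0)) = f'' by apply/funext => a; rewrite /H' H0.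
  have e1 : (fun a => H' (a, 1)) = f by apply/funext => a; rewrite /H' H1.
  apply: (@attach_homotopy_left_inverse Z Q'' Q H' jZ'' jX'' jZ jX E h) => //.
  - by rewrite /H'; ctsify.
  - by rewrite e0.
  - by rewrite e1.
have [||h' [ch' hZ' hX']] := univ' Q'' (fun z => jZ'' (g' z)) jX'' _ cjX''.
- by ctsify.
- by move=> a; have [_ _ <-] := po''.
have cgf : cts (fun a => g (f a)) by ctsify.
have [_ [L' [_ _ [cL' _ _ Lh']]]] :=
  cobase_left_inverse cgf cg cK K0 K1 po' po'' ch' hZ' hX'.
apply: (@heq_two_of_six R _ _ _ th L (fun q => L' (N q))) => //; first by ctsify.
have LE q : L q = h (h' q).
  by have [[z <-]|[x <-]] := surj' q; rewrite ?LZ ?hZ' ?hZ // LX hX' hX.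
apply: htp_trans Lh'.
have -> : L = (fun q => h (h' q)) by apply/funext.
apply: (@htp_compl _ _ _ _ _ _ L') => //.
exact: (htp_compr ch' Nh).
Qed.

Definition collar : topologicalType :=
  set_type (collar_set R A).

Lemma collar_bottom_subproof (a : A) :
  (collar_set R A) (i a, 0).
Proof. by left; rewrite itv01; split=> //; exact: (set_valP a). Qed.

Definition collar_bottom : A -> collar := corestr collar_bottom_subproof.

(** Turned upside down, [rho] retracts the whole cylinder onto the collar. The inverse puts [x] at
    height 0 and retracts; scaling heights towards 0 before retracting gives the homotopy on the
    collar. *)
Lemma heq_collar (Z Q Q' : topologicalType) (f : A -> Z)
    (jZ : Z -> Q) (jC : collar -> Q) (jZ' : Z -> Q') (jX' : X -> Q') (th : Q -> Q') :
  pushout_sq f collar_bottom jZ jC -> pushout_sq f i jZ' jX' ->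
  cts th -> (forall z, th (jZ z) = jZ' z) ->
  (forall c, th (jC c) = jX' (set_val c).1) ->
  heq R th.
Proof.
move=> po po' cth thZ thC.
have [cjZ cjC jf surj univ] := po; have [cjZ' cjX' jf' surj' univ'] := po'.
have [crho rho0 rhoA rhoI] := rhoP.
have s01 (t : R) : 0 <= t <= 1 -> 0 <= 1 - t <= 1.
  by move=> /andP[t0 t1]; apply/andP; split; lra.
have rP (z : X * R) : (collar_set R A)
    ((rho (z.1, 1 - clamp z.2)).1, 1 - (rho (z.1, 1 - clamp z.2)).2).
  have [h [e|a]] := rhoI z.1 _ (s01 _ (clamp01 z.2)).
    by right; rewrite /= e subr0.
  by left; split=> //=; exact: s01.
pose r : X * R -> collar := corestr rP.
have cr : cts r by apply: cts_corestr; ctsify.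
have rE x t : 0 <= t <= 1 -> set_val (r (x, t)) =
    ((rho (x, 1 - t)).1, 1 - (rho (x, 1 - t)).2).
  by move=> t01; rewrite -[in RHS](clamp_id t01).
have rC (c : collar) : r (set_val c) = c.
  apply: val_inj; rewrite -!set_valE [set_val c]surjective_pairing.
  have [[a t01]|t1] := set_valP c.
    rewrite rE // rhoA //; last exact: s01.
    by congr (_, _) => /=; lra.
  by rewrite t1 rE ?itv11 // subrr rho0 /= subr0.
have rA (a : A) t : 0 <= t <= 1 -> set_val (r (i a, t)) = (i a, t).
  move=> t01; rewrite rE // rhoA; [|exact: (set_valP a)|exact: s01].
  by congr (_, _) => /=; lra.
have rA0 (a : A) : r (i a, 0) = collar_bottom a.
  by apply: val_inj; rewrite -!set_valE rA ?itv01.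
have [||h [ch hZ hX]] := univ' Q jZ (fun x => jC (r (x, 0))) cjZ.
- by ctsify.
- by move=> a; rewrite rA0 jf.
split=> //; exists h; split=> //.
- have [|||H [cH HZ HC]] := @pushout_htp _ _ _ _ Q _ _ _ _ (fun z => jZ z.1)
    (fun z => jC (r ((set_val z.1).1, z.2 * (set_val z.1).2))) po.
  + by ctsify.
  + by ctsify.
  + by move=> a t t01; rewrite /= mulr0 (rA0 a) jf.
  exists H; split=> // q; have [[z <-]|[c <-]] := surj q.
  + by rewrite HZ ?itv01 // thZ hZ.
  + by rewrite HC ?itv01 //= mul0r thC hX.
  + by rewrite HZ ?itv11.
  + by rewrite HC ?itv11 //= mul1r -surjective_pairing rC.
- have [|||H [cH HZ HX]] := @pushout_htp _ _ _ _ Q' _ _ _ _ (fun z => jZ' z.1)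
    (fun z => jX' (rho (z.1, 1 - z.2)).1) po'.
  + by ctsify.
  + by ctsify.
  + move=> a t t01; rewrite /= rhoA; [exact: jf'|exact: (set_valP a)|exact: s01].
  exists H; split=> // q; have [[z <-]|[x <-]] := surj' q.
  + by rewrite HZ ?itv01 // hZ thZ.
  + by rewrite HX ?itv01 //= hX thC rE ?itv01 // subr0.
  + by rewrite HZ ?itv11.
  + by rewrite HX ?itv11 //= subrr rho0.
Qed.

End cobase_change.
End pushouts.

(** * Discs and CW pairs *)

Section row_vectors.
Context R (n : nat).

Local Notation Dn := (@disc R n).

Lemma cts_row Z (f : Z -> 'rV[R]_n) :
  (forall i, cts (fun z => f z ord0 i)) -> cts f.
Proof.
move=> cf z U [P nP PU].
have : \forall y \near z, forall i, P ord0 i (f y ord0 i).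
  by apply: filter_forall => i; apply: cf; rewrite /=; exact: nP.
by apply: filterS => y Py; apply: PU => i j; rewrite (ord1 i).
Qed.

Lemma cts_coord Z (f : Z -> 'rV[R]_n) i j :
  cts f -> cts (fun z => f z i j).
Proof.
move=> cf; apply: (@cts_comp _ _ _ (fun M : 'rV[R]_n => M i j) f _ cf).
exact: coord_continuous.
Qed.

Lemma cts_sum Z (I : finType) (f : I -> Z -> R) :
  (forall i, cts (f i)) -> cts (fun z => \sum_i f i z).
Proof.
move=> cf.
have h : continuous (fun x : R * R => x.1 + x.2).
  exact: (@cts_add R _ fst snd (cts_fst (@cts_id _)) (cts_snd (@cts_id _))).
have := @continuous_big _ I _ 0 xpredT h Z (index_enum I) f; apply=> i _; exact: cf.
Qed.

Lemma cts_sqnorm Z (f : Z -> 'rV[R]_n) :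
  cts f -> cts (fun z => sqnorm (f z)).
Proof.
move=> cf; apply: cts_sum => i.
have ci : cts (fun z => f z ord0 i) by exact: cts_coord.
by apply: (@cts_ext _ _ (fun z => f z ord0 i * f z ord0 i)); [|ctsify].
Qed.

Definition enorm (x : 'rV[R]_n) : R := Num.sqrt (sqnorm x).

Lemma cts_enorm Z (f : Z -> 'rV[R]_n) :
  cts f -> cts (fun z => enorm (f z)).
Proof.
move=> cf; have cs : cts (@Num.sqrt R) by exact: sqrt_continuous.
exact: (cts_comp cs (cts_sqnorm cf)).
Qed.

Lemma sqnorm_ge0 (x : 'rV[R]_n) : 0 <= sqnorm x.
Proof. by apply: sumr_ge0 => i _; exact: sqr_ge0. Qed.

Lemma enorm_ge0 (x : 'rV[R]_n) : 0 <= enorm x. Proof. exact: sqrtr_ge0. Qed.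

Lemma sqnormZ a (x : 'rV[R]_n) : sqnorm (a *: x) = a ^+ 2 * sqnorm x.
Proof. by rewrite /sqnorm mulr_sumr; apply: eq_bigr => i _; rewrite mxE exprMn. Qed.

Lemma enormZ a (x : 'rV[R]_n) : 0 <= a -> enorm (a *: x) = a * enorm x.
Proof.
by move=> a0; rewrite /enorm sqnormZ sqrtrM ?sqr_ge0 // sqrtr_sqr ger0_norm.
Qed.

Lemma sqr_enorm (x : 'rV[R]_n) : enorm x ^+ 2 = sqnorm x.
Proof. by rewrite sqr_sqrtr // sqnorm_ge0. Qed.

Lemma enorm_eq1 (x : 'rV[R]_n) : (enorm x = 1) <-> (sqnorm x = 1).
Proof.
split=> [e|e]; first by rewrite -sqr_enorm e expr1n.
by rewrite /enorm e sqrtr1.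
Qed.

Lemma enorm_le1 (x : 'rV[R]_n) : (enorm x <= 1) = (sqnorm x <= 1).
Proof. by rewrite -sqr_enorm expr_le1 ?enorm_ge0. Qed.

Lemma disc_compact : compact [set: Dn].
Proof.
apply/set_type_compact/bounded_closed_compact.
  exists 1; split; first exact: num_real.
  move=> M M1 x /= x1; apply: le_trans (ltW M1).
  rewrite [leLHS]/Num.Def.normr /= mx_normrE; apply/bigmax_leP; split=> // -[i j] _ /=.
  rewrite (ord1 i) -(@ler_sqr R) ?nnegrE // expr1n real_normK ?num_real //.
  apply: le_trans x1; rewrite /sqnorm (bigD1 j) //= lerDl.
  by apply: sumr_ge0 => k _; exact: sqr_ge0.
exact: (closed_lec (cts_sqnorm (@cts_id _))).
Qed.

Lemma disc_hausdorff : hausdorff_space (Dn).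
Proof. exact/set_type_hausdorff/norm_hausdorff. Qed.

Lemma closed_disc_boundary : closed (@disc_boundary R n).
Proof.
by apply: closed_eqc; apply: cts_sqnorm; ctsify.
Qed.

Lemma disc_interior_or_boundary (d : Dn) :
  disc_interior d \/ disc_boundary d.
Proof.
have : sqnorm (set_val d) <= 1 by exact: (set_valP d).
by rewrite le_eqVlt => /orP[/eqP|]; [right|left].
Qed.

(* The projection from the point at height 2 above the centre; [M] is the
   denominator making both cases (ray meets the bottom, or the side) uniform. *)
Lemma disc_radial_retraction :
  exists rho : Dn * R -> Dn * R, cyl_retraction (@disc_boundary R n) rho.
Proof.
pose M (z : Dn * R) := Num.max (2 - clamp z.2) (2 * enorm (set_val z.1)).
have M1 z : 1 <= M z.
  by have /andP[_ t1] := clamp01 z.2; rewrite /M le_max; apply/orP; left; lra.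
have M0 z : 0 < M z by apply: lt_le_trans (M1 z).
have cM : cts M.
  by rewrite /M; apply: cts_max; [ctsify|apply: cts_mul; [ctsify|apply: cts_enorm; ctsify]].
have cMV : cts (fun z => (M z)^-1).
  by apply: cts_inv => // z; rewrite gt_eqF.
have xP z : [set x : 'rV[R]_n | sqnorm x <= 1] ((2 / M z) *: set_val z.1).
  have Mi : 0 <= 2 / M z by apply: divr_ge0 => //; exact: ltW.
  rewrite /= -enorm_le1 enormZ // mulrAC ler_pdivrMr // mul1r.
  by rewrite /M le_max lexx orbT.
pose rx : Dn * R -> Dn := corestr xP.
pose rt (z : Dn * R) := 2 - 2 * (2 - clamp z.2) / M z.
have crx : cts rx.
  apply: cts_corestr; apply: cts_row => i.
  apply: (@cts_ext _ _ (fun z : Dn * R => (2 / M z) * (set_val z.1) ord0 i)).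
    by move=> z; rewrite mxE.
  by apply: cts_mul; [ctsify|apply: cts_coord; ctsify].
have crt : cts rt by rewrite /rt; ctsify.
(* On the bottom, and on the side where the norm is 1, the denominator is exactly 2 and the formula
   is the identity. *)
have ME z : M z = 2 -> 0 <= z.2 <= 1 -> (rx z, rt z) = z.
  move=> e t01; rewrite [RHS]surjective_pairing; congr (_, _).
    apply: val_inj; change ((2 / M z) *: set_val z.1 = set_val z.1).
    by rewrite e divff ?pnatr_eq0 // scale1r.
  by rewrite /rt e clamp_id // mulrAC divff ?pnatr_eq0 // mul1r; lra.
exists (fun z => (rx z, rt z)); split.
- by ctsify.
- move=> x; apply: ME; last exact: itv01.
  rewrite /M clamp0 subr0; apply/max_idPl => /=.
  have : enorm (set_val x) <= 1 by rewrite enorm_le1; exact: (set_valP x).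
  by lra.
- move=> x t xb t01; apply: ME => //; rewrite /M /=.
  have -> : enorm (set_val x) = 1 by exact/enorm_eq1.
  by rewrite mulr1; apply/max_idPr; have /andP[] := clamp01 t; lra.
- move=> x t t01 /=; split.
    rewrite /rt clamp_id //=; set m := M _; have m0 : 0 < m by exact: M0.
    have h : 2 - t <= m by rewrite /m /M /= clamp_id // le_max lexx.
    have h' : m <= 2 * (2 - t).
      rewrite /m /M /= clamp_id // ge_max; apply/andP; split; first by lra.
      have : enorm (set_val x) <= 1 by rewrite enorm_le1; exact: (set_valP x).
      by lra.
    rewrite subr_ge0 ler_pdivrMr // lerBlDr -lerBlDl ler_pdivlMr //.
    by apply/andP; split; lra.
  rewrite /rt clamp_id //=.
  have [h|h] := leP (2 * enorm (set_val x)) (2 - t).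
    left; have -> : M (x, t) = 2 - t by rewrite /M /= clamp_id //; exact/max_idPl.
    by rewrite mulfK ?subrr //; apply/eqP; lra.
  right; apply/enorm_eq1.
  have e : M (x, t) = 2 * enorm (set_val x).
    by rewrite /M /= clamp_id //; apply/max_idPr; exact: ltW.
  have Mi : 0 <= 2 / M (x, t) by apply: divr_ge0 => //; exact: ltW.
  rewrite /= enormZ // mulrAC -e divff // gt_eqF //; exact: M0.
Qed.

End row_vectors.

Section point_in_disc.
Context R (n : nat).

Local Notation Dn := (@disc R n).

(* Soft thresholding; the norm of ['rV[R]_n] is the maximum norm. *)
Definition soft (th : R) (y : 'rV[R]_n) : 'rV[R]_n :=
  \row_j (y ord0 j - Num.max (- th) (Num.min th (y ord0 j))).

Lemma cts_soft Z (th : Z -> R) (y : Z -> 'rV[R]_n) :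
  cts th -> cts y -> cts (fun z => soft (th z) (y z)).
Proof.
move=> cth cy; apply: cts_row => i.
have ci : cts (fun z => y z ord0 i) by exact: cts_coord.
apply: (@cts_ext _ _ (fun z => y z ord0 i - Num.max (- th z) (Num.min (th z) (y z ord0 i)))).
  by move=> z; rewrite mxE.
by ctsify.
Qed.

Lemma rV_norm_le (y : 'rV[R]_n) (c : R) :
  0 <= c -> (`|y| <= c) <-> (forall j, `|y ord0 j| <= c).
Proof.
move=> c0; rewrite /Num.Def.normr /= mx_normrE; split=> [/bigmax_leP[_ h] j|h].
  exact: (h (ord0, j)).
by apply/bigmax_leP; split=> // -[i j] _ /=; rewrite (ord1 i); exact: h.
Qed.

Lemma coord_le_norm (y : 'rV[R]_n) j : `|y ord0 j| <= `|y|.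
Proof.
have [h _] := @rV_norm_le y `|y| (normr_ge0 y).
exact: (h (lexx `|y|) j).
Qed.

Lemma soft0 (y : 'rV[R]_n) : soft 0 y = y.
Proof.
apply/rowP => j; rewrite mxE oppr0.
have [h|h] := leP 0 (y ord0 j); first by rewrite maxxx subr0.
by rewrite (max_idPl (ltW h)) subr0.
Qed.

Lemma soft_eq0 (th : R) (y : 'rV[R]_n) : `|y| <= th -> soft th y = 0.
Proof.
move=> h; apply/rowP => j; rewrite !mxE.
have := le_trans (coord_le_norm y j) h; rewrite ler_norml => /andP[h1 h2].
by rewrite (min_idPr h2) (max_idPr h1) subrr.
Qed.

Lemma soft_norm_le (th : R) (y : 'rV[R]_n) : 0 <= th -> `|soft th y| <= `|y|.
Proof.
move=> th0; apply/(rV_norm_le _ (normr_ge0 y)) => j; rewrite mxE; apply: le_trans (coord_le_norm y j).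
have [h|h] := leP 0 (y ord0 j).
  rewrite [leRHS]ger0_norm // ler_norml.
  have [h'|h'] := leP th (y ord0 j).
    rewrite (max_idPr _); last by lra.
    by apply/andP; split; lra.
  rewrite (max_idPr _); last by lra.
  by apply/andP; split; lra.
rewrite (min_idPr _); last by lra.
rewrite [leRHS]ltr0_norm // ler_norml.
have [h'|h'] := leP (- th) (y ord0 j); by apply/andP; split; lra.
Qed.

Lemma soft_norm_ge (th : R) (y : 'rV[R]_n) : 0 <= th -> `|y| - th <= `|soft th y|.
Proof.
move=> th0; rewrite lerBlDl.
have -> : y = (y - soft th y) + soft th y by rewrite subrK.
apply: le_trans (ler_normD _ _) _; rewrite subrK lerD2r.
apply/(rV_norm_le _ th0) => j; rewrite !mxE opprB addrC subrK ler_norml.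
rewrite le_max lexx /= ge_max; apply/andP; split; first by lra.
by rewrite ge_min lexx.
Qed.

(* Near [p] the cylinder is first pushed down onto its bottom, [{p} * I] and the
   region below the cone [2 e t = |x - p|]; then the radial retraction is
   applied away from [{p} * I]. *)
Lemma disc_point_retraction (p : Dn) : disc_interior p ->
  exists rho : Dn * R -> Dn * R,
    cyl_retraction (@disc_boundary R n `|` [set p]) rho.
Proof.
move=> pint.
have [rS [crS rS0 rSA rSI]] := disc_radial_retraction R n.
have [e e0 eP] : exists2 e : R, 0 < e &
    forall x : 'rV[R]_n, `|x - set_val p| < 2 * e -> sqnorm x < 1.
  have oU : open [set x : 'rV[R]_n | sqnorm x < 1].
    apply: (@open_preimage _ _ (@sqnorm R n) [set y | y < 1]).
      exact: (cts_sqnorm (@cts_id _)).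
    exact: open_lt.
  have /nbhs_ballP[d /= d0 dP] : nbhs (set_val p) [set x : 'rV[R]_n | sqnorm x < 1].
    by apply: open_nbhs_nbhs.
  exists (d / 2); first by rewrite divr_gt0.
  move=> x; rewrite mulrC divfK ?pnatr_eq0 // => xp; apply: dP.
  by rewrite -ball_normE /= distrC.
pose b (x : Dn) : R := `|set_val x - set_val p|.
(* A cut-off: beyond maximum-norm distance [2 e] from [p] it vanishes, and with it both the
   displacement [th] and the loss of height in [t1]. *)
pose ka x := Num.max 0 (2 * e - b x).
pose sc (z : Dn * R) := 2 * e * clamp z.2.
pose th z := Num.min (sc z) (ka z.1).
have cb : cts b.
  have cn : cts (fun x : 'rV[R]_n => `|x|) by exact: norm_continuous.
  have cd : cts (fun x : Dn => set_val x - set_val p).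
    apply: cts_row => i.
    apply: (@cts_ext _ _ (fun x : Dn => set_val x ord0 i - set_val p ord0 i)).
      by move=> x; rewrite !mxE.
    have := @cts_coord R n _ (fun x : Dn => set_val x) ord0 i.
    by move=> /(_ _)h; apply: cts_add; [apply: h; ctsify|ctsify].
  exact: (cts_comp cn cd).
have b0 x : 0 <= b x by exact: normr_ge0.
have cka : cts ka by rewrite /ka; ctsify.
have csc : cts sc by rewrite /sc; ctsify.
have cth : cts th by rewrite /th; ctsify.
have sc0 z : 0 <= sc z.
  by have /andP[h _] := clamp01 z.2; rewrite /sc; apply: mulr_ge0 => //; lra.
have sc1 z : sc z <= 2 * e.
  by have /andP[_ h] := clamp01 z.2; rewrite /sc; nra.
have th0 z : 0 <= th z by rewrite /th le_min sc0 /ka le_max lexx.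
pose x1v (z : Dn * R) := set_val p + soft (th z) (set_val z.1 - set_val p).
have x1P z : [set x : 'rV[R]_n | sqnorm x <= 1] (x1v z).
  have [h|h] := leP (2 * e) (b z.1).
    have -> : x1v z = set_val z.1.
      rewrite /x1v /th /ka (max_idPl _); last by lra.
      by rewrite (min_idPr (sc0 z)) soft0 addrC subrK.
    exact: (set_valP z.1).
  apply/ltW/eP; rewrite /x1v addrC addKr.
  by apply: le_lt_trans h; apply: soft_norm_le.
pose x1 : Dn * R -> Dn := corestr x1P.
(* The factor 2 brings the image below the cone: where [ka = 2 e - b], one has
   [sc - 2 ka <= 2 e - 2 ka = b - ka], and [x1] is still at distance at least [b - ka] from [p]. The
   minimum with [b] keeps the segment over [p] fixed. *)
pose t1 z := clamp z.2 - (2 * e)^-1 * Num.min (sc z) (2 * Num.min (b z.1) (ka z.1)).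
have cx1 : cts x1.
  apply: cts_corestr; apply: cts_row => i.
  have cs : cts (fun z : Dn * R => soft (th z) (set_val z.1 - set_val p)).
    apply: cts_soft => //; apply: cts_row => j.
    apply: (@cts_ext _ _ (fun z : Dn * R => set_val z.1 ord0 j - set_val p ord0 j)).
      by move=> x; rewrite !mxE.
    apply: cts_add; last by ctsify.
    by apply: cts_coord; ctsify.
  apply: (@cts_ext _ _ (fun z : Dn * R => set_val p ord0 i +
      soft (th z) (set_val z.1 - set_val p) ord0 i)).
    by move=> x; rewrite /x1v !mxE.
  by apply: cts_add; [ctsify|apply: cts_coord].
have ct1 : cts t1 by rewrite /t1; ctsify.
have ee : 2 * e != 0 by apply/eqP; lra.
have x1K z : b z.1 <= th z -> x1 z = p.
  move=> h; apply: val_inj; change (x1v z = set_val p).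
  by rewrite /x1v soft_eq0 // addr0.
have bx1 z : b z.1 - th z <= b (x1 z).
  have -> : b (x1 z) = `|soft (th z) (set_val z.1 - set_val p)|.
    by change (b (x1 z)) with (`|x1v z - set_val p|); rewrite /x1v addrC addKr.
  exact: soft_norm_ge.
have bp : b p = 0 by rewrite /b subrr normr0.
have t1E z : 2 * e * t1 z = sc z - Num.min (sc z) (2 * Num.min (b z.1) (ka z.1)).
  by rewrite /t1 mulrBr mulrA mulfV // mul1r.
have dich z : x1 z = p \/ 2 * e * t1 z <= b (x1 z).
  have [h|h] := leP (b z.1) (th z); first by left; exact: x1K.
  right; apply: le_trans (bx1 z); rewrite t1E.
  move: h; rewrite /th; have [h1|h1] := leP (sc z) (ka z.1) => h.
    have mm : sc z <= Num.min (b z.1) (ka z.1) by rewrite le_min (ltW h) h1.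
    rewrite (min_idPl (_ : sc z <= 2 * _)); first by rewrite subrr subr_ge0 ltW.
    by move: mm (sc0 z); move: (sc z) (Num.min _ _) => u v *; lra.
  rewrite (min_idPr (ltW h)); have h2 : 2 * e - b z.1 <= ka z.1 by rewrite /ka le_max lexx orbT.
  have h3 : 0 <= ka z.1 by rewrite /ka le_max lexx.
  have := sc1 z; rewrite minEle; case: ifP => _; lra.
have t10 z : 0 <= z.2 <= 1 -> 0 <= t1 z <= 1.
  move=> t01; have e20 : 0 < 2 * e by lra.
  have m0 : 0 <= Num.min (sc z) (2 * Num.min (b z.1) (ka z.1)).
    by rewrite le_min sc0 /= mulr_ge0 // le_min b0 /ka le_max lexx.
  have m1 : Num.min (sc z) (2 * Num.min (b z.1) (ka z.1)) <= sc z by rewrite ge_min lexx.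
  have /andP[h1 h2] : 0 <= 2 * e * t1 z <= 2 * e.
    by rewrite t1E subr_ge0 m1 /=; have := sc1 z; lra.
  by rewrite -(pmulr_rge0 _ e20) h1 /= -(ler_pM2l e20) mulr1.
have x1t1_fix z : 0 <= z.2 <= 1 -> th z = 0 -> Num.min (b z.1) (ka z.1) = 0 ->
    x1 z = z.1 /\ t1 z = z.2.
  move=> t01 thz mz; split.
    apply: val_inj; change (x1v z = set_val z.1).
    by rewrite /x1v thz soft0 addrC subrK.
  by rewrite /t1 mz mulr0 (min_idPr (sc0 z)) mulr0 subr0 clamp_id.
(* The two cases agree where both apply: over [p] and below the cone means height 0, which [rS]
   fixes. *)
pose k (z : Dn * R) := if x1 z == p then (x1 z, t1 z) else rS (x1 z, t1 z).
have kS z : 2 * e * t1 z <= b (x1 z) -> 0 <= z.2 <= 1 -> k z = rS (x1 z, t1 z).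
  move=> h t01; rewrite /k; case: eqP => // x1p; have := t10 z t01.
  rewrite x1p bp in h; have -> : t1 z = 0.
    by apply/eqP; have /andP[u0 u1] := t10 z t01; rewrite eq_le u0 andbT; nra.
  by rewrite x1p rS0.
pose kc (z : Dn * R) := k (z.1, clamp z.2).
have ckc : cts kc.
  pose zc (z : Dn * R) := (z.1, clamp z.2).
  have czc : cts zc by rewrite /zc; ctsify.
  pose C0 := [set z | x1 (zc z) = p].
  pose C1 := [set z | 2 * e * t1 (zc z) - b (x1 (zc z)) <= 0].
  apply: (@cts_cover2 _ _ C0 C1).
  - apply: (@closed_preimage _ _ (fun z => x1 (zc z)) [set p]); first by ctsify.
    exact/accessible_closed_set1/hausdorff_accessible/disc_hausdorff.
  - by apply: closed_lec; ctsify.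
  - by move=> z; have [h|h] := dich (zc z); [left|right; rewrite /C1 /= subr_le0].
  - apply: (@cts_ext _ _ (fun z : C0 => (x1 (zc (set_val z)), t1 (zc (set_val z))))); last by ctsify.
    move=> z; have zp : x1 (zc (set_val z)) = p by exact: (set_valP z).
    by rewrite /kc /k -/(zc _) zp eqxx.
  - apply: (@cts_ext _ _ (fun z : C1 => rS (x1 (zc (set_val z)), t1 (zc (set_val z))))); last by ctsify.
    move=> z; have zp : 2 * e * t1 (zc (set_val z)) - b (x1 (zc (set_val z))) <= 0 by exact: (set_valP z).
    by rewrite /kc -/(zc _) kS ?clamp01 // -subr_le0.
exists kc; split=> //.
- move=> x; rewrite /kc /= clamp0.
  have th00 : th (x, 0) = 0.
    rewrite /th /sc /= clamp0 mulr0; apply/min_idPl.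
    by rewrite /ka le_max lexx.
  have e1 : x1 (x, 0) = x.
    by apply: val_inj; change (x1v (x, 0) = set_val x); rewrite /x1v th00 soft0 addrC subrK.
  have e2 : t1 (x, 0) = 0.
    rewrite /t1 /sc /= clamp0 mulr0 (min_idPl _) ?mulr0 ?subr0 //.
    by rewrite mulr_ge0 // le_min b0 /ka le_max lexx.
  by rewrite /k e1 e2; case: eqP => // _; rewrite rS0.
- move=> x t xA t01; rewrite /kc /= (clamp_id t01).
  have thz : th (x, t) = 0 /\ Num.min (b x) (ka x) = 0 \/ x = p.
    case: xA => [xb|->]; [left|by right].
    have h : 2 * e <= b x.
      by rewrite leNgt; apply/negP => /eP; rewrite (_ : sqnorm _ = 1) ?ltxx.
    have k0 : ka x = 0 by apply/max_idPl; lra.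
    by rewrite /th /= k0; split; apply/min_idPr; [exact: sc0|exact: b0].
  have [[h1 h2]|->] := thz.
    have [e1 e2] := x1t1_fix (x, t) t01 h1 h2.
    rewrite /k e1 e2 /=; case: eqP => // xp; rewrite rSA //.
    by case: xA => // xe; case: xp.
  have e1 : x1 (p, t) = p by apply: x1K; rewrite bp.
  rewrite /k e1 eqxx; congr (_, _); rewrite /t1 /= bp (clamp_id t01).
  rewrite (min_idPl (_ : 0 <= ka p)); last by rewrite /ka le_max lexx.
  by rewrite mulr0 (min_idPr _) ?sc0 // mulr0 subr0.
- move=> x t t01; rewrite /kc /= (clamp_id t01) /k; case: eqP => [xp|xp] /=.
    by split; [exact: t10|right; right].
  have [h1 [h2|h2]] := rSI (x1 (x, t)) _ (t10 (x, t) t01); first by split=> //; left.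
  by split=> //; right; left.
Qed.

End point_in_disc.

(** The points of [A] satisfy [rho (x, 1) = (x, 1)], a closed condition in a Hausdorff space;
    conversely a point satisfying it is not sent to the bottom, hence lies in [A]. *)
Lemma closed_cyl_retraction R X (A : set X)
    (rho : X * R -> X * R) :
  hausdorff_space X -> cyl_retraction A rho -> closed A.
Proof.
move=> hX [crho rho0 rhoA rhoI] x clx.
have cr1 : cts (fun y => rho (y, 1)) by ctsify.
have ci : cts (fun y : X => (y, 1 : R)) by ctsify.
have e : rho (x, 1) = (x, 1).
  apply: (prod_hausdorff hX (@Rhausdorff R)) => U V /cr1 nU /ci nV.
  have nUV : nbhs x ((fun y => rho (y, 1)) @^-1` U `&` (fun y => (y, 1)) @^-1` V).
    exact: (@filterI _ (nbhs x) _ _ _ nU nV).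
  have [y [Ay [Uy Vy]]] := clx _ nUV.
  by exists (y, 1); split=> //; rewrite -(rhoA y 1 Ay (itv11 R)).
have [_ [h|]] := rhoI x 1 (itv11 R); last by rewrite e.
by move: h; rewrite e /= => /eqP; rewrite oner_eq0.
Qed.

(** * Cylinder retractions for CW pairs *)

Section cw.
Context R X (K : cw_structure R X).

Let idx := cw_index K.
Let dim (e : idx) := cw_dim e.
Let D (e : idx) : topologicalType := set_type (@disc R (dim e)).
Let chi (e : idx) : D e -> X := @cw_char R X K e.

Definition cw_union (S : set idx) : set X := \bigcup_(e in S) cw_cell e.

Lemma cw_coord (x : X) : exists ed : {e : idx & D e},
  disc_interior (projT2 ed) /\ chi (projT2 ed) = x.
Proof.
have : (\bigcup_e @cw_cell R X K e) x by rewrite cw_cover.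
by move=> [e _ [d di <-]]; exists (existT _ e d).
Qed.

Definition cw_point (x : X) : {e : idx & D e} := projT1 (cid (cw_coord x)).

Lemma cw_pointP x : disc_interior (projT2 (cw_point x)) /\ chi (projT2 (cw_point x)) = x.
Proof. exact: (projT2 (cid (cw_coord x))). Qed.

Lemma cw_point_unique e (d : D e) : disc_interior d -> cw_point (chi d) = existT _ e d.
Proof.
move=> di; have [] := cw_pointP (chi d).
case: (cw_point (chi d)) => e' d' /= di' E.
have ee : e' = e.
  apply: (@cw_disjoint R X K e' e) => //; exists (chi d); split; last by exists d.
  by exists d'.
move: d' di' E; rewrite ee => d' di' E; congr existT.
by apply: (@cw_inj R X K e); rewrite ?inE.
Qed.

Lemma cw_boundary_dim e (d : D e) : disc_boundary d ->
  (dim (projT1 (cw_point (chi d))) < dim e)%N.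
Proof.
move=> db; have [S [_ Sdim Sb]] := cw_closure_finite e.
have [e' Se' [d' di' E]] : (\bigcup_(e' in S) cw_cell e') (chi d) by apply: Sb; exists d.
by rewrite -[chi d]E (cw_point_unique (e := e') di') /=; exact: Sdim.
Qed.

Lemma interior_not_boundary e (d : D e) : disc_interior d -> ~ disc_boundary d.
Proof. by rewrite /disc_interior /disc_boundary /= => h h'; rewrite h' ltxx in h. Qed.

Lemma cts_cw V (f : X -> V) :
  (forall e, cts (fun d => f (@chi e d))) -> cts f.
Proof.
move=> cf; apply: cts_closed => B cB; apply: cw_weak => e.
exact: (closed_preimage (cf e) cB).
Qed.

Lemma cts_chi e : cts (@chi e). Proof. exact: cw_char_continuous. Qed.

Section extension.
Context (B : set X) (C : forall e, set (D e)) (rhoe : forall e, D e * R -> D e * R).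
Arguments C : clear implicits.
Arguments rhoe : clear implicits.
Context (clC : forall e, closed (C e)) (CB : forall e d, C e d -> B (chi d)).
Context (BC : forall e d, disc_interior d -> B (@chi e d) -> C e d).
Context (rhoeP : forall e, cyl_retraction (@disc_boundary R (dim e) `|` C e) (rhoe e)).

(** Retract in the open cell of [x]; if the result lies over the boundary of the disc, continue in
    the cell containing its image. That cell has smaller dimension, so the dimension is enough
    fuel. *)
Fixpoint cw_go (n : nat) (x : X) (t : R) : X * R :=
  let z := rhoe (projT1 (cw_point x)) (projT2 (cw_point x), clamp t) in
  if n is m.+1 then
    if pselect (disc_boundary z.1) then cw_go m (chi z.1) z.2 else (chi z.1, z.2)
  else (chi z.1, z.2).

Lemma cw_go_stable n m x t : (dim (projT1 (cw_point x)) <= n)%N ->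
  (dim (projT1 (cw_point x)) <= m)%N -> cw_go n x t = cw_go m x t.
Proof.
elim: n m x t => [|n IH] [|m] x t //=.
- rewrite leqn0 => /eqP e0 _; case: pselect => // b.
  by have := leq_trans (cw_boundary_dim b) (eq_leq e0).
- move=> _; rewrite leqn0 => /eqP e0; case: pselect => // b.
  by have := leq_trans (cw_boundary_dim b) (eq_leq e0).
- move=> hn hm; case: pselect => // b; apply: IH.
    by rewrite -ltnS; apply: leq_trans hn; exact: cw_boundary_dim.
  by rewrite -ltnS; apply: leq_trans hm; exact: cw_boundary_dim.
Qed.

Definition cw_rho (x : X) (t : R) : X * R := cw_go (dim (projT1 (cw_point x))) x t.

Definition cw_theta e (z : D e * R) : X * R :=
  if pselect (disc_boundary z.1) then cw_rho (chi z.1) z.2 else (chi z.1, z.2).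

(** The recursion holds on closed discs as well: over the boundary [rhoe] is the identity and
    [cw_theta] falls back on [cw_rho]. This is the form in which continuity on a cell can be
    studied. *)
Lemma cw_rhoE e (d : D e) t : 0 <= t <= 1 -> cw_rho (chi d) t = cw_theta (rhoe e (d, t)).
Proof.
move=> t01; have [di|db] := disc_interior_or_boundary d; last first.
  have [_ _ rA _] := rhoeP e.
  by rewrite rA //; [rewrite /cw_theta /=; case: pselect|left].
suff go n : (dim e <= n)%N -> cw_go n (chi d) t = cw_theta (rhoe e (d, t)).
  by apply: go; rewrite (cw_point_unique di).
case: n => [|n] hn; rewrite /= (cw_point_unique di) /= (clamp_id t01) /cw_theta.
  by case: pselect => // b; have := leq_trans (cw_boundary_dim b) hn.
case: pselect => // b; apply: cw_go_stable => //.
by rewrite -ltnS; apply: leq_trans hn; exact: cw_boundary_dim.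
Qed.

Lemma cw_dim_ind (P : X -> Prop) :
  (forall e (d : D e), disc_interior d ->
     (forall d' : D e, disc_boundary d' -> P (chi d')) -> P (chi d)) ->
  forall x, P x.
Proof.
move=> IH x.
have [n] := ubnP (dim (projT1 (cw_point x))).
elim: n x => // n IHn x; rewrite ltnS => hx.
have [di <-] := cw_pointP x; apply: IH => // d' db; apply: IHn.
exact: leq_trans (cw_boundary_dim db) hx.
Qed.

Lemma cw_rho0 x : cw_rho x 0 = (x, 0).
Proof.
have [di <-] := cw_pointP x; rewrite cw_rhoE ?itv01 //.
have [_ -> _ _] := rhoeP (projT1 (cw_point x)).
by rewrite /cw_theta /=; case: pselect => // b; case: (interior_not_boundary di b).
Qed.

Lemma cw_rhoB x t : B x -> 0 <= t <= 1 -> cw_rho x t = (x, t).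
Proof.
move=> Bx t01; have [di e] := cw_pointP x; rewrite -e in Bx *.
rewrite cw_rhoE //; have [_ _ rA _] := rhoeP (projT1 (cw_point x)).
rewrite rA //; last by right; exact: BC.
by rewrite /cw_theta /=; case: pselect => // b; case: (interior_not_boundary di b).
Qed.

Lemma cw_rhoI x : forall t, 0 <= t <= 1 -> 0 <= (cw_rho x t).2 <= 1 /\
  ((cw_rho x t).2 = 0 \/ B (cw_rho x t).1).
Proof.
elim/cw_dim_ind: x => e d di IH t t01; rewrite cw_rhoE //.
have [_ _ _ rI] := rhoeP e; have [h1 h2] := rI d t t01.
rewrite /cw_theta; case: pselect => [b|nb] /=; first exact: IH.
by split=> //; case: h2 => [|[|/CB]]; [left| |right].
Qed.

(** The retraction never leaves a closed union of cells. For the point pair this keeps a path that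
    starts in [A2] starting there. *)
Lemma cw_rho_union (S : set idx) :
  (forall e, S e -> forall d : D e, cw_union S (chi d)) ->
  forall x t, 0 <= t <= 1 -> cw_union S x -> cw_union S (cw_rho x t).1.
Proof.
move=> SP; elim/cw_dim_ind => e d di IH t t01 Sx; rewrite cw_rhoE //.
have Se : S e.
  have [e' Se' [d' di' E]] := Sx.
  have := cw_point_unique di; rewrite -E (cw_point_unique (e := e') di') => /(congr1 (@projT1 _ _)) /= <-.
  exact: Se'.
rewrite /cw_theta; case: pselect => [b|nb] /=; last exact: SP.
apply: IH => //; last exact: SP.
by have [_ _ _ rI] := rhoeP e; have [] := rI d t t01.
Qed.

(** The attaching map need not lift continuously to the lower discs, so continuity is tested on
    closed sets. The preimage of [V] comes from a finite union of images of compact sets, closed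
    because [X] is Hausdorff; compactness is why the factor is [I01] and not the line. *)
Lemma cts_cw_rho_boundary e :
  (forall e', (dim e' < dim e)%N ->
     cts (fun z : D e' * R => cw_rho (chi z.1) (clamp z.2))) ->
  cts (fun z : set_type (@disc_boundary R (dim e)) * R =>
         cw_rho (@chi e (set_val z.1)) (clamp z.2)).
Proof.
move=> IH.
have [S [finS Sdim Sb]] := cw_closure_finite e.
pose bd : topologicalType := set_type (@disc_boundary R (dim e)).
pose k (z : bd * I01 R) := (@chi e (set_val z.1), z.2).
have cchi := @cts_chi e.
have ck : cts k by rewrite /k; ctsify.
have cI : cts (fun z : bd * I01 R => cw_rho (@chi e (set_val z.1)) (set_val z.2)).
  apply: cts_closed => V clV.
  pose T (e' : {classic idx}) : set (X * I01 R) :=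
    (fun z : D e' * I01 R => (@chi e' z.1, z.2)) @`
    [set z | V (cw_rho (@chi e' z.1) (set_val z.2))].
  have -> : (fun z : bd * I01 R => cw_rho (@chi e (set_val z.1)) (set_val z.2)) @^-1` V =
      k @^-1` (\bigcup_(e' in (S : set {classic idx})) T e').
    apply/seteqP; split=> [z Vz|z [e' _ [[d' s] /= Vd [e1 e2]]]].
      have [e' Se' [d' di' E]] : (\bigcup_(e' in S) cw_cell e') (@chi e (set_val z.1)).
        by apply: Sb; exists (set_val z.1) => //; exact: (set_valP z.1).
      exists e' => //; exists (d', z.2); last by congr (_, _); exact: E.
      by move: Vz; rewrite /= -[chi (set_val z.1)]E.
    by rewrite /preimage /= -e1 -e2.
  apply: closed_preimage => //; apply: closed_bigcup => // e' Se'.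
  apply: compact_closed.
    apply: prod_hausdorff; [exact: (cw_hausdorff K)|exact: hausdorff_I01].
  have cchi' := @cts_chi e'.
  apply: continuous_compact.
    apply: continuous_subspaceT.
    have h : cts (fun z : D e' * I01 R => (@chi e' z.1, z.2)) by ctsify.
    exact: h.
  apply: (@subclosed_compact _ _ [set: D e' * I01 R]) => //.
    have h := IH e' (Sdim e' Se').
    pose q (z : D e' * I01 R) := (z.1, set_val z.2).
    have cq : cts q by rewrite /q; ctsify.
    have -> : [set z : D e' * I01 R | V (cw_rho (@chi e' z.1) (set_val z.2))] =
        (fun z => cw_rho (chi (q z).1) (clamp (q z).2)) @^-1` V.
      by apply/seteqP; split=> z; rewrite /preimage /q /= clamp_id // I01P.
    exact: (closed_preimage (cts_comp h cq) clV).
  by rewrite -setXTT; apply: compact_setX; [exact: disc_compact|exact: compact_I01].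
pose q (z : bd * R) := (z.1, to01 z.2).
have cq : cts q by rewrite /q; ctsify.
apply: cts_ext (cts_comp cI cq) => z.
by rewrite /q /= val_to01.
Qed.

(** The three closed sets record where [rhoe] lands: on the bottom, where [cw_rho] is the identity;
    over the boundary, settled by smaller dimensions; or over [C e], where [cw_rho] is the identity
    again. *)
Lemma cts_cw_rho_cell e : cts (fun z : D e * R => cw_rho (chi z.1) (clamp z.2)).
Proof.
have [n] := ubnP (dim e); elim: n e => // n IHn e; rewrite ltnS => hn.
have cbd : cts (fun z : set_type (@disc_boundary R (dim e)) * R =>
         cw_rho (@chi e (set_val z.1)) (clamp z.2)).
  by apply: cts_cw_rho_boundary => e' he; apply: IHn; exact: leq_trans he hn.
have [cr r0 rA rI] := rhoeP e.
have cchi := @cts_chi e.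
pose w (z : D e * R) := rhoe e (z.1, clamp z.2).
have cw : cts w by rewrite /w; ctsify.
apply: (@cts_ext _ _ (fun z => cw_theta (w z))).
  by move=> z; rewrite cw_rhoE ?clamp01.
pose E (j : 'I_3) : set (D e * R) :=
  if (j : nat) == 0%N then [set z | (w z).2 = 0] else
  if (j : nat) == 1%N then [set z | disc_boundary (w z).1] else [set z | C e (w z).1].
apply: (@cts_cover _ _ 'I_3 setT E).
- exact: finite_finset.
- move=> [[|[|[|//]]] hj] _; rewrite /E /=.
  + by apply: closed_eqc; ctsify.
  + apply: (@closed_preimage _ _ (fun z => (w z).1) (@disc_boundary R (dim e))); first by ctsify.
    exact: closed_disc_boundary.
  + by apply: (@closed_preimage _ _ (fun z => (w z).1) (C e)) => //; ctsify.
- move=> z; have [_ [h|[h|h]]] := rI z.1 (clamp z.2) (clamp01 _).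
  + by exists (inord 0) => //; rewrite /E inordK.
  + by exists (inord 1) => //; rewrite /E inordK.
  + by exists (inord 2) => //; rewrite /E inordK.
- move=> [[|[|[|//]]] hj] _.
  + apply: (@cts_ext _ _ (fun z : E (Ordinal hj) => (chi (w (set_val z)).1, 0 : R))); last by ctsify.
    move=> z; have zE : (w (set_val z)).2 = 0 by exact: (set_valP z).
    by rewrite /cw_theta zE; case: pselect => // b; rewrite cw_rho0.
  + have bP (z : E (Ordinal hj)) : disc_boundary (w (set_val z)).1 by exact: (set_valP z).
    pose q (z : E (Ordinal hj)) := (corestr bP z, (w (set_val z)).2).
    have cq : cts q by rewrite /q; apply: cts_pair; [apply: cts_corestr|]; ctsify.
    apply: cts_ext (cts_comp cbd cq) => z.
    rewrite /cw_theta; case: pselect => [b|]; last by case: (bP z).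
    rewrite /q /= clamp_id //.
    by have [] := rI (set_val z).1 (clamp (set_val z).2) (clamp01 _).
  + apply: (@cts_ext _ _ (fun z : E (Ordinal hj) => (chi (w (set_val z)).1, (w (set_val z)).2))); last by ctsify.
    move=> z; have zE : C e (w (set_val z)).1 by exact: (set_valP z).
    rewrite /cw_theta; case: pselect => // b; rewrite cw_rhoB //; first exact: CB.
    by have [] := rI (set_val z).1 (clamp (set_val z).2) (clamp01 _).
Qed.

Lemma cw_cyl_retraction : exists rho : X * R -> X * R, cyl_retraction B rho /\
  forall S : set idx, (forall e, S e -> forall d : D e, cw_union S (chi d)) ->
    forall x t, 0 <= t <= 1 -> cw_union S x -> cw_union S (rho (x, t)).1.
Proof.
exists (fun z => cw_rho z.1 (clamp z.2)); split; last first.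
  by move=> S SP x t t01 Sx; rewrite /= clamp_id //; exact: cw_rho_union.
split=> [|x|x t Bx t01|x t t01] /=.
- pose H (z : X * R) := cw_rho z.1 (clamp z.2).
  apply: (@cts_ext _ _ (fun z => H (z.1, clamp z.2))).
    by move=> z; rewrite /H /= clampK.
  (* The weak topology makes the characteristic maps jointly quotient; that this survives the
     product with the line is the content of [cts_quotient_prod]. *)
  apply: (@cts_quotient_prod R idx D X _ chi H).
  + by move=> W f; exact: cts_cw.
  + by move=> x; have [_ e] := cw_pointP x; exists (projT1 (cw_point x)), (projT2 (cw_point x)).
  + by move=> e; exact: cts_cw_rho_cell.
- by rewrite clamp0 cw_rho0.
- by rewrite clamp_id // cw_rhoB.
- by rewrite clamp_id //; exact: cw_rhoI.
Qed.

End extension.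

(** A boundary point is the limit of [s d] as [s] tends to 1 from below. Subcomplexes are defined
    through closures of cells, whereas the retraction needs images of closed discs. *)
Lemma cell_closure e (d : D e) : closure (cw_cell e) (chi d).
Proof.
have [di|db] := disc_interior_or_boundary d.
  by apply: subset_closure; exists d.
move=> U nU.
have sP (s : R) : [set x : 'rV[R]_(dim e) | sqnorm x <= 1] (clamp s *: set_val d).
  rewrite /= sqnormZ (_ : sqnorm (set_val d) = 1) // mulr1.
  by have /andP[s0 s1] := clamp01 s; rewrite expr_le1.
pose q (s : R) : D e := corestr sP s.
have cq : cts q.
  apply: cts_corestr; apply: cts_row => i.
  apply: (@cts_ext _ _ (fun s : R => clamp s * set_val d ord0 i)); last by ctsify.
  by move=> s; rewrite mxE.
have q1 : q 1 = d.
  apply: val_inj; change (clamp 1 *: set_val d = set_val d).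
  by rewrite clamp1 scale1r.
have : nbhs (1 : R) ((fun s => chi (q s)) @^-1` U).
  have cc : cts (fun s => chi (q s)) by apply: (cts_comp (@cts_chi e) cq).
  by apply: cc; rewrite q1.
move=> /nbhs_ballP[eps /= eps0 epsP].
pose s := Num.max 0 (1 - eps / 2).
have s0 : 0 <= s by rewrite /s le_max lexx.
have s1 : s < 1 by rewrite /s gt_max; apply/andP; split; lra.
exists (chi (q s)); split; last first.
  apply: epsP; rewrite -ball_normE /= ger0_norm; last by lra.
  have : 1 - eps / 2 <= s by rewrite /s le_max lexx orbT.
  by lra.
exists (q s) => //; rewrite /disc_interior /=.
change (sqnorm (clamp s *: set_val d) < 1).
rewrite sqnormZ (_ : sqnorm (set_val d) = 1) // mulr1 clamp_id; last by rewrite s0 ltW.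
by rewrite expr_lt1.
Qed.

Lemma subcomplex_retraction (A : set X) : subcomplex K A ->
  exists rho : X * R -> X * R, cyl_retraction A rho.
Proof.
move=> [S [AE SP]].
(* All of the disc for cells of the subcomplex, where the identity retracts, and nothing for the
   others, where the radial retraction is used. *)
pose C e : set (D e) := [set d | S e].
have rP e : exists r : D e * R -> D e * R,
    cyl_retraction (@disc_boundary R (dim e) `|` C e) r.
  have [Se|nS] := pselect (S e).
    exists id; split=> [|//|//|x t t01 /=]; first exact: cts_id.
    by split=> //; right; right.
  have [r hr] := disc_radial_retraction R (dim e); exists r.
  suff -> : disc_boundary (n:=dim e) `|` C e = @disc_boundary R (dim e) by [].
  by apply/seteqP; split=> [d [|]|d] //; left.
have [||||r [hr _]] := @cw_cyl_retraction A C (fun e => projT1 (cid (rP e))).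
- move=> e; have [Se|nS] := pselect (S e).
    by rewrite (_ : C e = setT); [exact: closedT|apply/seteqP; split].
  by rewrite (_ : C e = set0); [exact: closed0|apply/seteqP; split].
- by move=> e d Se; apply: (SP e Se); exact: cell_closure.
- move=> e d di; rewrite AE => -[e' Se' [d' di' E]]; change (S e).
  have := cw_point_unique di; rewrite -E (cw_point_unique (e := e') di') => /(congr1 (@projT1 _ _)) /= <-.
  exact: Se'.
- by move=> e; exact: (projT2 (cid (rP e))).
- by exists r.
Qed.

Lemma point_retraction (a : X) (A : set X) : subcomplex K A ->
  exists rho : X * R -> X * R, cyl_retraction [set a] rho /\
    forall x t, 0 <= t <= 1 -> A x -> A (rho (x, t)).1.
Proof.
move=> [S [AE SP]].
have [di0 Ea] := cw_pointP a.
set e0 := projT1 (cw_point a) in di0 Ea.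
(* Empty except for the cell whose interior contains [a], where it is the single coordinate of
   [a]. *)
pose C e : set (D e) := [set d | disc_interior d /\ chi d = a].
have uniq e (d : D e) : disc_interior d -> chi d = a -> existT D e d = cw_point a.
  by move=> di <-; rewrite cw_point_unique.
have rP e : exists r : D e * R -> D e * R,
    cyl_retraction (@disc_boundary R (dim e) `|` C e) r.
  have [[d [di da]]|nC] := pselect (exists d, C e d).
    have [r hr] := disc_point_retraction di; exists r.
    suff -> : C e = [set d] by [].
    apply/seteqP; split=> [d' [di' da']|d' -> //].
    by apply: (@cw_inj R X K e); rewrite ?inE // -/(chi _) da'.
  have [r hr] := disc_radial_retraction R (dim e); exists r.
  suff -> : disc_boundary (n:=dim e) `|` C e = @disc_boundary R (dim e) by [].
  by apply/seteqP; split=> [d [//|h]|d] //; [case: nC; exists d|left].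
have [||||r [hr rS]] := @cw_cyl_retraction [set a] C (fun e => projT1 (cid (rP e))).
- move=> e; have [[d [di da]]|nC] := pselect (exists d, C e d).
    suff -> : C e = [set d].
      exact/accessible_closed_set1/hausdorff_accessible/disc_hausdorff.
    apply/seteqP; split=> [d' [di' da']|d' -> //].
    by apply: (@cw_inj R X K e); rewrite ?inE // -/(chi _) da'.
  suff -> : C e = set0 by exact: closed0.
  by apply/seteqP; split=> // d h; case: nC; exists d.
- by move=> e d [].
- by [].
- by move=> e; exact: (projT2 (cid (rP e))).
exists r; split=> //; rewrite AE; apply: rS => e Se d.
by rewrite /cw_union -AE; apply: (SP e Se); exact: cell_closure.
Qed.

End cw.

(** * Telescopes *)

Lemma collarP R X (A : set X) (c : collar R A) :
  (A (set_val c).1 /\ 0 <= (set_val c).2 <= 1) \/ (set_val c).2 = 1.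
Proof. exact: (set_valP c). Qed.

Section telescopes.
Context R X.

(* [X * {0, ..., k}] together with the tubes [B i * [i, i + 1]] joining
   consecutive copies. *)
Definition tel_set (B : nat -> set X) (k : nat) : set (X * R) :=
  [set z | exists i : nat, ((i <= k)%N /\ z.2 = i%:R) \/
     [/\ (i < k)%N, B i z.1 & i%:R <= z.2 <= i.+1%:R]].

Definition tel (B : nat -> set X) (k : nat) : topologicalType := set_type (tel_set B k).

Lemma tel_copy_subproof B k i x : (i <= k)%N -> tel_set B k (x, i%:R).
Proof. by move=> ik; exists i; left. Qed.

Definition tel_first B k (x : X) : tel B k :=
  SigSub (mem_set (@tel_copy_subproof B k 0 x (leq0n k))).

Definition tel_last B k (x : X) : tel B k :=
  SigSub (mem_set (@tel_copy_subproof B k k x (leqnn k))).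

Lemma tel_set_le B k z : tel_set B k z -> z.2 <= k%:R.
Proof.
move=> [i [[ik ->]|[ik _ /andP[_ z2]]]]; first by rewrite ler_nat.
by apply: le_trans z2 _; rewrite ler_nat.
Qed.

Lemma tel_set_ge0 B k z : tel_set B k z -> 0 <= z.2.
Proof. by move=> [i [[ik ->]|[ik _ /andP[z2 _]]]] //; apply: le_trans z2. Qed.

Lemma tel_setS B k z : tel_set B k z -> tel_set B k.+1 z.
Proof.
move=> [i [[ik e]|[ik b e]]]; exists i; [left|right]; split=> //.
  exact: leq_trans ik _.
exact: ltn_trans ik _.
Qed.

Lemma tel_setS_le B k z : tel_set B k.+1 z -> z.2 <= k%:R -> tel_set B k z.
Proof.
move=> [i [[ik e]|[ik b /andP[e1 e2]]]] zk.
  by exists i; left; split=> //; rewrite -(@ler_nat R) -e.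
move: ik; rewrite ltnS leq_eqVlt => /orP[/eqP ik|ik]; last first.
  by exists i; right; split=> //; rewrite e1.
exists k; left; split=> //; apply/eqP; rewrite eq_le zk -ik e1 //.
Qed.

Definition tel_incl B k : tel B k -> tel B k.+1 :=
  @corestr (tel B k) _ _ (fun z => set_val z) (fun z => tel_setS (set_valP z)).

Lemma cts_tel_incl B k : cts (@tel_incl B k).
Proof. by apply: cts_corestr; ctsify. Qed.

Lemma tel_collar_subproof B k (c : collar R (B k)) :
  tel_set B k.+1 ((set_val c).1, (set_val c).2 + k%:R).
Proof.
have [[b /andP[t0 t1]]|t1] := collarP c.
  by exists k; right; split=> //=; apply/andP; rewrite -natr1; split; lra.
by exists k.+1; left; rewrite /= t1 -natr1 addrC.
Qed.

Definition tel_collar B k : collar R (B k) -> tel B k.+1 :=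
  corestr (@tel_collar_subproof B k).

Lemma tel_collar_dich B k (z : tel B k.+1) : (set_val z).2 <= k%:R \/
  (collar_set R (B k))
    ((set_val z).1, (set_val z).2 - k%:R).
Proof.
have [h|h] := leP (set_val z).2 k%:R; [by left|right].
have [i [[ik e]|[ik b /andP[e1 e2]]]] := set_valP z.
  have {}ik : i = k.+1.
    by apply/eqP; rewrite eqn_leq ik -(@ltr_nat R) -e.
  by right; rewrite /= e ik -natr1; lra.
have {}ik : i = k.
  apply/eqP; rewrite eqn_leq -ltnS ik -ltnS -(@ltr_nat R).
  exact: lt_le_trans h e2.
rewrite ik in b e2; left; split=> //=.
have {}e2 : (set_val z).2 <= k%:R + 1 by rewrite natr1.
by apply/andP; split; lra.
Qed.

(** The part below height [k] and the part above it are closed, the latter because [B k] is, so the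
    subspace topology has the universal property of the pushout. *)
Lemma tel_pushout B k : closed (B k) ->
  pushout_sq (fun a : B k => tel_last B k (set_val a)) (@collar_bottom R X (B k))
    (@tel_incl B k) (@tel_collar B k).
Proof.
move=> clB; split.
- exact: cts_tel_incl.
- by apply: cts_corestr; ctsify.
- move=> a; apply: val_inj.
  by change ((set_val a, k%:R : R) = (set_val a, 0 + k%:R)); rewrite add0r.
- move=> z; have [h|h] := tel_collar_dich z.
    left; exists (SigSub (mem_set (tel_setS_le (set_valP z) h))).
    exact: val_inj.
  right; exists (SigSub (mem_set h)); apply: val_inj.
  change (((set_val z).1, (set_val z).2 - k%:R + k%:R) = set_val z).
  by rewrite subrK -surjective_pairing.
- move=> V u v cu cv uv.
  pose w (z : tel B k.+1) : V := match pselect ((set_val z).2 <= k%:R) with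
    | left h => u (SigSub (mem_set (tel_setS_le (set_valP z) h)))
    | right n => v (SigSub (mem_set (or_ind (fun h => False_ind _ (n h)) id (tel_collar_dich z))))
    end.
  have wZ z : w (tel_incl z) = u z.
    rewrite /w; case: pselect => [h|n]; first by congr u; exact: val_inj.
    by case: n; have /tel_set_le := set_valP z.
  have wC c : w (tel_collar c) = v c.
    rewrite /w; case: pselect => [h|n].
      have h' : (set_val c).2 + k%:R <= k%:R by exact: h.
      have [[b /andP[t0 t1]]|t1] := collarP c; last first.
        by exfalso; lra.
      have c0 : (set_val c).2 = 0 by lra.
      pose a : B k := SigSub (mem_set b).
      apply: (@eq_trans _ _ (u (tel_last B k (set_val a)))).
        congr u; apply: val_inj.
        change (((set_val c).1, (set_val c).2 + k%:R) = ((set_val c).1, k%:R)).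
        by rewrite c0 add0r.
      rewrite uv; congr v; apply: val_inj.
      change (((set_val c).1, 0) = set_val c).
      by rewrite [RHS]surjective_pairing c0.
    congr v; apply: val_inj.
    change (((set_val c).1, (set_val c).2 + k%:R - k%:R) = set_val c).
    by rewrite addrK -surjective_pairing.
  exists w; split=> //.
  pose C0 := [set z : tel B k.+1 | (set_val z).2 <= k%:R].
  pose C1 := [set z : tel B k.+1 | (B k (set_val z).1 /\ 0 <= (set_val z).2 - k%:R <= 1) \/
                  (set_val z).2 - k%:R = 1].
  apply: (@cts_cover2 _ _ C0 C1).
  + by apply: closed_lec; ctsify.
  + apply: closedU; [apply: closedI|].
    * by apply: (@closed_preimage _ _ (fun z : tel B k.+1 => (set_val z).1) (B k)) => //; ctsify.
    * apply: (@closed_preimage _ _ (fun z : tel B k.+1 => (set_val z).2 - k%:R) `[0, 1]%classic).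
        by ctsify.
      exact: itv_closed.
    * by apply: closed_eqc; ctsify.
  + by move=> z; have [h|h] := tel_collar_dich z; [left|right].
  + have hP (z : C0) : tel_set B k (set_val (set_val z)).
      exact: (tel_setS_le (set_valP (set_val z)) (set_valP z)).
    have ch : cts (fun z : C0 => u (corestr hP z)).
      by apply: cts_comp => //; apply: cts_corestr; ctsify.
    apply: cts_ext ch => z; rewrite -wZ; congr w; exact: val_inj.
  + have hP (z : C1) : (collar_set R (B k))
        ((set_val (set_val z)).1, (set_val (set_val z)).2 - k%:R).
      exact: (set_valP z).
    have ch : cts (fun z : C1 => v (corestr hP z)).
      by apply: cts_comp => //; apply: cts_corestr; ctsify.
    apply: cts_ext ch => z; rewrite -wC; congr w; apply: val_inj.
    change (set_val (set_val z) =
      ((set_val (set_val z)).1, (set_val (set_val z)).2 - k%:R + k%:R)).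
    by rewrite subrK -surjective_pairing.
Qed.

(** The equivalence is a composite: collapse the last tube ([heq_collar]), then replace the lower
    telescope by [Z] ([heq_cobase]). *)
Lemma tel_step B k (rho : X * R -> X * R) (Z Q : topologicalType) (last : X -> Z)
    (c : tel B k -> Z) (jZ : Z -> Q) (jX : X -> Q) :
  closed (B k) -> cyl_retraction (B k) rho -> heq R c ->
  (forall x, c (tel_last B k x) = last x) ->
  pushout_sq (fun a : B k => last (set_val a)) (set_val : B k -> X) jZ jX ->
  exists c' : tel B k.+1 -> Q, [/\ heq R c',
    forall z, c' (tel_incl z) = jZ (c z) & forall x, c' (tel_last B k.+1 x) = jX x].
Proof.
move=> clB rhoP hc cl po.
pose f (a : B k) := tel_last B k (set_val a).
have cf : cts f.
  apply: cts_set_type; have -> : (fun a => set_val (f a)) = (fun a : B k => (set_val a, k%:R)).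
    by [].
  by ctsify.
have [Q' [jZ' [jX' po']]] : exists (Q' : topologicalType) (jZ' : tel B k -> Q')
    (jX' : X -> Q'), pushout_sq f (set_val : B k -> X) jZ' jX'.
  by exists (pushout f set_val), (pushout_inl f set_val), (pushout_inr f set_val); exact: pushoutP.
have pot := tel_pushout clB.
have [cjZ' cjX' jf' _ univ'] := po'; have [_ _ _ _ univt] := pot.
have [cjZ cjX jf _ _] := po; have [cc _] := hc.
have [||th1 [cth1 th1Z th1C]] := univt Q' jZ' (fun c => jX' (set_val c).1) cjZ'.
- by ctsify.
- by move=> a; rewrite jf'.
have h1 : heq R th1 := heq_collar rhoP pot po' cth1 th1Z th1C.
have [||th2 [cth2 th2Z th2X]] := univ' Q (fun z => jZ (c z)) jX _ cjX.
- by ctsify.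
- by move=> a; rewrite /f cl jf.
have ef : (fun a : B k => last (set_val a)) = (fun a => c (f a)).
  by apply/funext => a; rewrite /f cl.
have h2 : heq R th2.
  apply: (heq_cobase clB rhoP cf hc po' _ cth2 th2Z th2X).
  by rewrite -ef.
exists (fun z => th2 (th1 z)); split.
- exact: heq_comp.
- by move=> z; rewrite th1Z th2Z.
- move=> x.
  have cP : (collar_set R (B k)) (x, 1) by right.
  have -> : tel_last B k.+1 x = tel_collar (SigSub (mem_set cP)).
    apply: val_inj; change ((x, k.+1%:R : R) = (x, 1 + k%:R)).
    by rewrite -natr1 addrC.
  by rewrite th1C th2X.
Qed.

Lemma tel0_heq B : heq R (fun z : tel B 0 => (set_val z).1).
Proof.
split; first by ctsify.
exists (tel_first B 0); split.
- apply: cts_set_type; have -> : (fun a => set_val (tel_first B 0 a)) = (fun a => (a, 0%:R)).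
    by [].
  by ctsify.
- apply: htp_eq => [|z].
    apply: cts_set_type; have -> : (fun a : tel B 0 => set_val (tel_first B 0 (set_val a).1)) =
       (fun a => ((set_val a).1, 0%:R)) by [].
    by ctsify.
  apply: val_inj; change (((set_val z).1, 0%:R) = set_val z).
  have h0 := tel_set_ge0 (set_valP z); have h1 := tel_set_le (set_valP z).
  rewrite [RHS]surjective_pairing; congr (_, _).
  by apply/eqP; rewrite eq_le h0 h1.
- by apply: htp_eq => //; exact: cts_id.
Qed.

End telescopes.

(** Reindexes a gluing along a surjection of the glued part and a homeomorphism of the attached
    space. It turns the gluing of [X_k] into one of [X_1] along [glue_set]. *)
Lemma pushout_sq_transport (A A' Z X Y Q : topologicalType) (g : A -> Z) (f : A -> Y)
    (jZ : Z -> Q) (jY : Y -> Q) (e : A' -> A) (i : A' -> X) (lam : X -> Y) (mu : Y -> X) :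
  pushout_sq g f jZ jY -> (forall a, exists b, e b = a) -> cts lam -> cts mu ->
  cancel lam mu -> cancel mu lam -> (forall b, f (e b) = lam (i b)) ->
  pushout_sq (fun b => g (e b)) i jZ (fun x => jY (lam x)).
Proof.
move=> [cjZ cjY jf surj univ] esurj cl cm lm ml fe; split=> //.
- by ctsify.
- by move=> b; rewrite jf fe.
- move=> q; have [|[y <-]] := surj q; first by left.
  by right; exists (mu y); rewrite ml.
- move=> V u v cu cv uv.
  have [||h [ch hZ hY]] := univ V u (fun y => v (mu y)) cu.
  + by ctsify.
  + by move=> a; have [b <-] := esurj a; rewrite uv fe lm.
  exists h; split=> // x; by rewrite hY lm.
Qed.

Section gluing.
Context R (n : nat) (X : nat -> topologicalType).
Context (phi : forall i j : nat, X i -> X j).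
Arguments phi : clear implicits.
Context (hphi : forall k, (1 < k <= n)%N -> homeomorphism (phi 1 k)).
Context (A2 : set (X 1)) (psi : X 1 -> X 1) (hpsi : homeomorphism psi).

Definition glue_set (i : nat) : set (X 1) := [set x | A2 (iter i psi x)].

Context (B_closed : forall i, closed (glue_set i)).
Context (B_retr : forall i, exists rho : X 1 * R -> X 1 * R, cyl_retraction (glue_set i) rho).

(** The power of [psi] absorbs the twist of the gluing maps: [glue_f] sends [copy_map m b] to
    [copy_map m.+1 b]. *)
Definition copy_map (m : nat) (x : X 1) : X m.+2 := phi 1 m.+2 (iter m.+1 psi x).

Lemma iter_homeomorphism m : exists mu : X 1 -> X 1,
  [/\ cts (iter m psi), cts mu, cancel (iter m psi) mu & cancel mu (iter m psi)].
Proof.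
have [cpsi [psi' [cpsi' K1 K2]]] := hpsi.
elim: m => [|m [mu [c1 c2 h1 h2]]].
  by exists id; split=> //; exact: cts_id.
exists (fun x => mu (psi' x)); split.
- by apply: (@cts_comp _ _ _ psi (iter m psi)).
- by ctsify.
- by move=> x; rewrite /= K1 h1.
- by move=> x; rewrite /= h2 K2.
Qed.

Lemma copy_map_homeo m : (m.+2 <= n)%N -> exists mu : X m.+2 -> X 1,
  [/\ cts (copy_map m), cts mu, cancel (copy_map m) mu & cancel mu (copy_map m)].
Proof.
move=> mn; have [cp [phi' [cphi' K1 K2]]] := @hphi m.+2 mn.
have [mu [c1 c2 h1 h2]] := iter_homeomorphism m.+1.
exists (fun y => mu (phi' y)); split.
- exact: (cts_comp cp c1).
- by ctsify.
- by move=> x; rewrite /copy_map K1 h1.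
- by move=> y; rewrite /copy_map h2 K2.
Qed.

(** The last copy is tracked so that the next gluing can be performed, the first so that the base
    point of [P_n] can be located. *)
Lemma tel_glued m : (m.+2 <= n)%N ->
  exists c : tel R glue_set m.+1 -> stage_space (P_stage phi A2 psi m),
    [/\ heq R c,
        forall x, c (tel_first R glue_set m.+1 x) = stage_first (P_stage phi A2 psi m) x
      & forall x, c (tel_last R glue_set m.+1 x) =
          stage_last (P_stage phi A2 psi m) (copy_map m x)].
Proof.
elim: m => [|m IH] mn.
  have [mu [c1 c2 h1 h2]] := copy_map_homeo mn.
  have [rho rhoP] := B_retr 0.
  have po := pushoutP (set_val : A2 -> X 1) (@glue_f2 X phi A2 psi).
  pose e (b : glue_set 0) : A2 := SigSub (mem_set (set_valP b)).
  have esurj a : exists b, e b = a.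
    have aP : glue_set 0 (set_val a) by exact: (set_valP a).
    by exists (SigSub (mem_set aP)); exact: val_inj.
  have po' := @pushout_sq_transport _ (glue_set 0) _ _ _ _ _ _ _ _ e set_val (copy_map 0) mu
    po esurj c1 c2 h1 h2 (fun b => erefl).
  have [c' [hc' c'Z c'X]] := tel_step (last := id) (@B_closed 0) rhoP (tel0_heq R glue_set)
    (fun x => erefl) po'.
  exists c'; split=> // x.
  have -> : tel_first R glue_set 1 x = tel_incl (tel_first R glue_set 0 x) by exact: val_inj.
  by rewrite c'Z.
have [c [hc cf cl]] := IH (ltnW mn).
have [mu [c1 c2 h1 h2]] := copy_map_homeo mn.
have [rho rhoP] := B_retr m.+1.
set P := P_stage phi A2 psi m in c hc cf cl *.
have po := pushoutP (fun c : phi 1 m.+2 @` A2 => stage_last P (set_val c)) (@glue_f X phi A2 psi m.+2).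
have eP (b : glue_set m.+1) : (phi 1 m.+2 @` A2) (copy_map m (set_val b)).
  by exists (iter m.+1 psi (set_val b)) => //; exact: (set_valP b).
pose e : glue_set m.+1 -> phi 1 m.+2 @` A2 := corestr eP.
have esurj a : exists b, e b = a.
  have [y A2y ya] := set_valP a.
  have [nu [_ _ k1 k2]] := iter_homeomorphism m.+1.
  have yP : glue_set m.+1 (nu y) by rewrite /glue_set /mkset k2.
  exists (SigSub (mem_set yP)); apply: val_inj.
  change (copy_map m (nu y) = \val a).
  by rewrite -ya /copy_map k2.
have [_ [phi' [_ K1 _]]] := @hphi m.+2 (ltnW mn).
(* The preimage chosen by [phi_inv] must be [psi^(m+1) b], because [phi 1 m.+2] has a left
   inverse. *)
have fe b : @glue_f X phi A2 psi m.+2 (e b) = copy_map m.+1 (set_val b).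
  rewrite /glue_f /copy_map iterS; congr (phi 1 _ (psi _)).
  rewrite /phi_inv; case: (cid2 _) => y /= A2y.
  by move=> /(congr1 phi'); rewrite K1 => ->; rewrite [set_val _]/= /copy_map K1.
have po' := @pushout_sq_transport _ (glue_set m.+1) _ _ _ _ _ _ _ _ e set_val (copy_map m.+1) mu
    po esurj c1 c2 h1 h2 fe.
have [c' [hc' c'Z c'X]] := tel_step (last := fun x => stage_last P (copy_map m x))
  (@B_closed m.+1) rhoP hc cl po'.
exists c'; split=> // x.
have -> : tel_first R glue_set m.+2 x = tel_incl (tel_first R glue_set m.+1 x) by exact: val_inj.
by rewrite c'Z cf.
Qed.

End gluing.

(** * Comparison with the homotopies and loop spaces of the statement *)

Section interface.
Context R.

Lemma htp_homotopic X Y (f g : X -> Y) :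
  htp R f g -> homotopic R f g.
Proof.
move=> [H [cH H0 H1]]; exists (fun z => H (z.1, set_val z.2)); split=> //.
have : cts (fun z : X * I01 R => H (z.1, set_val z.2)) by ctsify.
by [].
Qed.

Lemma heqv_homotopy_equivalent X Y :
  heqv R X Y -> homotopy_equivalent R X Y.
Proof.
move=> [f [cf [g [cg gf fg]]]]; exists f, g.
by split=> //; apply: htp_homotopic.
Qed.

Lemma pev_zero X (w : pathsp R X) :
  pev w 0 = (set_val w : I01 R -> X) zero.
Proof. by rewrite /pev to01_0. Qed.

Lemma pev_one X (w : pathsp R X) :
  pev w 1 = (set_val w : I01 R -> X) one.
Proof. by rewrite /pev to01_1. Qed.

Lemma cts_path X (x y : X) (w : {path (I01 R) from x to y in X}) :
  cts (fun t => (w : I01 R -> X) (to01 t)).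
Proof.
have cw : cts (w : I01 R -> X) by exact: (@cts_fun _ _ w).
by apply: cts_comp => //; ctsify.
Qed.

Lemma loop_space_paths X (x : X) :
  heqv R (loop_space R x) (paths R x x).
Proof.
have cw (w : loop_space R x) := @cts_path X x x w.
have fP (w : loop_space R x) : pev (mkp (cw w)) 0 = x /\ pev (mkp (cw w)) 1 = x.
  by rewrite !pev_mkp clamp0 clamp1 to01_0 to01_1 path_zero path_one.
have cg (w : paths R x x) : continuous (set_val (set_val w) : I01 R -> X).
  by have := set_valP (set_val w).
have g0 (w : paths R x x) : (set_val (set_val w) : I01 R -> X) zero = x.
  by rewrite -[RHS](paths_zero w) pev_zero.
have g1 (w : paths R x x) : (set_val (set_val w) : I01 R -> X) one = x.
  by rewrite -[RHS](paths_one w) pev_one.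
pose f (w : loop_space R x) : paths R x x := mkpaths (fP w).
pose g (w : paths R x x) : loop_space R x := mk_path (@cg w) (g0 w) (g1 w).
have fg w : f (g w) = w.
  by apply: val_inj; apply: pathsp_ext => t t01; rewrite pev_mkp /pev to01_clamp.
have gf w : g (f w) = w.
  apply/path_eqP => s; change ((w : I01 R -> X) (to01 (set_val s)) = w s).
  by rewrite to01K.
have ccf : cts f.
  apply: cts_mkpaths; apply: cts_set_type; apply: cts_curry.
  apply: (@cts_ext _ _ (fun z : loop_space R x * I01 R => (z.1 : I01 R -> X) z.2)).
    by move=> [w s] /=; change ((w : I01 R -> X) (to01 (set_val s)) = w s); rewrite to01K.
  apply: (@cts_uncurry R (loop_space R x) X (fun w => w : I01 R -> X)).
    exact: initial_continuous.
  by move=> w; exact: (@cts_fun _ _ w).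
have ccg : cts g.
  apply: continuous_comp_initial.
  have : cts (fun w : paths R x x => set_val (set_val w)) by ctsify.
  by [].
by exists f; exact: heq_homeo ccf ccg gf fg.
Qed.

End interface.

(** * Maps and homotopies out of telescopes *)

Section maps_out_of_telescopes.
Context R X (B : nat -> set X).

Lemma collar_map V (A : set X) (w : A * R -> V) (v : X -> V) :
  closed A -> cts w -> cts v -> (forall a, w (a, 1) = v (set_val a)) ->
  exists g : collar R A -> V, [/\ cts g,
    forall (c : collar R A) (a : A), (set_val c).1 = set_val a ->
      g c = w (a, (set_val c).2)
    & forall c : collar R A, (set_val c).2 = 1 -> g c = v (set_val c).1].
Proof.
move=> clA cw cv wv.
pose g (c : collar R A) : V := match pselect (A (set_val c).1) with
  | left h => w (SigSub (mem_set h), (set_val c).2)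
  | right _ => v (set_val c).1 end.
have gw (c : collar R A) (a : A) : (set_val c).1 = set_val a -> g c = w (a, (set_val c).2).
  rewrite /g => e; case: pselect => [h|n].
    by congr (w (_, _)); apply: val_inj.
  by case: n; rewrite e; exact: (set_valP a).
have gv (c : collar R A) : (set_val c).2 = 1 -> g c = v (set_val c).1.
  by rewrite /g => e; case: pselect => // h; rewrite e wv.
exists g; split=> //.
pose C0 := [set c : collar R A | A (set_val c).1].
pose C1 := [set c : collar R A | (set_val c).2 = 1].
apply: (@cts_cover2 _ _ C0 C1).
- by apply: (@closed_preimage _ _ (fun c : collar R A => (set_val c).1) A) => //; ctsify.
- by apply: closed_eqc; ctsify.
- by move=> c; have [[h _]|h] := collarP c; [left|right].
- have hP (c : C0) : A (set_val (set_val c)).1 by exact: (set_valP c).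
  have ch : cts (corestr hP) by apply: cts_corestr; ctsify.
  apply: (@cts_ext _ _ (fun c : C0 => w (corestr hP c, (set_val (set_val c)).2))); last by ctsify.
  by move=> c; apply: gw.
- apply: (@cts_ext _ _ (fun c : C1 => v (set_val (set_val c)).1)); last by ctsify.
  by move=> c; apply: gv; exact: (set_valP c).
Qed.

Context (clB : forall i, closed (B i)).

Definition tel_copy k i (ik : (i <= k)%N) (x : X) : tel R B k :=
  SigSub (mem_set (@tel_copy_subproof R X B k i x ik)).

Lemma tel_tube_subproof k i (ik : (i < k)%N) (z : B i * R) :
  @tel_set R X B k (set_val z.1, i%:R + clamp z.2).
Proof.
exists i; right; split=> //; first exact: (set_valP z.1).
by have /andP[h0 h1] := clamp01 z.2; rewrite /= lerDl h0 -natr1 lerD2l.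
Qed.

Definition tel_tube k i (ik : (i < k)%N) (z : B i * R) : tel R B k :=
  SigSub (mem_set (tel_tube_subproof ik z)).

Lemma cts_tel_copy k i (ik : (i <= k)%N) : cts (@tel_copy k i ik).
Proof.
apply: cts_set_type; have -> : (fun x => set_val (tel_copy ik x)) = (fun x => (x, i%:R)) by [].
by ctsify.
Qed.

Lemma cts_tel_tube k i (ik : (i < k)%N) : cts (@tel_tube k i ik).
Proof.
apply: cts_set_type; have -> : (fun z => set_val (tel_tube ik z)) =
   (fun z => (set_val z.1, i%:R + clamp z.2)) by [].
by ctsify.
Qed.

Lemma tel_tube0 k i (ik : (i < k)%N) a t : t <= 0 ->
  tel_tube ik (a, t) = tel_copy (ltnW ik) (set_val a).
Proof.
move=> t0; apply: val_inj; change ((set_val a, i%:R + clamp t) = (set_val a, i%:R)).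
by rewrite clamp_le0 // addr0.
Qed.

Lemma tel_tube1 k i (ik : (i < k)%N) a t : 1 <= t ->
  tel_tube ik (a, t) = tel_copy ik (set_val a).
Proof.
move=> t1; apply: val_inj; change ((set_val a, i%:R + clamp t) = (set_val a, i.+1%:R)).
by rewrite clamp_ge1 // natr1.
Qed.

Lemma tel_surj k (z : tel R B k) :
  (exists i (ik : (i <= k)%N) x, z = tel_copy ik x) \/
  (exists i (ik : (i < k)%N) a t, 0 <= t <= 1 /\ z = tel_tube ik (a, t)).
Proof.
have [i [[ik e]|[ik b /andP[h0 h1]]]] := set_valP z; [left|right].
  exists i, ik, (set_val z).1; apply: val_inj; rewrite -set_valE.
  by rewrite [LHS]surjective_pairing; congr (_, _); exact: e.
have {}h0 : i%:R <= (set_val z).2 by exact: h0.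
have {}h1 : (set_val z).2 <= i%:R + 1 by rewrite natr1.
have t01 : 0 <= (set_val z).2 - i%:R <= 1 by apply/andP; split; lra.
exists i, ik, (SigSub (mem_set b)), ((set_val z).2 - i%:R); split=> //.
apply: val_inj; change (set_val z = ((set_val z).1, i%:R + clamp ((set_val z).2 - i%:R))).
by rewrite clamp_id // addrC subrK -surjective_pairing.
Qed.

Lemma tel_map k V (v : nat -> X -> V) (w : forall i, B i * R -> V) :
  (forall i, (i <= k)%N -> cts (v i)) -> (forall i, (i < k)%N -> cts (w i)) ->
  (forall i a, (i < k)%N -> w i (a, 0) = v i (set_val a)) ->
  (forall i a, (i < k)%N -> w i (a, 1) = v i.+1 (set_val a)) ->
  exists h : tel R B k -> V, [/\ cts h,
    forall i (ik : (i <= k)%N) x, h (tel_copy ik x) = v i x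
    & forall i (ik : (i < k)%N) a t, 0 <= t <= 1 -> h (tel_tube ik (a, t)) = w i (a, t)].
Proof.
elim: k => [|k IH] cv cw w0 w1.
  exists (fun z => v 0 (set_val z).1); split=> //.
    by have c0 := cv 0 isT; ctsify.
  move=> i ik x; change (v 0%N x = v i x).
  by have /eqP -> : i == 0%N by rewrite -leqn0.
have [||||h [ch hv hw]] := IH.
- by move=> i ik; apply: cv; exact: leq_trans ik _.
- by move=> i ik; apply: cw; exact: ltn_trans ik _.
- by move=> i a ik; apply: w0; exact: ltn_trans ik _.
- by move=> i a ik; apply: w1; exact: ltn_trans ik _.
have [|||g [cg gw gv]] := @collar_map V (B k) (w k) (v k.+1) (@clB k).
- exact: cw.
- exact: cv.
- by move=> a; apply: w1.
have [_ _ _ surj univ] := tel_pushout R (@clB k).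
have [|h' [ch' hZ hC]] := univ V h g ch cg.
  move=> a; have -> : tel_last R B k (set_val a) = tel_copy (leqnn k) (set_val a) by exact: val_inj.
  by rewrite hv (gw _ a) //; change (v k (set_val a) = w k (a, 0)); rewrite w0.
have cpE i (ik : (i <= k)%N) (ik' : (i <= k.+1)%N) x :
    tel_copy ik' x = tel_incl (tel_copy ik x) by exact: val_inj.
have tbE i (ik : (i < k)%N) (ik' : (i < k.+1)%N) z :
    tel_tube ik' z = tel_incl (tel_tube ik z) by exact: val_inj.
exists h'; split=> //.
- move=> i ik x.
  have /orP[/eqP i1|ik'] : (i == k.+1) || (i <= k)%N by rewrite -ltnS -leq_eqVlt.
    2: by rewrite (cpE _ ik') hZ hv.
  have cP : (collar_set R (B k)) (x, 1) by right.
  have -> : tel_copy ik x = tel_collar (SigSub (mem_set cP)).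
    apply: val_inj; change ((x, i%:R : R) = (x, 1 + k%:R)).
    by rewrite i1 -natr1 addrC.
  by rewrite hC gv // i1.
- move=> i ik a t t01.
  have /orP[/eqP i1|ik'] : (i == k) || (i < k)%N by rewrite -leq_eqVlt -ltnS.
    2: by rewrite (tbE _ ik') hZ hw.
  move: ik a; rewrite i1 => ik a.
  have cP : (collar_set R (B k)) (set_val a, t).
    by left; split=> //; exact: (set_valP a).
  have -> : tel_tube ik (a, t) = tel_collar (SigSub (mem_set cP)).
    apply: val_inj; change ((set_val a, k%:R + clamp t) = (set_val a, t + k%:R)).
    by rewrite clamp_id // addrC.
  by rewrite hC (gw _ a).
Qed.

Lemma tel_htp k V (v : nat -> X * R -> V)
    (w : forall i, B i * R * R -> V) :
  (forall i, (i <= k)%N -> cts (v i)) -> (forall i, (i < k)%N -> cts (w i)) ->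
  (forall i a t, (i < k)%N -> 0 <= t <= 1 -> w i (a, 0, t) = v i (set_val a, t)) ->
  (forall i a t, (i < k)%N -> 0 <= t <= 1 -> w i (a, 1, t) = v i.+1 (set_val a, t)) ->
  exists h : tel R B k * R -> V, [/\ cts h,
    forall i (ik : (i <= k)%N) x t, 0 <= t <= 1 -> h (tel_copy ik x, t) = v i (x, t)
    & forall i (ik : (i < k)%N) a s t, 0 <= s <= 1 -> 0 <= t <= 1 ->
        h (tel_tube ik (a, s), t) = w i (a, s, t)].
Proof.
move=> cv cw w0 w1.
(* Continuity is available only for indices in range; other indices get a junk constant path, so
   that the family is total. *)
pose vp i (x : X) : pathsp R V := match pselect (cts (v i)) with
  | left h => mkp (cts_comp h (cts_pair (@cts_cst _ _ x) (@cts_id _)))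
  | right _ => mkp (@cts_cst R V (v i (x, 0))) end.
pose wp i (z : B i * R) : pathsp R V := match pselect (cts (w i)) with
  | left h => mkp (cts_comp h (cts_pair (@cts_cst _ _ z) (@cts_id _)))
  | right _ => mkp (@cts_cst R V (w i (z, 0))) end.
have vpE i x t : (i <= k)%N -> pev (vp i x) t = v i (x, clamp t).
  by move=> /cv ci; rewrite /vp; case: pselect => // ?; rewrite pev_mkp.
have wpE i z t : (i < k)%N -> pev (wp i z) t = w i (z, clamp t).
  by move=> /cw ci; rewrite /wp; case: pselect => // ?; rewrite pev_mkp.
have [||||h [ch hv hw]] := @tel_map k (pathsp R V) vp wp.
- move=> i ik; apply: cts_pathsp; apply: (@cts_ext _ _ (fun z : X * R => v i (z.1, clamp z.2))).
    by move=> z; rewrite vpE.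
  by have ci := cv i ik; ctsify.
- move=> i ik; apply: cts_pathsp; apply: (@cts_ext _ _ (fun z : B i * R * R => w i (z.1, clamp z.2))).
    by move=> z; rewrite wpE.
  by have ci := cw i ik; ctsify.
- move=> i a ik; apply: pathsp_ext => t t01; rewrite wpE // vpE; last exact: ltnW.
  by rewrite w0 ?clamp01.
- by move=> i a ik; apply: pathsp_ext => t t01; rewrite wpE // vpE // w1 ?clamp01.
exists (fun z => pev (h z.1) z.2); split; first by ctsify.
- by move=> i ik x t t01; rewrite /= hv vpE // clamp_id.
- by move=> i ik a s t s01 t01; rewrite /= hw // wpE // clamp_id.
Qed.

End maps_out_of_telescopes.

(** * Chains of suspensions *)

(* A chain of [m] unreduced suspensions of [F], each glued to the next one at a
   cone point. *)
Section chain.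
Context R (F : ptopologicalType) (m : nat).

Let S : topologicalType := {i : 'I_m & (F * I01 R)%type}.

(** A complete invariant of the class: cone point [i] at the bottom of the suspension [i] and
    [i + 1] at its top, so that consecutive suspensions share a cone point; every other point is its
    own class. *)
Definition chain_code (u : S) : nat + S :=
  if set_val (projT2 u).2 == 0 then inl (projT1 u : nat)
  else if set_val (projT2 u).2 == 1 then inl (projT1 u).+1 else inr u.

Definition chain_rel_def (u v : S) : bool := chain_code u == chain_code v.

Fact chain_rel_refl : reflexive chain_rel_def.
Proof. by move=> u; exact: eqxx. Qed.

Fact chain_rel_sym : symmetric chain_rel_def.
Proof. by move=> u v; exact: eq_sym. Qed.

Fact chain_rel_trans : transitive chain_rel_def.
Proof. by rewrite /chain_rel_def => v u w /eqP -> /eqP ->. Qed.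

Definition chain_rel := EquivRel _ chain_rel_refl chain_rel_sym chain_rel_trans.

Definition chain_quot := {eq_quot chain_rel}%qT.

Definition chain : topologicalType := quotient_topology chain_quot.

Definition chain_pt (i : 'I_m) (z : F * R) : chain :=
  \pi_(chain_quot)%qT (existT (fun _ : 'I_m => (F * I01 R)%type) i (z.1, to01 z.2)).

Lemma cts_chain_pt i : cts (chain_pt i).
Proof.
have h1 : cts (fun u : S => \pi_(chain_quot)%qT u : chain) by exact: pi_continuous.
have h2 : cts (existT (fun _ : 'I_m => (F * I01 R)%type) i) by exact: existT_continuous.
pose g (z : F * R) := (z.1, to01 z.2).
have cg : cts g by rewrite /g; ctsify.
exact: (cts_comp h1 (cts_comp h2 cg)).
Qed.

Lemma chain_pt_clamp i f s : chain_pt i (f, clamp s) = chain_pt i (f, s).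
Proof. by rewrite /chain_pt /= to01_clamp. Qed.

Lemma chain_surj (z : chain) : exists i f s, 0 <= s <= 1 /\ z = chain_pt i (f, s).
Proof.
rewrite -[z](@reprK _ chain_quot); case: (repr z) => i [f s].
by exists i, f, (set_val s); split; [exact: I01P|rewrite /chain_pt /= to01K].
Qed.

Lemma chain_map V (p : nat -> V) (w : 'I_m -> F * R -> V) :
  (forall i, cts (w i)) -> (forall i f, w i (f, 0) = p i) ->
  (forall i f, w i (f, 1) = p i.+1) ->
  exists h : chain -> V, cts h /\ forall i f s, 0 <= s <= 1 -> h (chain_pt i (f, s)) = w i (f, s).
Proof.
move=> cw w0 w1.
pose g (u : S) : V := w (projT1 u) ((projT2 u).1, set_val (projT2 u).2).
have cg : continuous g.
  have cgi i : continuous (fun z : F * I01 R => w i (z.1, set_val z.2)).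
    have ci := cw i.
    have : cts (fun z : F * I01 R => w i (z.1, set_val z.2)) by ctsify.
    by [].
  exact: (sigT_continuous (fun i (z : F * I01 R) => w i (z.1, set_val z.2)) cgi).
pose gc (c : nat + S) := match c with inl i => p i | inr u => g u end.
have gcE u : g u = gc (chain_code u).
  rewrite /g /chain_code; case: eqP => [->|_] /=; first by rewrite w0.
  by case: eqP => [->|_] //=; rewrite w1.
have gpi u : g (repr (\pi_(chain_quot)%qT u)) = g u.
  have /eqP e : chain_code (repr (\pi_(chain_quot)%qT u)) == chain_code u.
    by have /eqmodP := @reprK _ chain_quot (\pi_(chain_quot)%qT u).
  by rewrite !gcE e.
exists (fun z => g (repr z)); split.
  apply/(@quotient_continuous _ chain_quot).
  by apply: (@cts_ext _ _ g) => // u; rewrite /= gpi.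
by move=> i f s s01; rewrite /chain_pt gpi /g /= val_to01 clamp_id.
Qed.

Lemma chain_htp V (p : nat -> R -> V) (w : 'I_m -> F * R * R -> V) :
  (forall i, cts (w i)) ->
  (forall i f t, 0 <= t <= 1 -> w i (f, 0, t) = p i t) ->
  (forall i f t, 0 <= t <= 1 -> w i (f, 1, t) = p i.+1 t) ->
  exists h : chain * R -> V, cts h /\ forall i f s t, 0 <= s <= 1 -> 0 <= t <= 1 ->
    h (chain_pt i (f, s), t) = w i (f, s, t).
Proof.
move=> cw w0 w1.
have cw1 i z : cts (fun t => w i (z, t)) by have ci := cw i; ctsify.
(* [p j] is a bare function. At a cone point of the chain it agrees on [0, 1] with a path given by
   [w], unique by [pathsp_ext]; an index without such a path gets a junk value. *)
pose pp (j : nat) : pathsp R V :=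
  match pselect (exists u : pathsp R V, forall t, 0 <= t <= 1 -> pev u t = p j t) with
  | left h => projT1 (cid h) | right _ => mkp (@cts_cst R V (p 0 0)) end.
have ppE j u : (forall t, 0 <= t <= 1 -> pev u t = p j t) -> pp j = u.
  move=> hu; rewrite /pp; case: pselect => [h|n]; last by case: n; exists u.
  by apply: pathsp_ext => t t01; rewrite (projT2 (cid h)) // hu.
have [|||h [ch hw]] := @chain_map (pathsp R V) pp (fun i z => mkp (cw1 i z)).
- by move=> i; have ci := cw i; apply: cts_pathsp_mkp; ctsify.
- move=> i f; rewrite [RHS](ppE _ (mkp (cw1 i (f, 0)))) // => t t01.
  by rewrite pev_mkp clamp_id // w0.
- move=> i f; rewrite [RHS](ppE _ (mkp (cw1 i (f, 1)))) // => t t01.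
  by rewrite pev_mkp clamp_id // w1.
exists (fun z => pev (h z.1) z.2); split; first by ctsify.
by move=> i f s t s01 t01; rewrite /= hw // pev_mkp clamp_id.
Qed.

Lemma chain_pt0 i f s : s <= 0 -> chain_pt i (f, s) = chain_pt i (point, 0).
Proof.
move=> s0; apply/eqmodP; apply/eqP.
by rewrite /chain_code /= !val_to01 clamp_le0 // clamp0 eqxx.
Qed.

Lemma chain_pt1 i f s : 1 <= s -> chain_pt i (f, s) = chain_pt i (point, 1).
Proof.
move=> s0; apply/eqmodP; apply/eqP.
by rewrite /chain_code /= !val_to01 clamp_ge1 // clamp1 oner_eq0 eqxx.
Qed.

Lemma chain_pt_next (i j : 'I_m) f g : j = i.+1 :> nat ->
  chain_pt i (f, 1) = chain_pt j (g, 0).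
Proof.
move=> ij; apply/eqmodP; apply/eqP.
by rewrite /chain_code /= !val_to01 clamp0 clamp1 oner_eq0 !eqxx ij.
Qed.

End chain.

Section chain_vertices.
Context R (F : ptopologicalType) (m : nat).

(** The [m + 2] cone points of a chain of [m + 1] suspensions. The last one is not the bottom of any
    suspension, hence the second branch. *)
Definition chain_vtx (i : nat) : chain R F m.+1 :=
  if (i <= m)%N then chain_pt (inord i) (point, 0) else chain_pt ord_max (point, 1).

Lemma chain_pt_vtx0 (i : 'I_m.+1) f s : s <= 0 -> chain_pt i (f, s) = chain_vtx i.
Proof.
move=> s0; rewrite chain_pt0 // /chain_vtx -ltnS ltn_ord.
by congr chain_pt; apply: val_inj; rewrite /= inordK.
Qed.

Lemma chain_pt_vtx1 (i : 'I_m.+1) f s : 1 <= s -> chain_pt i (f, s) = chain_vtx i.+1.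
Proof.
move=> s1; rewrite chain_pt1 // /chain_vtx; case: ifPn => [im|].
  by apply: chain_pt_next; rewrite inordK.
rewrite -leqNgt => im; congr chain_pt; apply: val_inj => /=.
by apply/eqP; rewrite eqn_leq -ltnS ltn_ord -ltnS.
Qed.

End chain_vertices.

(** * Telescopes over a contractible space *)

Section contractible_telescope.
Context R Y (D : nat -> set Y) (m : nat).
Context (clD : forall i, closed (D i)).
Context (y0 : Y) (kappa : Y * R -> Y).
Context (ckappa : cts kappa) (kappa0 : forall y, kappa (y, 0) = y).
Context (kappa1 : forall y, kappa (y, 1) = y0).
Context (F : ptopologicalType) (hD : forall i, exists th : D i -> F, heq R th).

Let E := tel R D m.+1.

(** Total in [i], with a junk value out of range, so that it can serve in families indexed by [nat];
    likewise [tb]. *)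
Let cp (i : nat) (y : Y) : E := match pselect (i <= m.+1)%N with
  | left h => tel_copy R D h y | right _ => tel_first R D m.+1 y end.

Let tb (i : nat) (z : D i * R) : E := match pselect (i < m.+1)%N with
  | left h => tel_tube h z | right _ => tel_first R D m.+1 (set_val z.1) end.

Let cpE i (h : (i <= m.+1)%N) y : cp i y = tel_copy R D h y.
Proof. by rewrite /cp; case: pselect => // h'; congr tel_copy; exact: bool_irrelevance. Qed.

Let tbE i (h : (i < m.+1)%N) z : tb z = tel_tube (i := i) h z.
Proof. by rewrite /tb; case: pselect => // h'; congr tel_tube; exact: bool_irrelevance. Qed.

Let ccp i : cts (cp i).
Proof.
rewrite /cp; case: pselect => [h|_]; first exact: cts_tel_copy.
exact: (@cts_tel_copy R Y D m.+1 0 (leq0n _)).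
Qed.

Let ctb i : cts (@tb i).
Proof.
rewrite /tb; case: pselect => [h|_]; first exact: cts_tel_tube.
apply: (cts_comp (@cts_tel_copy R Y D m.+1 0 (leq0n _))).
by ctsify.
Qed.

Let tb0 i (a : D i) t : (i < m.+1)%N -> t <= 0 -> tb (a, t) = cp i (set_val a).
Proof. by move=> h t0; rewrite (tbE h) tel_tube0 // (cpE (ltnW h)). Qed.

Let tb1 i (a : D i) t : (i < m.+1)%N -> 1 <= t -> tb (a, t) = cp i.+1 (set_val a).
Proof. by move=> h t0; rewrite (tbE h) tel_tube1 // (cpE h). Qed.

Let ka (y : Y) (t : R) := kappa (y, clamp t).

(* Time [t] of the homotopy that contracts all copies of [Y] while stretching the
   tubes over the tracks of the contraction. *)
Let G (i : nat) (z : D i * R * R) : E :=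
  let a := z.1.1 in let s := z.1.2 in let t := clamp z.2 in
  if 3 * s - t <= 0 then cp i (ka (set_val a) (t - 3 * s))
  else if 3 * s - 3 + t <= 0 then tb (a, (3 * s - t) * (3 - 2 * t)^-1)
  else cp i.+1 (ka (set_val a) (3 * s - 3 + t)).

(** The pieces are [s <= t / 3], the tube on the middle part of length [(3 - 2 t) / 3], and
    [s >= 1 - t / 3]. They match because [kappa] starts at the identity. *)
Let cG i : (i < m.+1)%N -> cts (@G i).
Proof.
move=> im; rewrite /G /=.
have den (z : D i * R * R) : 3 - 2 * clamp z.2 != 0.
  by have /andP[h0 h1] := clamp01 z.2; apply/eqP; lra.
have c1 := @ccp i; have c2 := @ccp i.+1; have c3 := @ctb i.
have ci : cts (fun z : D i * R * R => (3 - 2 * clamp z.2)^-1).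
  by apply: cts_inv => //; ctsify.
apply: cts_if; [by ctsify|by rewrite /ka; ctsify|apply: cts_if|].
- by ctsify.
- by ctsify.
- by rewrite /ka; ctsify.
- move=> z e; rewrite /ka e clamp0 kappa0 tb1 //.
  rewrite ler_pdivlMr ?mul1r; first by lra.
  by have /andP[h0 h1] := clamp01 z.2; lra.
- move=> z e; have /andP[h0 h1] := clamp01 z.2.
  rewrite /ka (_ : clamp z.2 - 3 * z.1.2 = 0); last by lra.
  rewrite clamp0 kappa0 ifT; last by lra.
  by rewrite e mul0r tb0.
Qed.

Let th i : D i -> F := projT1 (cid (hD i)).

Let thP i : heq R (@th i). Proof. exact: (projT2 (cid (hD i))). Qed.

(** The map [a] sends each copy of [Y] to a cone point and each tube over [D i] to a suspension
    through [th]. Its inverse uses that [G] at time 1 starts and ends at [y0] in consecutive copies,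
    so it factors through a suspension. *)
Lemma contractible_telescope : exists a : E -> chain R F m.+1,
  heq R a /\ forall y, a (tel_first R D m.+1 y) = chain_pt ord0 (point, 0).
Proof.
pose wa i (z : D i * R) : chain R F m.+1 := chain_pt (inord i) (th z.1, z.2).
have cth i : cts (@th i) by have [] := thP i.
have cpt i := @cts_chain_pt R F m.+1 i.
have [||||a [ca aC aT]] := @tel_map R Y D clD m.+1 _ (fun i _ => chain_vtx R F m i) wa.
- by move=> i _; exact: cts_cst.
- by move=> i im; rewrite /wa; have h1 := cpt (inord i); have h2 := cth i; ctsify.
- by move=> i b im; rewrite /wa /= chain_pt_vtx0 // inordK.
- by move=> i b im; rewrite /wa /= chain_pt_vtx1 // inordK.
have ccpa i y : (i <= m.+1)%N -> a (cp i y) = chain_vtx R F m i.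
  by move=> h; rewrite (cpE h) aC.
have tba i z : (i < m.+1)%N -> a (tb z) = chain_pt (inord i) (@th i z.1, z.2).
  move=> im; case: z => b t /=.
  have -> : tb (b, t) = tb (b, clamp t).
    by rewrite !(tbE im); apply: val_inj; rewrite /= clampK.
  by rewrite (tbE im) aT ?clamp01 // /wa /= chain_pt_clamp.
have afirst y : a (tel_first R D m.+1 y) = chain_pt ord0 (point, 0).
  rewrite -[tel_first _ _ _ _]/(tel_copy R D (leq0n m.+1) y) aC /chain_vtx leq0n.
  by congr chain_pt; apply: val_inj; rewrite /= inordK.
pose thV i : F -> D i := projT1 (cid (thP i).2).
have [thVc thVK thKV] : [/\ forall i, cts (thV i), forall i, htp R (fun x => thV i (th x)) id
    & forall i, htp R (fun x => @th i (thV i x)) id].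
  by split=> i; have [] := projT2 (cid (thP i).2).
have G0 i (b : D i) t : 0 <= t <= 1 -> G (b, 0, t) = cp i (ka (set_val b) t).
  move=> t01; rewrite /G /= mulr0 sub0r subr0 (clamp_id t01) ifT //.
  by case/andP: t01; lra.
have G1 i (b : D i) t : (i < m.+1)%N -> 0 <= t <= 1 -> G (b, 1, t) = cp i.+1 (ka (set_val b) t).
  move=> im t01; rewrite /G /= (clamp_id t01) mulr1; case/andP: t01 => t0 t1.
  rewrite ifF; last by apply/negbTE; rewrite -ltNge; lra.
  have -> : 3 - 3 + t = t by lra.
  case: ifP => // t0'; have -> : t = 0 by lra.
  by rewrite /ka clamp0 kappa0 tb1 // mulr0 !subr0 divff.
have Gs i (b : D i) s : (i < m.+1)%N -> 0 <= s <= 1 -> G (b, s, 0) = tb (b, s).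
  move=> im /andP[s0 s1]; rewrite /G /= clamp0 subr0; case: ifP => [s0'|_].
    have -> : s = 0 by lra.
    by rewrite mulr0 subr0 /ka clamp0 kappa0 tb0.
  rewrite ifT; last by lra.
  by rewrite mulr0 subr0 mulrAC divff // mul1r.
have Ga i (b : D i) s : (i < m.+1)%N -> a (G (b, s, 1)) = chain_pt (inord i) (th b, 3 * s - 1).
  move=> im; rewrite /G /= clamp1; case: ifP => h1.
    by rewrite ccpa ?(ltnW im) // chain_pt_vtx0 ?inordK //; lra.
  case: ifP => h2.
    rewrite tba //=; congr chain_pt; congr (_, _).
    by rewrite (_ : 3 - 2 * 1 = 1) ?invr1 ?mulr1 //; lra.
  by rewrite ccpa // chain_pt_vtx1 ?inordK //; lra.
have cGt i (im : (i < m.+1)%N) := cG im.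
have [|||b [cb bE]] := @chain_map R F m.+1 E (fun i => cp i y0)
    (fun i z => G (thV i z.1, z.2, 1)).
- move=> i; have h := cGt i (ltn_ord i); have h2 := thVc i; ctsify.
- by move=> i f /=; rewrite G0 ?itv11 // /ka clamp1 kappa1.
- by move=> i f /=; rewrite G1 ?itv11 ?ltn_ord // /ka clamp1 kappa1.
have ba_cp i y : (i <= m.+1)%N -> b (a (cp i y)) = cp i y0.
  move=> im; rewrite ccpa //; case: (leqP i m) => [i'|i'].
    have -> : chain_vtx R F m i = chain_pt (inord i) (point, 0).
      by rewrite chain_pt_vtx0 // inordK.
    by rewrite bE ?itv01 // G0 ?itv11 // /ka clamp1 kappa1 inordK.
  have {i'}im : i = m.+1 by apply/eqP; rewrite eqn_leq im.
  have -> : chain_vtx R F m i = chain_pt ord_max (point, 1) by rewrite chain_pt_vtx1 // im.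
  by rewrite bE ?itv11 // G1 ?itv11 // /ka clamp1 kappa1 im.
exists a; split=> //; split=> //; exists b; split=> //.
- have [||||h1 [ch1 h1C h1T]] := @tel_htp R Y D clD m.+1 E
      (fun i z => cp i (ka z.1 z.2)) (fun i => @G i).
  + by move=> i _; rewrite /ka; have h := @ccp i; ctsify.
  + by move=> i; exact: cG.
  + by move=> i c t im t01; rewrite G0.
  + by move=> i c t im t01; rewrite G1.
  pose K i : D i * R -> D i := projT1 (cid (thVK i)).
  have [cK K0 K1] : [/\ forall i, cts (K i), forall i x, K i (x, 0) = thV i (th x)
      & forall i x, K i (x, 1) = x].
    by split=> i; have [] := projT2 (cid (thVK i)).
  (* [h1] stretches the tubes from the identity to [G] at time 1; [h2] replaces [thV th] by the
     identity inside that final map. *)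
  have [||||h2 [ch2 h2C h2T]] := @tel_htp R Y D clD m.+1 E
      (fun i _ => cp i y0) (fun i z => G (K i (z.1.1, z.2), z.1.2, 1)).
  + by move=> i _; exact: cts_cst.
  + by move=> i im; have h := cGt i im; have h' := cK i; ctsify.
  + by move=> i c t im t01; rewrite /= G0 ?itv11 // /ka clamp1 kappa1.
  + by move=> i c t im t01; rewrite /= G1 ?itv11 // /ka clamp1 kappa1.
  apply: (@htp_trans _ _ _ (fun z => h2 (z, 1))).
    exists h2; split=> // z.
    have [[i [im [y ->]]]|[i [im [c [t [t01 ->]]]]]] := tel_surj z.
      by rewrite h2C ?itv01 // -(cpE im) ba_cp.
    by rewrite h2T ?itv01 //= K0 -(tbE im) tba //= bE // inordK.
  apply/htp_sym; exists h1; split=> // z.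
    have [[i [im [y ->]]]|[i [im [c [t [t01 ->]]]]]] := tel_surj z.
      by rewrite h1C ?itv01 //= /ka clamp0 kappa0 cpE.
    by rewrite h1T ?itv01 // Gs // tbE.
  have [[i [im [y ->]]]|[i [im [c [t [t01 ->]]]]]] := tel_surj z.
    by rewrite h1C ?itv11 // h2C ?itv11 // /ka /= clamp1 kappa1.
  by rewrite h1T ?itv11 // h2T ?itv11 // K1.
- pose K i : F * R -> F := projT1 (cid (thKV i)).
  have [cK K0 K1] : [/\ forall i, cts (K i), forall i x, K i (x, 0) = @th i (thV i x)
      & forall i x, K i (x, 1) = x].
    by split=> i; have [] := projT2 (cid (thKV i)).
  (* The composite reads the parameter [clamp (3 s - 1)], the outer thirds being spent on tracks of
     [kappa]; it is interpolated to [s] while [K] undoes [th thV]. *)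
  have [|||h [ch hE]] := @chain_htp R F m.+1 (chain R F m.+1) (fun i _ => chain_vtx R F m i)
    (fun i z => chain_pt i (K i (z.1.1, z.2), (1 - z.2) * clamp (3 * z.1.2 - 1) + z.2 * z.1.2)).
  + by move=> i; have h1 := cpt i; have h2 := cK i; ctsify.
  + move=> i f t /andP[t0 t1] /=; rewrite chain_pt_vtx0 //.
    by rewrite !mulr0 addr0 clamp_le0 ?mulr0 //; lra.
  + move=> i f t /andP[t0 t1] /=; rewrite chain_pt_vtx1 //.
    by rewrite (@clamp_ge1 R (3 * 1 - 1)); lra.
  exists h; split=> // z; have [i [f [s [s01 ->]]]] := chain_surj z.
    rewrite hE ?itv01 //= subr0 mul1r mul0r addr0 K0 bE //= Ga // chain_pt_clamp.
    by congr chain_pt; apply: val_inj; rewrite /= inordK.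
  by rewrite hE ?itv11 //= subrr !mul0r add0r mul1r K1.
Qed.

End contractible_telescope.

(** * Wedges of reduced suspensions and the collapse of a chain *)

Section wedge_of_suspensions.
Context R (F : ptopologicalType) (m : nat).

Definition susp_wedge : ptopologicalType :=
  pwedge (fun _ : 'I_m.+1 => suspension R F).

Local Notation susp_lift i :=
  (@wedge_lift _ (fun _ : 'I_m.+1 => suspension R F : topologicalType) (fun _ => point) i).

Definition wedge_pt (i : 'I_m.+1) (z : F * R) : susp_wedge :=
  susp_lift i
    (\pi_(suspension R F)%qT (z.1, to01 z.2)).

Lemma cts_susp_pi Z (f : Z -> F * I01 R) :
  cts f -> cts (fun z => \pi_(suspension R F)%qT (f z) : suspension R F).
Proof.
have h1 : cts (fun u : F * I01 R => \pi_(suspension R F)%qT u : suspension R F).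
  by exact: pi_continuous.
exact: cts_comp.
Qed.

Lemma cts_wedge_pt i : cts (wedge_pt i).
Proof.
have h2 : cts (fun z : F * R => \pi_(suspension R F)%qT (z.1, to01 z.2) : suspension R F).
  by apply: cts_susp_pi; ctsify.
have h1 : cts (susp_lift i) by exact: wedge_lift_continuous.
exact: (cts_comp h1 h2).
Qed.

Lemma susp_collapse (z : F * I01 R) : susp_collapsed z ->
  \pi_(suspension R F)%qT z = point :> suspension R F.
Proof.
move=> h; apply/eqmodP; rewrite /= /susp_rel_def; apply/orP; right.
by apply/andP; split; rewrite inE; [exact: h|]; apply: Or31.
Qed.

Lemma wedge_pt_collapse i f s : (s <= 0 \/ 1 <= s) \/ f = point ->
  wedge_pt i (f, s) = point.
Proof.
move=> h; rewrite /wedge_pt susp_collapse.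
  exact: (@wedge_liftE _ (fun _ : 'I_m.+1 => suspension R F : topologicalType)
    (fun _ => point) point point i point).
case: h => [[h|h]|h].
- by constructor 1; rewrite /= -to01_0 -to01_clamp clamp_le0.
- by constructor 2; rewrite /= -to01_1 -to01_clamp clamp_ge1 // to01_1.
- by constructor 3.
Qed.

Lemma wedge_surj (z : susp_wedge) : exists i f s, 0 <= s <= 1 /\ z = wedge_pt i (f, s).
Proof.
have [i _ [x _ <-]] : (\bigcup_i (susp_lift i) @` setT) z by rewrite wedgeTE.
rewrite -[x](@reprK _ (suspension R F)); case: (repr x) => f s.
by exists i, f, (set_val s); split; [exact: I01P|rewrite /wedge_pt /= to01K].
Qed.

Lemma wedge_map V (c : V) (w : 'I_m.+1 -> F * R -> V) :
  (forall i, cts (w i)) -> (forall i f, w i (f, 0) = c) -> (forall i f, w i (f, 1) = c) ->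
  (forall i s, 0 <= s <= 1 -> w i (point, s) = c) ->
  exists h : susp_wedge -> V, cts h /\
    forall i f s, 0 <= s <= 1 -> h (wedge_pt i (f, s)) = w i (f, s).
Proof.
move=> cw w0 w1 wp.
pose g i (z : F * I01 R) := w i (z.1, set_val z.2).
have gcol i z : susp_collapsed z -> g i z = c.
  rewrite /g; case: z => f s [/= ->|/= ->|/= ->]; rewrite ?val_zero ?val_one //.
  by rewrite wp // I01P.
have gE i u v : susp_rel R F u v -> g i u = g i v.
  move=> /orP[/eqP -> //|/andP[]]; rewrite !inE => /(gcol i) -> /(gcol i) ->//.
have gpi i z : g i (repr (\pi_(suspension R F)%qT z)) = g i z.
  by apply: gE; apply/eqmodP; rewrite reprK.
pose s i (z : suspension R F) := g i (repr z).
have cs i : continuous (s i).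
  apply/(@quotient_continuous _ (suspension R F)).
  have ci := cw i.
  apply: (@cts_ext _ _ (g i)); first by move=> z; rewrite /s /= gpi.
  by rewrite /g; ctsify.
have sp i : s i point = c by rewrite /s gpi; apply: gcol; constructor 1.
exists (wedge_fun s); split.
  by apply: wedge_fun_continuous => // i j; rewrite !sp.
move=> i f t t01; rewrite /wedge_pt wedge_lift_funE; last by move=> i' j'; rewrite !sp.
by rewrite /s gpi /g /= val_to01 clamp_id.
Qed.

Lemma wedge_htp V (c : R -> V) (w : 'I_m.+1 -> F * R * R -> V) :
  (forall i, cts (w i)) ->
  (forall i f t, 0 <= t <= 1 -> w i (f, 0, t) = c t) ->
  (forall i f t, 0 <= t <= 1 -> w i (f, 1, t) = c t) ->
  (forall i s t, 0 <= s <= 1 -> 0 <= t <= 1 -> w i (point, s, t) = c t) ->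
  exists h : susp_wedge * R -> V, cts h /\
    forall i f s t, 0 <= s <= 1 -> 0 <= t <= 1 -> h (wedge_pt i (f, s), t) = w i (f, s, t).
Proof.
move=> cw w0 w1 wp.
have cw1 i z : cts (fun t => w i (z, t)) by have ci := cw i; ctsify.
(* [c] is not assumed continuous; on [0, 1] it is realised by [w] at the base point. *)
pose c0 := mkp (cw1 ord0 (point, 0)).
have c0E u : (forall t, 0 <= t <= 1 -> pev u t = c t) -> u = c0.
  by move=> hu; apply: pathsp_ext => t t01; rewrite hu // pev_mkp clamp_id // w0.
have [||||h [ch hw]] := @wedge_map (pathsp R V) c0 (fun i z => mkp (cw1 i z)).
- by move=> i; have ci := cw i; apply: cts_pathsp_mkp; ctsify.
- by move=> i f; apply: c0E => t t01; rewrite pev_mkp clamp_id // w0.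
- by move=> i f; apply: c0E => t t01; rewrite pev_mkp clamp_id // w1.
- by move=> i s s01; apply: c0E => t t01; rewrite pev_mkp clamp_id // wp.
exists (fun z => pev (h z.1) z.2); split; first by ctsify.
by move=> i f s t s01 t01; rewrite /= hw // pev_mkp clamp_id.
Qed.

(* The chain of arcs over the base point is contractible inside the chain of
   suspensions; collapsing it is an equivalence because the base point of [F] is
   nondegenerate, as witnessed by [v] and [k]. *)
Section collapse.
Context (v : F -> R) (k : F * R -> F).
Context (cv : cts v) (v0 : v point = 0) (ck : cts k).
Context (k0 : forall f, k (f, 0) = f) (kpt : forall t, k (point, t) = point).
Context (k1 : forall f, v f < 1 -> k (f, 1) = point).

Let T := chain R F m.+1.

(** A coordinate on the arc through the base points. That every value lies over the base point makes
    the collapse constant on [L], whatever its argument. *)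
Lemma chain_line : exists L : R -> T, [/\ cts L,
  forall (i : 'I_m.+1) s, 0 <= s <= 1 -> L (i%:R + s) = chain_pt i (point, s),
  L 0 = chain_pt ord0 (point, 0)
  & forall x, exists i s, L x = chain_pt i (point, s)].
Proof.
suff [L [cL L1 L2 L3 L4]] : exists L : R -> T, [/\ cts L,
  forall i s, (i < m.+1)%N -> 0 <= s <= 1 -> L (i%:R + s) = chain_pt (inord i) (point, s),
  L 0 = chain_pt ord0 (point, 0), L (m.+1)%:R = chain_vtx R F m m.+1
  & forall x, exists i s, L x = chain_pt i (point, s)].
  exists L; split=> // i s s01; rewrite L1 //.
  by congr chain_pt; apply: val_inj; rewrite /= inordK.
have h : forall j, (j <= m.+1)%N -> exists L : R -> T, [/\ cts L,
  forall i s, (i < j)%N -> 0 <= s <= 1 -> L (i%:R + s) = chain_pt (inord i) (point, s),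
  L 0 = chain_pt ord0 (point, 0), L j%:R = chain_vtx R F m j
  & forall x, exists i s, L x = chain_pt i (point, s)]; last exact: h.
elim=> [|j IH] jm.
  exists (fun _ => chain_pt ord0 (point, 0)); split=> //; first exact: cts_cst.
    by rewrite chain_pt_vtx0.
  by move=> x; exists ord0, 0.
have [L [cL L1 L2 L3 L4]] := IH (ltnW jm).
have cpt := @cts_chain_pt R F m.+1 (inord j).
exists (fun x => if x - j%:R <= 0 then L x else chain_pt (inord j) (point, x - j%:R)); split.
- apply: cts_if; [by ctsify..|move=> x e].
  have -> : x = j%:R by lra.
  by rewrite L3 subrr chain_pt_vtx0 // inordK.
- move=> i s; rewrite ltnS leq_eqVlt => /orP[/eqP -> |ij] /andP[s0 s1].
    rewrite (_ : j%:R + s - j%:R = s); last by lra.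
    case: ifP => // s0'.
    have -> : s = 0 by lra.
    by rewrite addr0 L3 chain_pt_vtx0 // inordK.
  rewrite ifT; first by rewrite L1 // s0.
  have : i.+1%:R <= j%:R :> R by rewrite ler_nat.
  by rewrite -natr1; lra.
- by rewrite sub0r oppr_le0 ler0n.
- rewrite (_ : j.+1%:R - j%:R = 1 :> R); last by rewrite -natr1; lra.
  rewrite ifF; last by apply/negbTE; rewrite -ltNge.
  by rewrite chain_pt_vtx1 // inordK.
- by move=> x; case: ifP => _; [exact: L4|exists (inord j), (x - j%:R)].
Qed.

(** The inverse [p] sends the summand [i] to a round trip from [L 0]: along the line to cone point
    [i], across the suspension, and back from cone point [i + 1]. In [Om] at time [t] the trip
    starts at [L ((1 - t) i)] and ends at [L ((1 - t) (i + 1))]. *)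
Lemma chain_collapse : exists q : T -> susp_wedge,
  heq R q /\ q (chain_pt ord0 (point, 0)) = point.
Proof.
have [L [cL LE L0 Lex]] := chain_line.
have cpt i := @cts_chain_pt R F m.+1 i.
have cwp i := cts_wedge_pt i.
have [|||q [cq qE]] := @chain_map R F m.+1 susp_wedge (fun _ => point) wedge_pt.
- by [].
- by move=> i f; apply: wedge_pt_collapse; left; left.
- by move=> i f; apply: wedge_pt_collapse; left; right.
have qE' i f s : q (chain_pt i (f, s)) = wedge_pt i (f, s).
  by rewrite -chain_pt_clamp qE ?clamp01 // /wedge_pt /= to01_clamp.
have qL x : q (L x) = point.
  by have [i [s ->]] := Lex x; rewrite qE'; apply: wedge_pt_collapse; right.
have Lvtx i : (i <= m.+1)%N -> L i%:R = chain_vtx R F m i.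
  rewrite leq_eqVlt => /orP[/eqP ->|im].
    have := LE ord_max 1 (itv11 R); rewrite /= natr1 => ->.
    by rewrite chain_pt_vtx1.
  have := LE (inord i) 0 (itv01 R); rewrite inordK // addr0 => ->.
  by rewrite chain_pt_vtx0 // inordK.
(* At time 1 it sends the region [v <= 1/2] to the base point; it fades out to the identity where
   [v >= 1]. *)
pose kk (f : F) (t : R) := k (f, t * clamp (2 - 2 * v f)).
have ckk Z (f : Z -> F) (t : Z -> R) : cts f -> cts t ->
    cts (fun z => kk (f z) (t z)).
  by move=> cf ct; rewrite /kk; ctsify.
have kk0 f : kk f 0 = f by rewrite /kk mul0r k0.
have kkp t : kk point t = point by rewrite /kk kpt.
have kk1 f : 2 * v f - 1 <= 0 -> kk f 1 = point.
  by move=> h; rewrite /kk mul1r clamp_ge1 ?k1 //; lra.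
(* position on the line at time [t] of the point [s] of the [i]-th loop *)
pose chi (s t : R) := clamp ((3 * s - t) * (3 - 2 * t)^-1).
(* The real coordinate of the round trip when the crossing, too, runs over the base point: the
   maxima are nonzero only on the outward and the return part, and [chi] is 0 before the crossing
   and 1 after it. *)
pose lam (i : 'I_m.+1) (s t : R) : R :=
  i%:R - i%:R * Num.max 0 (t - 3 * s) + chi s t - (i%:R + 1) * Num.max 0 (3 * s - 3 + t).
(* Over the base point itself the round trip must become constant at time 1, so there the line is
   contracted instead. For [v <= 1/2] everything lies on the line, and the coordinates of the
   contraction ([v = 0]) and of the round trip ([v = 1/2]) are interpolated. *)
pose Om (i : 'I_m.+1) (z : F * R * R) : T :=
  let f := z.1.1 in let s := z.1.2 in let t := clamp z.2 in
  if 2 * v f - 1 <= 0 then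
    L ((1 - clamp (2 * v f)) * (1 - t) * (i%:R + s) + clamp (2 * v f) * lam i s t)
  else if 3 * s - t <= 0 then L (i%:R - i%:R * (t - 3 * s))
  else if 3 * s - 3 + t <= 0 then chain_pt i (kk f 1, chi s t)
  else L ((i%:R + 1) - (i%:R + 1) * (3 * s - 3 + t)).
have den (t : R) : 0 < 3 - 2 * clamp t by have /andP[h0 h1] := clamp01 t; lra.
have cchi Z (s t : Z -> R) : cts s -> cts t ->
    cts (fun z => chi (s z) (clamp (t z))).
  move=> cs ct; have h : cts (fun z => (3 - 2 * clamp (t z))^-1).
    by apply: cts_inv => [z|]; [rewrite gt_eqF|ctsify].
  by rewrite /chi; ctsify.
have chi_lo s t : 3 * s - clamp t <= 0 -> chi s (clamp t) = 0.
  by move=> h; rewrite /chi clamp_le0 // mulr_le0_ge0 // invr_ge0 ltW.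
have chi_hi s t : 0 <= 3 * s - 3 + clamp t -> chi s (clamp t) = 1.
  by move=> h; rewrite /chi clamp_ge1 // ler_pdivlMr //; lra.
have cOm i : cts (Om i).
  rewrite /Om /=.
  have c1 : cts (fun z : F * R * R => chi z.1.2 (clamp z.2)) by apply: cchi; ctsify.
  have c2 : cts (fun z : F * R * R => kk z.1.1 1) by apply: ckk; ctsify.
  have ci := cpt i.
  apply: cts_if; [by ctsify| |apply: cts_if; [by ctsify|by ctsify|apply: cts_if|]|].
  - by rewrite /lam; ctsify.
  - by ctsify.
  - by ctsify.
  - by ctsify.
  - move=> z e; rewrite chi_hi ?e // mulr0 subr0 chain_pt_vtx1 // -Lvtx ?ltn_ord //.
    by rewrite -natr1.
  - move=> z e; have /andP[h0 h1] := clamp01 z.2.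
    rewrite ifT; last by lra.
    rewrite (_ : clamp z.2 - 3 * z.1.2 = 0); last by lra.
    rewrite mulr0 subr0 Lvtx; last exact: ltnW.
    by rewrite chi_lo ?e // chain_pt_vtx0.
  - move=> z e; have /andP[h0 h1] := clamp01 z.2.
    have -> : clamp (2 * v z.1.1) = 1 by apply: clamp_ge1; lra.
    rewrite subrr !mul0r add0r mul1r /lam; case: ifP => h2.
      rewrite chi_lo // (max_idPr (_ : 0 <= clamp z.2 - 3 * z.1.2)); last by lra.
      rewrite (max_idPl (_ : 3 * z.1.2 - 3 + clamp z.2 <= 0)); last by lra.
      by congr L; lra.
    rewrite (max_idPl (_ : clamp z.2 - 3 * z.1.2 <= 0)); last by move/negbT: h2; rewrite -ltNge; lra.
    rewrite mulr0 subr0; case: ifP => h3.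
      rewrite (max_idPl h3) mulr0 subr0 LE ?clamp01 //.
      by rewrite kk1 // e.
    move/negbT: h3; rewrite -ltNge => h3.
    rewrite (max_idPr (ltW h3)) chi_hi ?(ltW h3) //.
have Om0 i f t : 0 <= t <= 1 -> Om i (f, 0, t) = L ((1 - t) * i%:R).
  move=> t01; rewrite /Om /= (clamp_id t01) !mulr0 !addr0; case/andP: (t01) => t0 t1.
  have -> : (0 - t <= 0) = true by apply/idP; lra.
  case: ifP => h; last by congr L; lra.
  have e0 : chi 0 t = 0 by have := @chi_lo 0 t; rewrite (clamp_id t01); apply; lra.
  rewrite /lam e0 mulr0 subr0 (max_idPr t0) (max_idPl (_ : 0 - 3 + t <= 0)); last by lra.
  by congr L; lra.
have Om1 i f t : 0 <= t <= 1 -> Om i (f, 1, t) = L ((1 - t) * (i%:R + 1)).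
  move=> t01; rewrite /Om /= (clamp_id t01) !mulr1; case/andP: (t01) => t0 t1.
  case: ifP => h.
    have e1 : chi 1 t = 1 by have := @chi_hi 1 t; rewrite (clamp_id t01); apply; lra.
    rewrite /lam e1 mulr1 (max_idPl (_ : t - 3 <= 0)); last by lra.
    rewrite (max_idPr (_ : 0 <= 3 - 3 + t)); last by lra.
    by congr L; lra.
  rewrite ifF; last by apply/negbTE; rewrite -ltNge; lra.
  case: ifP => h2; last by congr L; lra.
  have t0' : t = 0 by lra.
  have e1 : chi 1 0 = 1 by have := @chi_hi 1 0; rewrite (clamp0 R); apply; lra.
  by rewrite t0' subr0 mul1r e1 chain_pt_vtx1 // natr1 Lvtx.
have Omp i s t : 0 <= t <= 1 -> Om i (point, s, t) = L ((1 - t) * (i%:R + s)).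
  move=> t01; rewrite /Om /= v0 mulr0 sub0r oppr_le0 ler01 clamp0 subr0 mul1r mul0r addr0.
  by rewrite (clamp_id t01).
have [||||p [cp pE]] := @wedge_map T (L 0) (fun i z => Om i (z, 1)).
- by move=> i; have ci := cOm i; ctsify.
- by move=> i f; rewrite Om0 ?itv11 // subrr mul0r.
- by move=> i f; rewrite Om1 ?itv11 // subrr mul0r.
- by move=> i s s01; rewrite Omp ?itv11 // subrr mul0r.
have OmS i f s : 0 <= s <= 1 -> Om i (f, s, 0) = chain_pt i (kk f 1, s).
  move=> /andP[s0 s1]; have s01 : 0 <= s <= 1 by rewrite s0.
  have chi0 : chi s 0 = s by rewrite /chi mulr0 !subr0 mulrAC divff // mul1r clamp_id.
  rewrite /Om /= clamp0 chi0; case: ifP => h.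
    rewrite /lam chi0 !subr0 sub0r mulr1 addr0.
    rewrite (max_idPl (_ : - (3 * s) <= 0)); last by lra.
    rewrite (max_idPl (_ : 3 * s - 3 <= 0)); last by lra.
    rewrite kk1 // -LE //; congr L; lra.
  rewrite subr0; case: ifP => h2.
    have -> : s = 0 by lra.
    by rewrite mulr0 subrr mulr0 subr0 Lvtx ?(ltnW (ltn_ord i)) // chain_pt_vtx0.
  by rewrite ifT // addr0; lra.
have vkk i t : 0 <= t <= 1 -> chain_pt i (kk point t, 0) = chain_vtx R F m i.
  by move=> _; rewrite chain_pt_vtx0.
exists q; split; last by rewrite qE'; apply: wedge_pt_collapse; right.
split=> //; exists p; split=> //.
- have [|||h1 [ch1 h1E]] := @chain_htp R F m.+1 T (fun i _ => chain_vtx R F m i)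
    (fun i z => chain_pt i (kk z.1.1 z.2, z.1.2)).
  + move=> i; have ci := cpt i.
    have c2 : cts (fun z : F * R * R => kk z.1.1 z.2) by apply: ckk; ctsify.
    by ctsify.
  + by move=> i f t t01; rewrite /= chain_pt_vtx0.
  + by move=> i f t t01; rewrite /= chain_pt_vtx1.
  have [|||h2 [ch2 h2E]] := @chain_htp R F m.+1 T (fun i t => L ((1 - t) * i%:R)) Om.
  + by [].
  + by move=> i f t t01; rewrite Om0.
  + by move=> i f t t01; rewrite Om1 // natr1.
  apply/htp_sym; apply: (@htp_trans _ _ _ (fun z => h1 (z, 1))).
    exists h1; split=> // z; have [i [f [s [s01 ->]]]] := chain_surj z.
    by rewrite h1E ?itv01 //= kk0.
  exists h2; split=> // z; have [i [f [s [s01 ->]]]] := chain_surj z.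
    by rewrite h1E ?h2E ?itv11 ?itv01 // OmS.
  by rewrite h2E ?itv11 //= qE' pE.
- have [||||h1 [ch1 h1E]] := @wedge_htp susp_wedge (fun _ => point)
    (fun i z => q (chain_pt i (kk z.1.1 z.2, z.1.2))).
  + move=> i; have ci := cpt i.
    have c2 : cts (fun z : F * R * R => kk z.1.1 z.2) by apply: ckk; ctsify.
    by ctsify.
  + by move=> i f t t01; rewrite /= qE'; apply: wedge_pt_collapse; left; left.
  + by move=> i f t t01; rewrite /= qE'; apply: wedge_pt_collapse; left; right.
  + by move=> i s t s01 t01; rewrite /= qE' kkp; apply: wedge_pt_collapse; right.
  (* [q] is constant on the line, so after composition with [q] the same [Om] respects the
     identifications of the wedge. *)
  have [||||h2 [ch2 h2E]] := @wedge_htp susp_wedge (fun _ => point) (fun i z => q (Om i z)).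
  + by move=> i; have ci := cOm i; ctsify.
  + by move=> i f t t01; rewrite Om0.
  + by move=> i f t t01; rewrite Om1.
  + by move=> i s t s01 t01; rewrite Omp.
  apply/htp_sym; apply: (@htp_trans _ _ _ (fun z => h1 (z, 1))).
    exists h1; split=> // z; have [i [f [s [s01 ->]]]] := wedge_surj z.
    by rewrite h1E ?itv01 //= kk0 qE'.
  exists h2; split=> // z; have [i [f [s [s01 ->]]]] := wedge_surj z.
    by rewrite h1E ?h2E ?itv11 ?itv01 // OmS.
  by rewrite h2E ?itv11 //= pE.
Qed.

End collapse.
End wedge_of_suspensions.

(** * Homotopy fibres and path spaces over a subspace *)

(** Compactness of the interval makes [g] vary uniformly in [t] near a given [z]. Used to measure
    how far a whole path is from the base point. *)
Lemma cts_sup R Z (g : Z * I01 R -> R) :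
  cts g -> (forall z, 0 <= g z <= 1) -> cts (fun z => sup (range (fun t => g (z, t)))).
Proof.
move=> cg g01.
have ub z : has_ubound (range (fun t => g (z, t))).
  by exists 1 => _ [t _ <-]; case/andP: (g01 (z, t)).
have ne z : range (fun t => g (z, t)) !=set0 by exists (g (z, zero)), zero.
have le z z' e : (forall t, g (z, t) <= g (z', t) + e) ->
    sup (range (fun t => g (z, t))) <= sup (range (fun t => g (z', t))) + e.
  move=> h; apply: ge_sup => // _ [t _ <-]; apply: le_trans (h t) _.
  by rewrite lerD2r; apply: ub_le_sup => //; exists t.
move=> z; apply/cvgrPdist_le => e e0.
have : \forall z' \near z, setT `<=` (fun t => `|g (z', t) - g (z, t)| < e).
  apply: (proj1 (compact_near_coveringP _) (@compact_I01 R)) => t _.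
  pose d (p : I01 R * Z) := g (p.2, p.1) - g (z, p.1).
  have cd : cts d by rewrite /d; ctsify.
  have := cd (t, z) => /cvgrPdist_lt /(_ e e0).
  apply: filterS => p; rewrite /d /= subrr.
  by rewrite sub0r normrN.
apply: filterS => z' hz'; rewrite ler_distl; apply/andP; split.
  rewrite lerBlDr; apply: le => t; have := hz' t Logic.I.
  by rewrite ltr_distl => /andP[_ /ltW]; rewrite addrC.
apply: le => t; have := hz' t Logic.I.
by rewrite ltr_distl ltrBlDr => /andP[/ltW].
Qed.

Local Notation ends_at R x0 := [set w : pathsp R%type _ | pev w 1 = x0].

Section based_paths.
Context R X.

Definition based (x0 : X) : topologicalType := set_type (ends_at R x0).

Lemma basedP x0 (w : based x0) : pev (set_val w) 1 = x0.
Proof. exact: (set_valP w). Qed.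

Definition based_over (B : set X) (x0 : X) : set (based x0) :=
  [set w | B (pev (set_val w) 0)].

Lemma based_overP B x0 (w : @based_over B x0) : B (pev (set_val (set_val w)) 0).
Proof. exact: (set_valP w). Qed.

Lemma based_cst_subproof (x0 : X) :
  (ends_at R x0) (mkp (@cts_cst_path R X x0)).
Proof. by rewrite /= pev_mkp. Qed.

Definition based_cst (x0 : X) : based x0 := SigSub (mem_set (based_cst_subproof x0)).

Lemma based_contraction (x0 : X) : exists kappa : based x0 * R -> based x0,
  [/\ cts kappa, forall w, kappa (w, 0) = w & forall w, kappa (w, 1) = based_cst x0].
Proof.
have kP (z : based x0 * R) : (ends_at R x0) (subp (set_val z.1) z.2 1).
  by rewrite /= subp1 basedP.
exists (corestr kP); split=> [|w|w].
- by apply: cts_corestr; ctsify.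
- by apply: val_inj; change (subp (set_val w) 0 1 = set_val w); rewrite subp_full.
- apply: val_inj; change (subp (set_val w) 1 1 = mkp (@cts_cst_path R X x0)).
  by apply: pathsp_ext => t _; rewrite pev_subp subrr mul0r addr0 basedP pev_mkp.
Qed.

(** A homeomorphism: the point of [A] stored in the homotopy fibre is the start of the path. *)
Lemma based_over_hofiber (A : set X) (a0 : A) :
  heqv R (@based_over A (set_val a0)) (hofiber R (set_val : A -> X) a0).
Proof.
set hofib := hofiber _ _ _.
have fP (w : @based_over A (set_val a0)) : hofiber_set (set_val : A -> X) a0
    (corestr (@based_overP A (set_val a0)) w, set_val (set_val (set_val w))).
  split=> /=; first exact: (set_valP (set_val (set_val w))).
    by rewrite -pev_zero.
  by rewrite -pev_one basedP.
pose f : _ -> hofib := corestr fP.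
have hP (z : hofib) : hofiber_set (set_val : A -> X) a0 (set_val z).
  exact: (set_valP z).
have g0 (z : hofib) :
    [set w : {compact-open, I01 R -> X} | continuous (w : I01 R -> X)] (set_val z).2.
  by have [] := hP z.
have g1 (z : hofib) :
    (ends_at R (set_val a0)) (corestr g0 z).
  rewrite /= pev_one; change (((set_val z).2 : I01 R -> X) one = set_val a0).
  by have [] := hP z.
have g2 (z : hofib) :
    @based_over A (set_val a0) (corestr g1 z).
  rewrite /based_over /= pev_zero; change (A (((set_val z).2 : I01 R -> X) zero)).
  by have [_ -> _] := hP z; exact: (set_valP (set_val z).1).
pose g := corestr g2.
have cf : cts f.
  apply: cts_corestr; apply: cts_pair; last by ctsify.
  by apply: cts_corestr; ctsify.
have cg : cts g.
  by apply: cts_corestr; apply: cts_corestr; apply: cts_corestr; ctsify.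
exists f; apply: (@heq_homeo _ _ (hofib) _ g cf cg).
- by move=> w; apply: val_inj; apply: val_inj; exact: val_inj.
- move=> z; apply: val_inj.
  have [h1 h2 _] := hP z.
  change ((corestr (@based_overP A (set_val a0)) (g z), (set_val z).2) = set_val z).
  rewrite [RHS]surjective_pairing; congr (_, _); apply: val_inj.
  change (pev (set_val (set_val (g z))) 0 = set_val (set_val z).1).
  by rewrite pev_zero -h2.
Qed.

Lemma based_over_translate_subproof (B : set X) (x0 x1 : X) (b : paths R x0 x1)
    (w : @based_over B x0) :
  (ends_at R x1) (catp (set_val (set_val w)) (set_val b)).
Proof. by rewrite /= catp1 ?basedP ?paths_zero ?paths_one. Qed.

Lemma based_over_translate_subproof2 (B : set X) (x0 x1 : X) (b : paths R x0 x1)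
    (w : @based_over B x0) :
  @based_over B x1 (corestr (@based_over_translate_subproof B x0 x1 b) w).
Proof. by rewrite /based_over /= catp0; exact: (based_overP w). Qed.

Definition translate (B : set X) (x0 x1 : X) (b : paths R x0 x1) :
    @based_over B x0 -> @based_over B x1 :=
  corestr (@based_over_translate_subproof2 B x0 x1 b).

Lemma cts_translate B x0 x1 (b : paths R x0 x1) : cts (@translate B x0 x1 b).
Proof.
apply: cts_corestr; apply: cts_corestr; ctsify.
by rewrite basedP paths_zero.
Qed.

Lemma translateK B x0 x1 (b : paths R x0 x1) :
  htp R (fun w => translate (revp b) (@translate B x0 x1 b w)) id.
Proof.
have e1 (z : @based_over B x0 * R) : pev (set_val (set_val z.1)) 1 = pev (subp (set_val b) 0 z.2) 0.
  by rewrite basedP subp0 paths_zero.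
have e2 (z : @based_over B x0 * R) :
    pev (catp (set_val (set_val z.1)) (subp (set_val b) 0 z.2)) 1 = pev (subp (set_val b) z.2 0) 0.
  by rewrite catp1 // subp0 subp1.
pose H (z : @based_over B x0 * R) :=
  catp (catp (set_val (set_val z.1)) (subp (set_val b) 0 z.2)) (subp (set_val b) z.2 0).
have cH : cts H by rewrite /H; ctsify; [exact: e2|exact: e1].
have H1 z : (ends_at R x0) (H z).
  by rewrite /H /= catp1 // subp1 paths_zero.
have H2 z : @based_over B x0 (corestr H1 z).
  rewrite /based_over /= /H !catp0; exact: (based_overP z.1).
have cH2 : cts (corestr H2) by apply: cts_corestr; apply: cts_corestr.
apply: (@htp_trans _ _ _ (fun w => corestr H2 (w, 0))).
  apply: htp_sym; exists (corestr H2); split=> // w.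
  by apply: val_inj; apply: val_inj; rewrite /= /H subp_full.
(* [based_over] is a subspace of a subspace, while [htp_reparam] works in one set of paths; both
   conditions are merged into [S] and the result is carried back by [s2]. *)
pose S := [set w : pathsp R X | pev w 1 = x0 /\ B (pev w 0)].
have SP (w : @based_over B x0) : S (set_val (set_val w)).
  by split; [exact: basedP|exact: (based_overP w)].
have s1 (u : S) : (ends_at R x0) (set_val u) by have [] := set_valP u.
have s2 (u : S) : @based_over B x0 (corestr s1 u) by have [] := set_valP u.
have cs2 : cts (corestr s2) by apply: cts_corestr; apply: cts_corestr; ctsify.
have send (u w : pathsp R X) : pev u 0 = pev w 0 -> pev u 1 = pev w 1 -> S u -> S w.
  by move=> e0 e1' [h1 h2]; split; rewrite -?e1' -?e0.
have HS w : S (H (w, 0)) by split; [exact: H1|exact: H2].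
have h21 : (1 : R) <= 2 - 0 by lra.
have K (w : @based_over B x0) : S (catp (set_val (set_val w)) (subp (set_val b) 0 0)).
  by split; rewrite ?catp1 ?catp0 ?subp1 ?paths_zero ?(e1 (w, 0)) //; exact: (based_overP w).
have cK : cts (fun w : @based_over B x0 => catp (set_val (set_val w)) (subp (set_val b) 0 0)).
  by ctsify; exact: (e1 (_, 0)).
have hc (w : pathsp R X) : pev w 1 = x0 -> catp w (subp (set_val b) 0 0) = reparam w 2 0 1.
  move=> h; apply: catp_cst_right => t.
  by rewrite pev_subp subrr mul0r addr0 paths_zero h.
have h1 : htp R (corestr HS) (corestr K).
  apply: (@htp_reparam _ _ _ _ (fun w => catp (set_val (set_val w)) (subp (set_val b) 0 0))
     2 0 _ _ (lexx 0) h21) => //.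
  move=> w.
  change (H (w, 0) = reparam (catp (set_val (set_val w)) (subp (set_val b) 0 0)) 2 0 1).
  rewrite /H.
  rewrite [LHS]hc //.
  by have [] := K w.
have h2 : htp R (corestr K) (corestr SP).
  apply: (@htp_reparam _ _ _ _ (fun w => set_val (set_val w)) 2 0 _ _ (lexx 0) h21) => //.
    by ctsify.
  move=> w.
  change (catp (set_val (set_val w)) (subp (set_val b) 0 0) = reparam (set_val (set_val w)) 2 0 1).
  by rewrite hc // basedP.
have {h1 h2} := htp_compl cs2 (htp_trans h1 h2).
congr htp; apply/funext => w; apply: val_inj; exact: val_inj.
Qed.

Lemma based_over_basepoint B x0 x1 (b : paths R x0 x1) :
  heqv R (@based_over B x0) (@based_over B x1).
Proof.
exists (translate b); split; first exact: cts_translate.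
exists (translate (revp b)); split; first exact: cts_translate.
  exact: translateK.
by have := @translateK B _ _ (revp b); rewrite revpK.
Qed.

End based_paths.

Lemma based_over_map R X Y (f : X -> Y) (g : Y -> X) (B : set Y) (x0 : X) :
  cts f -> cts g -> cancel f g -> cancel g f ->
  heqv R (@based_over R X (f @^-1` B) x0) (@based_over R Y B (f x0)).
Proof.
move=> cf cg fg gf.
pose W := [set w : pathsp R Y | pev w 1 = f x0].
pose WB := @based_over R Y B (f x0).
have hP (w : @based_over R X (f @^-1` B) x0) : W (mapp cf (set_val (set_val w))).
  by rewrite /W /= pev_mapp basedP.
have hP2 (w : @based_over R X (f @^-1` B) x0) : WB (corestr hP w).
  by rewrite /WB /based_over /= pev_mapp; exact: (based_overP w).
have kP (w : WB) : (ends_at R x0) (mapp cg (set_val (set_val w))).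
  by rewrite /= pev_mapp; have /= -> := set_valP (set_val w); rewrite fg.
have kP2 (w : WB) : @based_over R X (f @^-1` B) x0 (corestr kP w).
  by rewrite /based_over /= pev_mapp gf; exact: (set_valP w).
have ch : cts (corestr hP2).
  by apply: cts_corestr; apply: cts_corestr; ctsify.
have ck : cts (corestr kP2).
  by apply: cts_corestr; apply: cts_corestr; ctsify.
exists (corestr hP2); apply: (@heq_homeo _ _ (@based_over R Y B (f x0)) _ _ ch ck).
- move=> w; apply: val_inj; apply: val_inj; apply: pathsp_ext => t _.
  by rewrite pev_mapp [set_val (set_val (corestr _ _))]/= pev_mapp fg.
- move=> w; apply: val_inj; apply: val_inj; apply: pathsp_ext => t _.
  by rewrite pev_mapp [set_val (set_val (corestr _ _))]/= pev_mapp gf.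
Qed.

Section nondegenerate_fibre.
Context R X (A : set X) (a0 : A).
Context (rho : X * R -> X * R) (hrho : cyl_retraction [set set_val a0] rho).
Context (rhoA : forall x t, 0 <= t <= 1 -> A x -> A (rho (x, t)).1).

Let F := hofiber R (set_val : A -> X) a0.

Let path_of (z : F) : I01 R -> X := (set_val z).2.

(** The deformation of [X] towards [a0] is applied at every time of the path, and [v] is the
    supremum of [vX] along it: [v f < 1] puts the whole path where it is moved to [a0]. The start
    stays in [A] by [rhoA]. *)
Lemma hofiber_nondegenerate : exists (v : F -> R) (k : F * R -> F),
  [/\ cts v, v point = 0, cts k & [/\ forall f, k (f, 0) = f,
      forall t, k (point, t) = point & forall f, v f < 1 -> k (f, 1) = point]].
Proof.
have [crho rho0 rhoa rhoI] := hrho.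
(* Below 1 means that [rho] does not send [(x, 1)] to the bottom, hence sends it over [a0]. *)
pose vX x := 1 - (rho (x, 1)).2.
pose kX (x : X) (t : R) := (rho (x, clamp t)).1.
have vX01 x : 0 <= vX x <= 1.
  by have [/andP[h0 h1] _] := rhoI x 1 (itv11 R); rewrite /vX; apply/andP; split; lra.
have vXa : vX (set_val a0) = 0 by rewrite /vX rhoa ?itv11 //= subrr.
have kXa t : kX (set_val a0) t = set_val a0 by rewrite /kX rhoa ?clamp01.
have kX0 x : kX x 0 = x by rewrite /kX clamp0 rho0.
have kX1 x : vX x < 1 -> kX x 1 = set_val a0.
  rewrite /vX /kX clamp1 => h; have [_ [e|//]] := rhoI x 1 (itv11 R).
  by move: h; rewrite e subr0 ltxx.
have ckX Z (x : Z -> X) (t : Z -> R) : cts x -> cts t ->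
    cts (fun z => kX (x z) (t z)) by move=> cx ct; rewrite /kX; ctsify.
have FP (z : F) : hofiber_set (set_val : A -> X) a0 (set_val z) by exact: (set_valP z).
have cev : cts (fun z : F * I01 R => path_of z.1 z.2).
  apply: (@cts_uncurry R F X (fun z => (set_val z).2)); first by ctsify.
  by move=> z; have [] := FP z.
pose g (z : F * I01 R) := vX (path_of z.1 z.2).
have cg : cts g by rewrite /g /vX; ctsify.
pose v (z : F) := sup (range (fun t => g (z, t))).
have cv : cts v by apply: cts_sup => // z; exact: vX01.
have gv z t : g (z, t) <= v z.
  by apply: ub_le_sup; [exists 1 => _ [s _ <-]; case/andP: (vX01 ((set_val z).2 s))|exists t].
have kA (z : F * R) : A (kX (set_val (set_val z.1).1) z.2).
  by apply: rhoA; [exact: clamp01|exact: (set_valP (set_val z.1).1)].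
have kF (z : F * R) : hofiber_set (set_val : A -> X) a0
    (corestr kA z, (fun t => kX (path_of z.1 t) z.2)).
  have [h1 h2 h3] := FP z.1; split.
  - have ch1 : cts (path_of z.1) by exact: h1.
    have h : cts (fun t => kX (path_of z.1 t) z.2) by apply: ckX; ctsify.
    exact: h.
  - change (kX (path_of z.1 zero) z.2 = kX (set_val (set_val z.1).1) z.2).
    by rewrite {1}/path_of h2.
  - by change (kX (path_of z.1 one) z.2 = set_val a0); rewrite /path_of h3 kXa.
pose k : F * R -> F := corestr kF.
have ck : cts k.
  apply: cts_corestr; apply: cts_pair.
    by apply: cts_corestr; apply: ckX; ctsify.
  apply: cts_curry => /=.
  pose q (z : F * R * I01 R) := (z.1.1, z.2).
  have cq : cts q by rewrite /q; ctsify.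
  have cevq := cts_comp cev cq.
  by apply: ckX; [exact: cevq|ctsify].
have kE z (y : F) : kX (set_val (set_val z.1).1) z.2 = set_val (set_val y).1 ->
    (forall t, kX (path_of z.1 t) z.2 = path_of y t) -> k z = y.
  move=> h1 h2; apply: val_inj; rewrite [RHS]surjective_pairing.
  change ((corestr kA z, (fun t => kX (path_of z.1 t) z.2))
     = ((set_val y).1, (set_val y).2)).
  by congr (_, _); [exact: val_inj|exact: funext].
exists v, k; split=> //; last split.
- apply/le_anti/andP; split; last first.
    by apply: le_trans (gv point zero); case/andP: (vX01 (path_of point zero)).
  apply: ge_sup; first by exists (g (point, zero)), zero.
  by move=> _ [t _ <-]; rewrite /g; change (vX (set_val a0) <= 0); rewrite vXa.
- by move=> f; apply: kE => [|t]; rewrite kX0.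
- by move=> t; apply: kE => [|s]; exact: kXa.
- move=> f vf; have h t : kX (path_of f t) 1 = set_val a0.
    by apply: kX1; apply: le_lt_trans vf; exact: gv.
  apply: kE => [|t]; last exact: h.
  by have [_ e _] := FP f; have := h zero; rewrite /path_of e.
Qed.

End nondegenerate_fibre.

Section telescope_fibre.
Context R X (B : nat -> set X) (k : nat) (x0 : X).

Definition tel_proj (z : tel R B k) : X := (set_val z).1.

Lemma cts_tel_proj : cts tel_proj. Proof. by rewrite /tel_proj; ctsify. Qed.

Lemma tel_projK x : tel_proj (tel_first R B k x) = x. Proof. by []. Qed.

Let D (i : nat) : set (based R x0) := @based_over R X (B i) x0.

Let E := ret_fib R tel_proj x0.
Let e0 : E := @ret_fib_point R _ X tel_proj (tel_first R B k) tel_projK x0.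

(** A homeomorphism: a point of the fibre is a path ending at [x0] with a height, the point of [X]
    being the start of the path. *)
Lemma telescope_fibre : exists h : E -> tel R D k,
  heq R h /\ h e0 = tel_first R D k (based_cst R x0).
Proof.
have EP (z : E) := ret_fibP z.
have w1 (z : E) : (ends_at R x0) (set_val z).2 by have [] := EP z.
have hP (z : E) : @tel_set R _ D k (corestr w1 z, (set_val (set_val z).1).2).
  have [e _] := EP z; have [i [[ik ei]|[ik b ei]]] := set_valP (set_val z).1.
    by exists i; left.
  exists i; right; split=> //; rewrite /D /based_over /=.
  by change (B i (pev (set_val z).2 0)); rewrite e.
have gP (y : tel R D k) : @tel_set R _ B k (pev (set_val (set_val y).1) 0, (set_val y).2).
  by have [i [[ik ei]|[ik b ei]]] := set_valP y; exists i; [left|right].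
have gP2 (y : tel R D k) :
    [set z : tel R B k * pathsp R X | pev z.2 0 = tel_proj z.1 /\ pev z.2 1 = x0]
    (corestr gP y, set_val (set_val y).1).
  by split=> //=; exact: basedP.
have ch : cts (corestr hP).
  by apply: cts_corestr; apply: cts_pair; [apply: cts_corestr; ctsify|ctsify].
have cg : cts (corestr gP2).
  by apply: cts_corestr; apply: cts_pair; [apply: cts_corestr; ctsify|ctsify].
exists (corestr hP); split.
  apply: (@heq_homeo _ E (tel R D k) _ _ ch cg).
  - move=> z; apply: val_inj; rewrite [RHS]surjective_pairing.
    change ((corestr gP (corestr hP z), (set_val z).2) = ((set_val z).1, (set_val z).2)).
    congr (_, _); apply: val_inj; rewrite [RHS]surjective_pairing.
    change ((pev (set_val z).2 0, (set_val (set_val z).1).2) =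
      ((set_val (set_val z).1).1, (set_val (set_val z).1).2)).
    by have [-> _] := EP z.
  - move=> y; apply: val_inj; rewrite [RHS]surjective_pairing.
    change ((corestr w1 (corestr gP2 y), (set_val y).2) = ((set_val y).1, (set_val y).2)).
    by congr (_, _); exact: val_inj.
by apply: val_inj; congr (_, _); exact: val_inj.
Qed.

End telescope_fibre.

(** * The gluing *)

Lemma cyl_retraction_preimage R X Y (f : X -> Y) (g : Y -> X)
    (B : set Y) (rho : Y * R -> Y * R) :
  cts f -> cts g -> cancel f g -> cancel g f -> cyl_retraction B rho ->
  cyl_retraction (f @^-1` B) (fun z => (g (rho (f z.1, z.2)).1, (rho (f z.1, z.2)).2)).
Proof.
move=> cf cg fg gf [crho rho0 rhoB rhoI]; split=> [|x|x t Bx t01|x t t01] /=.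
- by ctsify.
- by rewrite rho0 fg.
- by rewrite rhoB //= fg.
- have [h1 h2] := rhoI (f x) t t01; split=> //.
  by case: h2 => [->|h2]; [left|right; rewrite gf].
Qed.

Lemma path_connected_paths R X (x y : X) :
  path_connected R X -> inhabited (paths R x y).
Proof.
move=> /(_ x y) [w].
have cw := @cts_path R X x y w.
have e : pev (mkp cw) 0 = x /\ pev (mkp cw) 1 = y.
  by rewrite !pev_mkp clamp0 clamp1 to01_0 to01_1 path_zero path_one.
exact: (inhabits (mkpaths e)).
Qed.

Lemma heqv_paths R X Y (f : X -> Y) (x : X) (y : Y) :
  heq R f -> f x = y -> heqv R (paths R x x) (paths R y y).
Proof.
move=> hf <-; have [cf _] := hf.
by exists (@path_map R X Y f cf x x); exact: heq_path_map.
Qed.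

Lemma pointed_homotopy_equivalent_refl R (X : ptopologicalType) :
  pointed_homotopy_equivalent R X X.
Proof.
have h : pointed_homotopic R (id : X -> X) id.
  by exists fst; split=> //; exact: (@cts_fst _ X (I01 R) id (@cts_id _)).
by exists id, id; split=> //; split=> //; exact: (@cts_id X).
Qed.

Section loops_of_gluing.
Context R (n : nat) (X : nat -> topologicalType).
Context (phi : forall i j : nat, X i -> X j).
Arguments phi : clear implicits.
Context (hphi : forall k, (1 < k <= n)%N -> homeomorphism (phi 1 k)).
Context (K : cw_structure R (X 1)) (pcX : path_connected R (X 1)).
Context (A2 : set (X 1)) (hA2 : subcomplex K A2).
Context (psi : X 1 -> X 1) (hpsi : homeomorphism psi) (a0 : A2).

Let F : ptopologicalType := hofiber R (set_val : A2 -> X 1) a0.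

Lemma glue_setS i : glue_set A2 psi i.+1 = psi @^-1` (glue_set A2 psi i).
Proof. by apply/seteqP; split=> x; rewrite /glue_set /preimage /mkset iterSr. Qed.

(** The sets are preimages of [A2] under powers of the homeomorphism [psi], so the retraction for
    [A2] is transported along [psi]. *)
Lemma glue_set_retraction i : exists rho : X 1 * R -> X 1 * R,
  cyl_retraction (glue_set A2 psi i) rho.
Proof.
elim: i => [|i [rho hrho]]; first exact: (subcomplex_retraction hA2).
have [cpsi [psi' [cpsi' h1 h2]]] := hpsi.
by rewrite glue_setS; eexists; exact: (cyl_retraction_preimage cpsi cpsi' h1 h2 hrho).
Qed.

Lemma glue_set_closed i : closed (glue_set A2 psi i).
Proof.
have [rho hrho] := glue_set_retraction i.
exact: (closed_cyl_retraction (cw_hausdorff K) hrho).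
Qed.

Lemma glue_set_hofiber i :
  heqv R (@based_over R (X 1) (glue_set A2 psi i) (set_val a0)) F.
Proof.
elim: i => [|i IH]; first exact: based_over_hofiber.
have [cpsi [psi' [cpsi' h1 h2]]] := hpsi.
rewrite glue_setS; apply: heqv_trans (based_over_map R _ _ cpsi cpsi' h1 h2) _.
have [b] := path_connected_paths (psi (set_val a0)) (set_val a0) pcX.
exact: heqv_trans (based_over_basepoint _ b) IH.
Qed.

(** [heqv_paths] lets free equivalences act on loops, so only the image of the base point is
    followed: through the first copy of the path space and the first cone point to the base point of
    the wedge. *)
Lemma loops_gluing m : (m.+2 <= n)%N ->
  let p := stage_first (P_stage phi A2 psi m) (set_val a0) in
  heqv R (loop_space R p)
    (loop_space R (set_val a0) * loop_space R (point : susp_wedge R F m))%type.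
Proof.
move=> mn p; set x0 := set_val a0.
have [c [hc cfirst _]] := tel_glued hphi hpsi glue_set_closed glue_set_retraction mn.
set B := glue_set A2 psi in c hc cfirst *.
pose D i : set (based R x0) := @based_over R (X 1) (B i) x0.
have clD i : closed (D i).
  have h : cts (fun w : based R x0 => pev (set_val w) 0) by ctsify.
  exact: (closed_preimage h (@glue_set_closed i)).
have [kappa [ck k0 k1]] := based_contraction R x0.
have [a [ha a1]] := contractible_telescope m clD ck k0 k1 (F := F) glue_set_hofiber.
have [rho [hrho rhoA]] := point_retraction x0 hA2.
have [v [k [cv v0 ck' [k0' kpt k1']]]] := hofiber_nondegenerate hrho rhoA.
have [q [hq q1]] := chain_collapse m cv v0 ck' k0' kpt k1'.
have [h [hh h1]] := telescope_fibre R B m.+1 x0.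
have ctf : cts (tel_first R B m.+1).
  exact: (@cts_tel_copy R (X 1) B m.+1 0 (leq0n _)).
have split := loops_retraction_split R (@cts_tel_proj R _ B m.+1) ctf (@tel_projK R _ B m.+1) x0.
apply: heqv_trans (loop_space_paths R p) _.
apply: heqv_trans (heqv_sym (heqv_paths hc (cfirst x0))) _.
apply: heqv_trans split _; apply: heqv_prod; first exact/heqv_sym/loop_space_paths.
apply: heqv_trans _ (heqv_sym (loop_space_paths R _)).
apply: heqv_paths (heq_comp (heq_comp hh ha) hq) _.
by rewrite h1 a1 q1.
Qed.

End loops_of_gluing.

Local Close Scope ring_scope.

Theorem theorem1p1 (R : realType) (n : nat) (hn : (2 <= n)%N)
  (X : nat -> topologicalType)
  (hcw : forall i, (1 <= i <= n)%N -> is_cw_complex R (X i))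
  (hpc : forall i, (1 <= i <= n)%N -> path_connected R (X i))
  (phi : forall i j : nat, X i -> X j)
  (hphi : forall i j, (1 <= i)%N -> (i < j)%N -> (j <= n)%N ->
     homeomorphism (phi i j))
  (K : cw_structure R (X 1)) (A1 A2 : set (X 1))
  (hA1 : subcomplex K A1) (hA2 : subcomplex K A2)
  (hA12 : homeomorphic A1 A2)
  (psi : X 1 -> X 1) (hpsi : homeomorphism psi)
  (hpsi1 : psi @` A1 = A2) (hpsi2 : psi @` A2 = A1)
  (a0 : A2) :
  exists F : ptopologicalType,
    pointed_homotopy_equivalent R F
      (pwedge (fun _ : 'I_(n - 2).+1 =>
         suspension R (hofiber R (set_val : A2 -> X 1) a0))) /\
    homotopy_equivalent R
      (loop_space R (P_first phi A2 psi n (set_val a0)))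
      (loop_space R (set_val a0) * loop_space R (point : F))%type.
Proof.
(* [F] is the wedge itself, with [(n - 2).+1 = n - 1] summands. *)
exists (susp_wedge R (hofiber R (set_val : A2 -> X 1) a0) (n - 2)).
split; first exact: pointed_homotopy_equivalent_refl.
apply: heqv_homotopy_equivalent.
apply: (@loops_gluing R n X phi _ K _ A2 hA2 psi hpsi a0 (n - 2)).
- by move=> k /andP[k1 kn]; exact: hphi.
- by apply: hpc; rewrite leqnn (leq_trans _ hn).
- by rewrite -addn2 subnK.
Qed.
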